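(* Let $p\in(1,\infty)$, let $k\in\mathbb{N}\cup\{0\}$ be a fixed nonnegative integer, and for $m\in\mathbb{N}$ let $\psi_m^S$ be the semiorthogonal spline wavelet of order $m$, i.e. $$\psi_m^S(x):=\sum_{\nu=0}^{2m-2}\frac{(-1)^\nu}{2^{m-1}}N_{2m}(\nu+1)N_{2m}^{(m)}(2x-\nu),\quad x\in\mathbb{R}.$$ Then, as $m\to\infty$, $$\|\widehat{{}_k\psi_m^S}\|_p=\frac{2^{3/p}}{(\sqrt{2\pi})^{1-1/p}}\cdot\frac{(2\pi-4\xi_2)^{-k}}{(\sqrt{2\Lambda_2mp})^{1/p}}\cdot\lambda_2^m\cdot\left(1+\mathcal{O}(m^{-1/2})\right),$$ where $$\lambda_2=\frac{\sin^2(\xi_2-\pi/2)\sin^2(\xi_2)}{(\pi/2-\xi_2)\xi_2^2}=0.69706\ldots,\qquad \Lambda_2=-\frac12\frac{d^2}{du^2}\ln\frac{\sin^2(u-\pi/2)\sin^2(u)}{(\pi/2-u)u^2}\Big|_{u=\xi_2}=1.2229\ldots,$$ and $\xi_2=0.2853\ldots$ is the unique solution in $(0,\pi/2)$ of the transcendental equation $$(2\pi\xi_2-4\xi_2^2)\cos(2\xi_2)+(3\xi_2-\pi)\sin(2\xi_2)=0.$$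
   Context: The Fourier transform is $\widehat f(\omega)=\frac{1}{\sqrt{2\pi}}\int_{\mathbb{R}}f(x)e^{-i x\omega}\,dx$; $\|\cdot\|_p$ is the $L_p(\mathbb{R})$ norm. For an integer $k$, ${}_kf$ denotes the function with $\widehat{{}_kf}(\omega)=(i\omega)^{-k}\widehat f(\omega)$. The B-spline of order $m$ is $N_m(x)=\frac{1}{(m-1)!}\sum_{\nu=0}^m(-1)^\nu\binom{m}{\nu}(x-\nu)_+^{m-1}$, equivalently $\widehat{N_m}(\omega)=\frac{1}{\sqrt{2\pi}}\left(e^{-i\omega/2}\frac{\sin(\omega/2)}{\omega/2}\right)^m$; $N_{2m}^{(m)}$ is the $m$-th derivative of $N_{2m}$.
   Formalization: The printed decimal value Λ₂ = 1.2229… contradicts its own defining formula, which at ξ₂ gives 1.12229…; the formal statement keeps the formula for Λ₂ and asserts the corrected decimals 1.12229…. *)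

(* Defs.v *)
From HB Require Import structures.
From mathcomp Require Import all_boot all_order all_algebra.
From mathcomp Require Import all_classical all_reals all_analysis.
From mathcomp Require Import complex.
Set Implicit Arguments.
Unset Strict Implicit.
Unset Printing Implicit Defensive.
Import Order.TTheory GRing.Theory Num.Theory.
Import numFieldNormedType.Exports.
Local Open Scope classical_set_scope.
Local Open Scope ring_scope.
Local Open Scope complex_scope.

(** The decimal representation of [x] begins with [a.ds]. *)
Definition decimal_prefix {R : realType} (a : nat) (ds : seq nat) (x : R) :
    Prop :=
  let d := a%:R + foldr (fun c y => (c%:R + y) / 10) 0 ds in
  d <= x < d + 10 ^- size ds.

Section Fourier.
Context {R : realType}.
Local Notation mu := (@lebesgue_measure R).

(** e^{i t} *)
Definition expi (t : R) : R[i] := cos t +i* sin t.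

Definition cintegral (F : R -> R[i]) : R[i] :=
  (\int[mu]_x complex.Re (F x)) +i* (\int[mu]_x complex.Im (F x)).

Definition fourier (f : R -> R) (w : R) : R[i] :=
  ((Num.sqrt (2 * pi))^-1)%:C *
  cintegral (fun x => (f x)%:C * expi (- (x * w))).

(** The Fourier transform of the function written _k f; at [w = 0] with
    [0 < k] the value is [0] because [0^-1 = 0]. *)
Definition fourier_shift (k : int) (f : R -> R) (w : R) : R[i] :=
  (0 +i* w) ^ (- k) * fourier f w.

(** L_p norm of a complex-valued function, possibly [+oo]. *)
Definition cLnorm (p : R) (F : R -> R[i]) : \bar R :=
  Lnorm mu p%:E (fun w => (ComplexField.Normc.normc (F w))%:E).

End Fourier.

Section SplineWavelet.
Context {R : realType}.

(** x_+^n, right-continuous for [n = 0] *)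
Definition truncpow (n : nat) (x : R) : R := if 0 <= x then x ^+ n else 0.

(** B-spline of order [m], meaningful for [0 < m]. *)
Definition bspline (m : nat) (x : R) : R :=
  ((m.-1)`!%:R)^-1 *
  \sum_(0 <= nu < m.+1)
     (-1) ^+ nu * 'C(m, nu)%:R * truncpow m.-1 (x - nu%:R).

(** Semiorthogonal spline wavelet of order [m], meaningful for [0 < m]; for
    [m = 1] the derivative exists only off the knots, a null set. *)
Definition spline_wavelet (m : nat) (x : R) : R :=
  \sum_(0 <= nu < (2 * m).-1)
     (-1) ^+ nu / 2 ^+ m.-1 * bspline (2 * m) (nu.+1)%:R
     * derive1n m (bspline (2 * m)) (2 * x - nu%:R).

Definition xi2_equation (u : R) : Prop :=
  (2 * pi * u - 4 * u ^+ 2) * cos (2 * u) + (3 * u - pi) * sin (2 * u) = 0.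

Definition lambda_fun (u : R) : R :=
  (sin (u - pi / 2) ^+ 2 * sin u ^+ 2) / ((pi / 2 - u) * u ^+ 2).

Definition Lambda_fun (u : R) : R :=
  - (1 / 2) * derive1n 2 (fun v => ln (lambda_fun v)) u.

End SplineWavelet.

(* Main.v *)
Require Import Defs.
From HB Require Import structures.
From mathcomp Require Import all_boot all_order all_algebra.
From mathcomp Require Import all_classical all_reals all_analysis.
From mathcomp Require Import complex measurable_realfun.
From mathcomp Require Import ring lra zify.
Import Order.TTheory GRing.Theory Num.Theory.
Import numFieldNormedType.Exports.
Local Open Scope classical_set_scope.
Local Open Scope ring_scope.

(* With u = w / 4 the modulus of the Fourier transform of the wavelet is
   (2 pi)^(-1/2) (sin^2 u / |u|)^m A(u + pi/2), where A is the symbol of the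
   integer values of N_2m. The refinement equation of N_2m says that A is a fixed
   point of a two-term transfer operator T, which also maps the partial sums over
   |j| < 2^N of the Poisson series of (sin v / (v + j pi))^2m to one another; T
   halves every function dominated by |sin|, hence A is the sum of the whole series
   and lies between its two largest terms and (1 + 4^(1-m)) times their sum. So on
   |w| < 2 pi the modulus is lambda(v)^m up to a harmless factor, v = pi/2 - |w|/4.

   The logarithm of lambda has second derivative at most -1 on (0, pi/2) and a
   critical point exactly at xi_2, so lambda^(mp) is dominated by a Gaussian around
   xi_2 and, by the third order expansion there, agrees with the Gaussian
   exp(- m p Lambda_2 (v - xi_2)^2) up to a relative error O(m^(-1/2)) in the mean.
   The frequencies |w| >= 2 pi contribute exponentially less since
   2/pi < lambda_2. Both peaks w = +-(2 pi - 4 xi_2) yield the Gaussian integral. *)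

(** * Integer values of B-splines *)

(** The Poisson summation formula is never invoked: identifying the symbol with its series needs
    only the refinement equation, a Lipschitz bound in |sin v|, and contraction. The refinement
    equation is polynomial algebra, since the values N_M(l) are the coefficients of (1 - X)^M times
    the series of n^(M-1) X^n, divided by (M-1)!. The factor (1 - X)^(2m) in the truncated-power
    coefficients of the wavelet likewise replaces arguments about compact support: these
    coefficients annihilate polynomials of degree below 2m in the knot, which removes the tail of
    the wavelet and the boundary terms of integration by parts. In the Laplace step errors are
    measured by h = m^(-1/2). The pointwise error is kept below h times a wider Gaussian plus h^2 /
    (1 + w^2), so that integration gains a second factor h: an error O(1/m) against a main term of
    order m^(-1/2). The singularity of |w|^(-k) at w = 0 is absorbed by k of the m factors lambda(v)
    <= 2 pi - 4 v, hence the restriction to m >= k. *)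

Section Moments.
Variable F : comNzRingType.
Implicit Types p e f g : {poly F}.

(** The operator X d/dX multiplies the coefficient of index s by s, so its iterates turn moments of
    the coefficients into values at 1. *)
Definition euler_op p : {poly F} := 'X * p^`().

Lemma coef_iter_euler a p s : (iter a euler_op p)`_s = p`_s * s%:R ^+ a.
Proof.
elim: a => [|a IH] /=; first by rewrite expr0 mulr1.
rewrite /euler_op coefXM; case: s IH => [|s] IH; first by rewrite expr0n mulr0.
by rewrite coef_deriv IH -mulrnAr exprSr mulr_natr.
Qed.

Lemma moment_horner a p N : (size p <= N)%N ->
  \sum_(s < N) p`_s * s%:R ^+ a = (iter a euler_op p).[1].
Proof.
move=> sp; rewrite (@horner_coef_wide _ N); last first.
  apply/leq_sizeP => j Nj; rewrite coef_iter_euler nth_default ?mul0r //.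
  exact: leq_trans Nj.
by apply: eq_bigr => i _; rewrite coef_iter_euler expr1n mulr1.
Qed.

(** Each application of X d/dX costs one factor 1 - X. Differentiating that power brings down minus
    the exponent, and at 1 only this contribution survives, whence the falling factorial. *)
Lemma iter_euler_factor a n f : (a <= n)%N ->
  exists2 g, iter a euler_op ((1 - 'X) ^+ n * f) = (1 - 'X) ^+ (n - a) * g &
             g.[1] = (-1) ^+ a * (n ^_ a)%:R * f.[1].
Proof.
elim: a => [|a IH] an.
  by exists f; rewrite ?subn0 // expr0 ffactn0 !mul1r.
have [g /= Eg g1] := IH (ltnW an).
move: Eg; have -> : (n - a = (n - a.+1).+1)%N by rewrite subnSK.
move=> Eg.
(* Product rule for (1 - X)^(n-a) g, with (1 - X)^(n-a-1) taken out. *)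
exists (- (n - a.+1).+1%:R *: ('X * g) + (1 - 'X) * ('X * g^`())).
  rewrite Eg /euler_op derivM deriv_exp derivB derivX derivC sub0r -mulr_natr.
  rewrite scaleNr -mul_polyC polyC_natr exprS -pred_Sn; ring.
rewrite !hornerE g1 subnSK // ffactnSr natrM exprS /=; ring.
Qed.

Lemma moment_sum e p N : \sum_(s < N) e`_s * p.[s%:R] =
  \sum_(i < size p) p`_i * \sum_(s < N) e`_s * s%:R ^+ i.
Proof.
under eq_bigr do rewrite horner_coef mulr_sumr.
rewrite exchange_big; apply: eq_bigr => i _ /=.
by rewrite mulr_sumr; apply: eq_bigr => s _; rewrite mulrCA.
Qed.

Lemma moment_lt n f a N : (a < n)%N -> (size ((1 - 'X) ^+ n * f)%R <= N)%N ->
  \sum_(s < N) ((1 - 'X) ^+ n * f)`_s * s%:R ^+ a = 0.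
Proof.
move=> an sN; rewrite moment_horner //.
have [g -> _] := iter_euler_factor a n f (ltnW an).
by rewrite !hornerE subrr expr0n subn_eq0 leqNgt an mul0r.
Qed.

(** Multiplication by (1 - X)^n is an n-th finite difference, and such a difference annihilates
    polynomials of degree below n. *)
Lemma moment_poly_eq0 n f p N : (size p <= n)%N ->
  (size ((1 - 'X) ^+ n * f)%R <= N)%N ->
  \sum_(s < N) ((1 - 'X) ^+ n * f)`_s * p.[s%:R] = 0.
Proof.
move=> pn sN; rewrite moment_sum big1 // => i _.
by rewrite moment_lt ?mulr0 // (leq_trans (ltn_ord i)).
Qed.

Lemma moment_poly_top n f p N : (size p <= n.+1)%N ->
  (size ((1 - 'X) ^+ n * f)%R <= N)%N ->
  \sum_(s < N) ((1 - 'X) ^+ n * f)`_s * p.[s%:R] =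
  (-1) ^+ n * n`!%:R * p`_n * f.[1].
Proof.
move=> pn sN.
transitivity (\sum_(i < n.+1) p`_i *
    \sum_(s < N) ((1 - 'X) ^+ n * f)`_s * s%:R ^+ i).
  under eq_bigr do rewrite (horner_coef_wide _ pn) mulr_sumr.
  rewrite exchange_big; apply: eq_bigr => i _ /=.
  by rewrite mulr_sumr; apply: eq_bigr => s _; rewrite mulrCA.
rewrite big_ord_recr /= big1 ?add0r; last first.
  by move=> i _; rewrite moment_lt ?mulr0.
rewrite moment_horner //; have [g -> g1] := iter_euler_factor n n f (leqnn n).
by rewrite subnn expr0 mul1r g1 ffactnn; ring.
Qed.

Lemma coef_oneBX_exp n i : ((1 - 'X) ^+ n : {poly F})`_i = (-1) ^+ i * 'C(n, i)%:R.
Proof.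
rewrite exprBn coef_sum.
have E (j : 'I_n.+1) : ((-1) ^+ j * 1 ^+ (n - j) * 'X^j *+ 'C(n, j) : {poly F})`_i =
    if i == j :> nat then (-1) ^+ i * 'C(n, i)%:R else 0.
  have -> : (-1) ^+ j = ((-1) ^+ j)%:P :> {poly F} by rewrite rmorphXn rmorphN.
  rewrite coefMn expr1n mulr1 coefCM coefXn.
  case: eqVneq => [->|_]; last by rewrite mulr0 mul0rn.
  by rewrite mulr1 mulr_natr.
rewrite (eq_bigr _ (fun j _ => E j)); case: (ltnP i n.+1) => h.
  rewrite (bigD1 (Ordinal h)) //= eqxx big1 ?addr0 // => j jn.
  by case: eqVneq => // ij; rewrite -val_eqE /= ij eqxx in jn.
rewrite big1 ?bin_small ?mulr0 // => j _.
by case: eqVneq => // ij; move: (ltn_ord j); rewrite -ij ltnNge h.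
Qed.

Lemma size_oneBX_exp n : (size ((1 - 'X) ^+ n : {poly F})%R <= n.+1)%N.
Proof. by apply/leq_sizeP => j h; rewrite coef_oneBX_exp bin_small ?mulr0. Qed.

End Moments.

Lemma sum_nat_widen0 (V : nmodType) (n N : nat) (G : nat -> V) : (n <= N)%N ->
  (forall j, (n <= j)%N -> G j = 0) ->
  \sum_(0 <= j < n) G j = \sum_(0 <= j < N) G j.
Proof.
move=> nN G0; rewrite (big_cat_nat (leq0n n) nN) /= [X in _ = _ + X]big1_seq ?addr0 //.
by move=> j; rewrite mem_index_iota => /andP[_ /andP[nj _]]; exact: G0.
Qed.

(** * Refinement equation for the integer samples of a B-spline *)

Section BsplineSymbol.
Context {R : realType}.
Implicit Types (p q r : {poly R}).

(** Truncated generating series of n^d; the full series times (1 - X)^(d+1) is an Eulerian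
    polynomial. Cutting at [K] leaves the coefficients below [K] exact. *)
Definition power_poly (d K : nat) : {poly R} := \poly_(n < K) n%:R ^+ d.

Lemma coef_oneBX_power M d K l : (l < K)%N ->
  ((1 - 'X) ^+ M * power_poly d K)`_l =
  \sum_(j < l.+1) ((1 - 'X) ^+ M : {poly R})`_j * (l%:R - j%:R) ^+ d.
Proof.
move=> lK; rewrite coefM; apply: eq_bigr => j _.
rewrite coef_poly (leq_ltn_trans (leq_subr _ _) lK) natrB //.
by rewrite -ltnS.
Qed.

Lemma bspline_natE M l : (1 < M)%N -> bspline M l%:R =
  ((M.-1)`!%:R)^-1 *
  \sum_(j < l.+1) ((1 - 'X) ^+ M : {poly R})`_j * (l%:R - j%:R) ^+ M.-1.
Proof.
move=> M1; rewrite /bspline; congr (_ * _).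
rewrite (@sum_nat_widen0 _ _ (M + l).+1) ?ltnS ?leq_addr //; last first.
  by move=> j Mj; rewrite bin_small // mulr0 mul0r.
pose G (j : nat) : R := (-1) ^+ j * 'C(M, j)%:R * truncpow M.-1 (l%:R - j%:R).
transitivity (\sum_(0 <= j < l.+1) G j).
  apply/esym/sum_nat_widen0; first by rewrite ltnS leq_addl.
  by move=> j lj; rewrite /G /truncpow subr_ge0 ler_nat leqNgt lj /= mulr0.
rewrite big_mkord; apply: eq_bigr => j _; rewrite /G coef_oneBX_exp.
by rewrite /truncpow subr_ge0 ler_nat -ltnS ltn_ord.
Qed.

Lemma size_subX_exp (a : R) n : (size ((a%:P - 'X) ^+ n)%R <= n.+1)%N.
Proof.
rewrite (leq_trans (size_poly_exp_leq _ _)) // ltnS.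
rewrite -[leqRHS]mul1n leq_mul2r; apply/orP; right.
by rewrite -opprB size_polyN size_XsubC.
Qed.

Lemma coef_subX_exp_top (a : R) n : ((a%:P - 'X) ^+ n)`_n = (-1) ^+ n.
Proof.
have -> : a%:P - 'X = (-1) *: ('X - a%:P) by rewrite scaleN1r opprB.
rewrite exprZn coefZ.
have := monic_exp n (monicXsubC a); rewrite monicE /lead_coef size_exp_XsubC /=.
by move=> /eqP ->; rewrite mulr1.
Qed.

(** For l >= M no power is truncated, so the value is an M-th difference of a polynomial of degree M
    - 1. *)
Lemma bspline_nat_eq0 M l : (1 < M)%N -> (M <= l)%N -> bspline M (l%:R : R) = 0.
Proof.
move=> M1 Ml; rewrite bspline_natE //.
have := @moment_poly_eq0 R M 1 ((l%:R%:P - 'X) ^+ M.-1) l.+1.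
rewrite !mulr1 => h; rewrite [X in _ * X](_ : _ = 0) ?mulr0 //.
rewrite -[RHS]h.
- by apply: eq_bigr => j _; rewrite !hornerE.
- by rewrite (leq_trans (size_subX_exp _ _)) // prednK // (ltn_trans _ M1).
- by rewrite (leq_trans (size_oneBX_exp _ _)) // ltnS.
Qed.

(** For M > 1 this is X times the Euler-Frobenius polynomial of order M, divided by (M-1)!. *)
Definition bspline_symbol M : {poly R} := \poly_(l < M) bspline M l%:R.

Lemma bspline_symbol_mod M K : (1 < M)%N -> forall l, (l < K)%N ->
  ((1 - 'X) ^+ M * power_poly M.-1 K)`_l =
  ((M.-1)`!%:R *: bspline_symbol M)`_l.
Proof.
move=> M1 l lK; rewrite coef_oneBX_power // coefZ coef_poly.
have f0 : (M.-1)`!%:R != 0 :> R by rewrite pnatr_eq0 -lt0n fact_gt0.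
case: ltnP => Ml; first by rewrite bspline_natE // mulrA divff ?mul1r.
have := bspline_nat_eq0 _ _ M1 Ml; rewrite bspline_natE // => /eqP.
by rewrite mulf_eq0 invr_eq0 (negbTE f0) /= => /eqP ->; rewrite mulr0.
Qed.

Lemma sum_coef_oneBX p n : \sum_(i < n.+1) ((1 - 'X) * p)`_i = p`_n.
Proof.
elim: n => [|n IH].
  by rewrite big_ord_recr big_ord0 /= add0r mulrBl mul1r coefB coefXM subr0.
by rewrite big_ord_recr /= IH mulrBl mul1r coefB coefXM /= addrC subrK.
Qed.

(** Taking one factor 1 - X out of (1 - X)^M makes the sum of coefficients telescope to a single
    coefficient of (1 - X)^(M-1) [power_poly], which is an (M-1)-th difference of a polynomial of
    degree M - 1. *)
Lemma bspline_symbol1 M : (1 < M)%N -> (bspline_symbol M).[1] = 1.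
Proof.
move=> M1; have f0 : (M.-1)`!%:R != 0 :> R by rewrite pnatr_eq0 -lt0n fact_gt0.
have M0 : (0 < M)%N by exact: ltn_trans M1.
apply: (mulfI f0); rewrite -hornerZ mulr1.
rewrite (@horner_coef_wide _ M); last by rewrite size_scale // size_poly.
transitivity (\sum_(i < M.-1.+1) ((1 - 'X) * ((1 - 'X) ^+ M.-1 * power_poly M.-1 M))`_i).
  rewrite prednK //; apply: eq_bigr => i _; rewrite expr1n mulr1.
  by rewrite -(bspline_symbol_mod _ M) // mulrA -exprS prednK.
rewrite sum_coef_oneBX coef_oneBX_power; last by rewrite prednK.
have := @moment_poly_top R M.-1 1 (((M.-1)%:R%:P - 'X) ^+ M.-1) M.-1.+1.
rewrite !mulr1 => h; transitivity (((-1) ^+ M.-1 * (M.-1)`!%:R *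
   ((((M.-1)%:R%:P - 'X) ^+ M.-1 : {poly R})`_M.-1) * (1 : {poly R}).[1] : R)).
  rewrite -h ?size_subX_exp ?size_oneBX_exp //.
  by apply: eq_bigr => j _; rewrite !hornerE.
by rewrite coef_subX_exp_top hornerE mulr1 mulrAC -expr2 sqrr_sign mul1r.
Qed.

Lemma coef_comp_opp p i : (p \Po (- 'X))`_i = (-1) ^+ i * p`_i.
Proof.
rewrite comp_polyE coef_sum.
have E (j : 'I_(size p)) : (p`_j *: (- 'X) ^+ j)`_i =
    if i == j :> nat then (-1) ^+ i * p`_i else 0.
  have -> : (- 'X) ^+ j = (-1) ^+ j *: 'X^j :> {poly R}.
    by rewrite -scaleN1r exprZn.
  rewrite !coefZ coefXn; case: eqVneq => [->|_]; last by rewrite !mulr0.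
  by rewrite mulr1 mulrC.
rewrite (eq_bigr _ (fun j _ => E j)); case: (ltnP i (size p)) => h.
  rewrite (bigD1 (Ordinal h)) //= eqxx big1 ?addr0 // => j jn.
  by case: eqVneq => // ij; rewrite -val_eqE /= ij eqxx in jn.
rewrite big1 ?[p`_i]nth_default ?mulr0 // => j _.
by case: eqVneq => // ij; move: (ltn_ord j); rewrite -ij ltnNge h.
Qed.

Lemma coefM_eq_mod N p q r : (forall i, (i < N)%N -> p`_i = q`_i) ->
  forall i, (i < N)%N -> (r * p)`_i = (r * q)`_i.
Proof.
move=> pq i iN; rewrite !coefM; apply: eq_bigr => j _.
by rewrite pq // (leq_ltn_trans (leq_subr _ _)).
Qed.

(** Twice the even part of the series: the index n = 2 j contributes 2 (2 j)^(M-1) = 2^M j^(M-1). *)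
Lemma power_poly_dilate M : (0 < M)%N ->
  power_poly M.-1 (2 * M) + (power_poly M.-1 (2 * M) \Po (- 'X)) =
  2 ^+ M *: (power_poly M.-1 M \Po 'X^2).
Proof.
move=> M0; apply/polyP => i; rewrite coefD coef_comp_opp coefZ coef_comp_poly_Xn //.
rewrite !coef_poly dvdn2; case: (boolP (odd i)) => oi.
  by rewrite -signr_odd oi expr1 mulN1r subrr mulr0.
rewrite -signr_odd (negbTE oi) expr0 mul1r.
have := odd_double_half i; rewrite (negbTE oi) add0n => ei.
rewrite -ei -muln2 mulnK // [in LHS]mulnC ltn_mul2l /=.
case: ifP => _; last by rewrite addr0 mulr0.
have -> : 2 ^+ M = 2 * 2 ^+ M.-1 :> R by rewrite -exprS prednK.
by rewrite natrM exprMn; ring.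
Qed.

(** With S the series of n^(M-1) X^n, S(X) + S(-X) = 2^M S(X^2); multiplication by (1 - X^2)^M = (1
    - X)^M (1 + X)^M turns each S into a symbol. Both sides have degree below 2 M, so series
    truncated at 2 M suffice. *)
Lemma bspline_symbol_refine M : (1 < M)%N ->
  2 ^+ M *: (bspline_symbol M \Po 'X^2) =
  (1 + 'X) ^+ M * bspline_symbol M +
  (1 - 'X) ^+ M * (bspline_symbol M \Po (- 'X)).
Proof.
move=> M1; have M0 : (0 < M)%N by exact: ltn_trans M1.
have f0 : (M.-1)`!%:R != 0 :> R by rewrite pnatr_eq0 -lt0n fact_gt0.
set Q := bspline_symbol M; set c := (M.-1)`!%:R : R.
have sQ : (size Q <= M)%N by exact: size_poly.
have sX (e : {poly R}) : (size e <= 2)%N -> (size (e ^+ M : {poly R})%R <= M.+1)%N.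
  move=> se; rewrite (leq_trans (size_poly_exp_leq _ _)) // ltnS.
  by rewrite -[leqRHS]mul1n leq_mul2r; apply/orP; right; case: (size e) se => [|[]].
have sXC (a : R) : (size (a%:P * 'X + 1 : {poly R})%R <= 2)%N.
  by rewrite -polyC1 size_MXaddC; case: ifP => // _; rewrite ltnS size_polyC leq_b1.
have sM (e f : {poly R}) : (size e <= M.+1)%N -> (size f <= M)%N -> (size (e * f)%R <= 2 * M)%N.
  move=> he hf; rewrite (leq_trans (size_polyMleq _ _)) //.
  by rewrite mul2n -addnn -ltnS; move: he hf; clear; lia.
have sQN : (size (Q \Po - 'X) <= M)%N.
  by apply/leq_sizeP => j Mj; rewrite coef_comp_opp nth_default ?mulr0 ?(leq_trans sQ).
apply: (can_inj (scalerK f0)); rewrite -/c.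
apply/polyP => i; case: (ltnP i (2 * M)) => iM; last first.
  rewrite !nth_default //.
    rewrite size_scale // (leq_trans (size_polyD _ _)) // geq_max.
    apply/andP; split; rewrite (leq_trans _ iM) // sM //; apply: sX.
      by rewrite addrC -['X]mul1r -polyC1 sXC.
    by rewrite addrC -mulN1r -polyC1 -polyCN sXC.
  rewrite !size_scale ?expf_neq0 ?pnatr_eq0 -?lt0n ?fact_gt0 //.
  rewrite (leq_trans _ iM) //.
  apply/leq_sizeP => j Mj; rewrite coef_comp_poly_Xn //; case: ifP => // _.
  by rewrite nth_default // (leq_trans sQ) // leq_divRL // mulnC.
set S := power_poly M.-1 (2 * M).
have HS : forall l, (l < 2 * M)%N -> ((1 - 'X) ^+ M * S)`_l = (c *: Q)`_l.
  by move=> l; apply: bspline_symbol_mod.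
have HSN : forall l, (l < 2 * M)%N -> ((1 + 'X) ^+ M * (S \Po - 'X))`_l = (c *: (Q \Po - 'X))`_l.
  move=> l lM; have -> : (1 + 'X) ^+ M = ((1 - 'X) ^+ M) \Po - 'X :> {poly R}.
    by rewrite rmorphXn /= comp_polyB comp_polyX -polyC1 comp_polyC opprK.
  by rewrite -comp_polyM -comp_polyZ !coef_comp_opp HS.
rewrite scalerDr !scalerAr coefD -(coefM_eq_mod _ _ _ _ HS) //.
rewrite -(coefM_eq_mod _ _ _ _ HSN) // -coefD.
have -> : (1 + 'X) ^+ M * ((1 - 'X) ^+ M * S) +
   (1 - 'X) ^+ M * ((1 + 'X) ^+ M * (S \Po - 'X)) =
   (1 - 'X^2) ^+ M * (S + (S \Po - 'X)) :> {poly R}.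
  have -> : 1 - 'X^2 = (1 - 'X) * (1 + 'X) :> {poly R} by ring.
  by rewrite exprMn; ring.
rewrite power_poly_dilate // -scalerAr.
have -> : (1 - 'X^2) ^+ M = ((1 - 'X) ^+ M) \Po 'X^2 :> {poly R}.
  by rewrite rmorphXn /= comp_polyB comp_polyX -polyC1 comp_polyC.
rewrite -comp_polyM scalerA mulrC -scalerA !coefZ; congr (_ * _).
rewrite -coefZ -comp_polyZ !coef_comp_poly_Xn //; case: ifP => // i2.
by rewrite bspline_symbol_mod // ltn_divLR // mulnC.
Qed.

End BsplineSymbol.

(** * The symbol as a sum of powers of sinc *)

Section CalculusAux.
Context {R : realType}.
Implicit Types (f df : R -> R) (a b x : R).

Lemma mean_value f df a b : a <= b ->
  (forall x, a <= x <= b -> is_derive x 1 f (df x)) ->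
  exists2 c, a <= c <= b & f b - f a = df c * (b - a).
Proof.
move=> ab fd; have [||c] := @MVT_segment R f df a b ab.
- by move=> x; rewrite in_itv /= => /andP[/ltW h /ltW k]; apply: fd; rewrite h.
- apply: derivable_within_continuous => x; rewrite in_itv /= => h.
  by have [] := fd x h.
by rewrite in_itv /= => h E; exists c.
Qed.

Lemma deriv_ge0_le f df a b : a <= b ->
  (forall x, a <= x <= b -> is_derive x 1 f (df x)) ->
  (forall x, a <= x <= b -> 0 <= df x) -> f a <= f b.
Proof.
move=> ab fd f0; have [c /f0 dc E] := mean_value _ _ _ _ ab fd.
by rewrite -subr_ge0 E mulr_ge0 // subr_ge0.
Qed.

Lemma ler_pi_sin x : 0 <= x <= pi -> x * cos x <= sin x.
Proof.
move=> /andP[x0 xpi]; rewrite -subr_ge0.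
have -> : 0 = sin 0 - 0 * cos 0 :> R by rewrite sin0 mul0r subrr.
apply: (deriv_ge0_le (fun y => sin y - y * cos y) (fun y => y * sin y) 0 x) => // y.
  by move=> _; apply: is_derive_eq; rewrite /GRing.scale /=; ring.
move=> /andP[y0 yx]; rewrite mulr_ge0 // sin_ge0_pi // y0 (le_trans yx xpi)//.
Qed.

End CalculusAux.

Section ExpI.
Context {R : realType}.
Local Open Scope complex_scope.
Import ComplexField.Normc.
Implicit Types (x t : R) (z : R[i]).

Lemma expi0 : expi 0 = 1 :> R[i].
Proof. by rewrite /expi cos0 sin0. Qed.

Lemma expiD x t : expi (x + t) = expi x * expi t.
Proof. by rewrite /expi cosD sinD; simpc; congr (_ +i* _); ring. Qed.

Lemma expiX x n : expi x ^+ n = expi (n%:R * x).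
Proof.
elim: n => [|n IH]; first by rewrite expr0 mul0r expi0.
by rewrite exprS IH -expiD -nat1r mulrDl mul1r.
Qed.

Lemma normc_expi x : normc (expi x) = 1.
Proof. by rewrite /= cos2Dsin2 sqrtr1. Qed.

Lemma normcX z n : normc (z ^+ n) = normc z ^+ n.
Proof.
elim: n => [|n IH]; first by rewrite !expr0 normc1.
by rewrite !exprS normcM IH.
Qed.

Lemma normc_ge0 z : 0 <= normc z.
Proof. by case: z => a b; exact: sqrtr_ge0. Qed.

Lemma normcR x : normc x%:C = `|x|.
Proof. by rewrite /= expr0n addr0 sqrtr_sqr. Qed.

Lemma le_normcB z1 z2 : `|normc z1 - normc z2| <= normc (z1 - z2).
Proof.
have h (x y : R[i]) : normc x <= normc (x - y) + normc y.
  by rewrite -[X in normc X <= _](subrK y) le_normcD.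
rewrite ler_norml; have := h z1 z2; have := h z2 z1.
have -> : normc (z2 - z1) = normc (z1 - z2) by rewrite -opprB normcN.
lra.
Qed.

Lemma le_normc_sum (I : Type) (r : seq I) (F : I -> R[i]) :
  normc (\sum_(i <- r) F i) <= \sum_(i <- r) normc (F i).
Proof.
elim: r => [|i r IH]; first by rewrite !big_nil normc0.
by rewrite !big_cons (le_trans (le_normcD _ _)) // lerD2l.
Qed.

Lemma expi_pi_nat n : expi (n%:R * (2 * pi)) = 1 :> R[i].
Proof.
rewrite -expiX (_ : expi (2 * pi) = 1) ?expr1n //.
by rewrite /expi mulr_natl cos2pi sin2pi.
Qed.

Lemma addr_expiN x :
  1 + expi (- x) = expi (- (x / 2)) * (2 * cos (x / 2))%:C.
Proof.
have -> : - x = - (x / 2) + - (x / 2) by lra.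
rewrite expiD /expi cosN sinN; simpc; congr (_ +i* _); last by ring.
by have := cos2Dsin2 (x / 2); nra.
Qed.

Lemma subr_expiN x :
  1 - expi (- x) = expi (- (x / 2)) * (0 +i* (2 * sin (x / 2))).
Proof.
have -> : - x = - (x / 2) + - (x / 2) by lra.
rewrite expiD /expi cosN sinN; simpc; congr (_ +i* _); last by ring.
by have := cos2Dsin2 (x / 2); nra.
Qed.

Lemma normc_subX z n : normc z = 1 -> normc (z ^+ n - 1) <= n%:R * normc (z - 1).
Proof.
move=> z1; elim: n => [|n IH]; first by rewrite expr0 subrr normc0 mul0r.
have -> : z ^+ n.+1 - 1 = z * (z ^+ n - 1) + (z - 1) by rewrite exprS; ring.
rewrite (le_trans (le_normcD _ _)) // normcM z1 mul1r -natr1 mulrDl mul1r.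
by rewrite lerD2r.
Qed.

Lemma normc_expi_sub1 x : normc (expi (2 * x) - 1) = 2 * `|sin x|.
Proof.
have -> : expi (2 * x) - 1 = - (1 - expi (- (- (2 * x)))) by rewrite opprK opprB.
rewrite normcN subr_expiN normcM normc_expi mul1r.
have -> : 0 +i* (2 * sin (- (2 * x) / 2)) = 'i * (2 * sin (- (2 * x) / 2))%:C.
  by simpc.
rewrite normcM /= !expr0n expr1n add0r addr0 sqrtr1 mul1r sqrtr_sqr normrM.
have -> : - (2 * x) / 2 = - x by lra.
by rewrite sinN normrN ger0_norm.
Qed.

End ExpI.

(** * Contraction of the symbol to its series *)

Section CenteredSymbol.
Context {R : realType}.
Local Open Scope complex_scope.
Import ComplexField.Normc.
Implicit Types (v x : R).

Definition csymbol_poly (M : nat) : {poly R[i]} :=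
  map_poly (real_complex R) (bspline_symbol M).

(* By Poisson summation this is the sum of [(sin v / (v + j * pi)) ^+ (2 * m)] over all integers j. *)
Definition centered_symbol (m : nat) (v : R) : R[i] :=
  expi ((2 * m)%:R * v) * (csymbol_poly (2 * m)).[expi (- (2 * v))].

(* The terms -N <= j < N of that sum. *)
Definition sinc_peaks (M N : nat) (v : R) : R :=
  \sum_(j < N) ((sin v / (v + pi * j%:R)) ^+ M +
                (sin v / (pi - v + pi * j%:R)) ^+ M).

Lemma csymbol_poly_refine M (w : R[i]) : (1 < M)%N ->
  2 ^+ M * (csymbol_poly M).[w ^+ 2] =
  (1 + w) ^+ M * (csymbol_poly M).[w] + (1 - w) ^+ M * (csymbol_poly M).[- w].
Proof.
move=> M1; have := congr1 (fun p => (map_poly (real_complex R) p).[w])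
  (@bspline_symbol_refine R M M1).
rewrite /csymbol_poly map_polyZ rmorphD !rmorphM /= !map_comp_poly !rmorphXn /=.
rewrite rmorphN !(rmorphB, rmorphD, rmorph1) /= !map_polyX.
by rewrite !hornerE !horner_comp !hornerE.
Qed.

(** The polynomial equation is taken at exp(-i v). Half-angle formulas turn 1 + w and 1 - w into
    phases times cosine and sine of v / 2; the centering factor and i^(2m) cancel all phases,
    leaving nonnegative weights. *)
Lemma centered_symbol_refine m v : (0 < m)%N ->
  centered_symbol m v =
  (cos (v / 2) ^+ (2 * m))%:C * centered_symbol m (v / 2) +
  (sin (v / 2) ^+ (2 * m))%:C * centered_symbol m (v / 2 + pi / 2).
Proof.
move=> m0; have M1 : (1 < 2 * m)%N by lia.
have E := csymbol_poly_refine _ (expi (- v)) M1.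
have e2 : expi (- v) ^+ 2 = expi (- (2 * v)) :> R[i] by rewrite expiX; congr expi; lra.
have eN : - expi (- v) = expi (- (2 * (v / 2 + pi / 2))) :> R[i].
  have -> : - (2 * (v / 2 + pi / 2)) = - v + - pi :> R by lra.
  by rewrite expiD /expi [cos (- pi)]cosN [sin (- pi)]sinN cospi sinpi; simpc;
     congr (_ +i* _); ring.
have T0 : 2 ^+ (2 * m) != 0 :> R[i] by rewrite expf_neq0 // pnatr_eq0.
apply: (mulfI T0); rewrite /centered_symbol.
have -> : - (2 * (v / 2)) = - v by lra.
rewrite -eN -e2 mulrCA E mulrDr addr_expiN subr_expiN !exprMn.
rewrite mulrDr; congr (_ + _).
  rewrite !mulrA; congr (_ * _); rewrite expiX -expiD.
  rewrite -rmorphXn exprMn rmorphM /= rmorphXn /= rmorph_nat.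
  have -> : (2 * m)%:R * v + (2 * m)%:R * - (v / 2) = (2 * m)%:R * (v / 2) by lra.
  by rewrite mulrC mulrA.
have -> : 0 +i* (2 * sin (v / 2)) = 'i * (2 * sin (v / 2))%:C.
  by simpc.
rewrite !mulrA; congr (_ * _); rewrite exprMn -rmorphXn exprMn rmorphM /= rmorphXn /= rmorph_nat.
rewrite expiX.
have E1 : expi ((2 * m)%:R * (v / 2 + pi / 2)) =
    expi ((2 * m)%:R * v) * expi ((2 * m)%:R * - (v / 2)) * 'i ^+ (2 * m) :> R[i].
  have -> : (2 * m)%:R * (v / 2 + pi / 2) =
    (2 * m)%:R * v + (2 * m)%:R * - (v / 2) + (2 * m)%:R * (pi / 2) by lra.
  rewrite !expiD; congr (_ * _).
  by rewrite -expiX /expi cos_pihalf sin_pihalf.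
by rewrite E1; ring.
Qed.

Lemma csymbol_poly1 M : (1 < M)%N -> (csymbol_poly M).[1] = 1.
Proof.
move=> M1; have := horner_map (real_complex R) (bspline_symbol M) 1.
by rewrite bspline_symbol1 // => <-; rewrite rmorph1.
Qed.

Lemma normc_horner_sub1 (p : {poly R[i]}) (z : R[i]) : normc z = 1 ->
  normc (p.[z] - p.[1]) <=
  (\sum_(i < size p) normc p`_i * i%:R) * normc (z - 1).
Proof.
move=> z1; rewrite !horner_coef -sumrB (le_trans (le_normc_sum _ _ _)) // mulr_suml.
apply: ler_sum => i _; rewrite expr1n -mulrBr normcM -mulrA ler_wpM2l ?normc_ge0 //.
exact: normc_subX.
Qed.

(** The symbol and the centering phase are both 1 at v = 0, and each is a polynomial in a point of
    the unit circle at distance 2 |sin v| from 1. *)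
Lemma centered_symbol_sub1 m : (0 < m)%N ->
  exists2 C : R, 0 <= C & forall v, normc (centered_symbol m v - 1) <= C * `|sin v|.
Proof.
move=> m0; set p := csymbol_poly (2 * m).
set K := \sum_(i < size p) normc p`_i * i%:R.
exists (2 * m%:R + 2 * K) => [|v].
  by rewrite addr_ge0 ?mulr_ge0 // sumr_ge0 // => i _; rewrite mulr_ge0 ?normc_ge0.
have -> : centered_symbol m v - 1 = expi ((2 * m)%:R * v) * (p.[expi (- (2 * v))] - p.[1])
    + (expi ((2 * m)%:R * v) - 1).
  by rewrite csymbol_poly1 ?ltn_Pmulr //; [rewrite /centered_symbol; ring | lia].
rewrite (le_trans (le_normcD _ _)) // normcM normc_expi mul1r [leLHS]addrC [leRHS]mulrDl; apply:
  lerD.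
  have -> : expi ((2 * m)%:R * v) = expi (2 * v) ^+ m :> R[i].
    by rewrite expiX; congr expi; rewrite natrM; ring.
  rewrite (le_trans (normc_subX _ _ (normc_expi _))) // normc_expi_sub1.
  by rewrite mulrA [_ * 2]mulrC.
rewrite (le_trans (normc_horner_sub1 _ _ (normc_expi _))) //.
have -> : - (2 * v) = 2 * - v by lra.
by rewrite normc_expi_sub1 sinN normrN mulrCA mulrA.
Qed.

Lemma expr_le1_sub (x : R) n : 0 <= x <= 1 -> 1 - x ^+ n <= n%:R * (1 - x).
Proof.
move=> /andP[x0 x1]; elim: n => [|n IH]; first by rewrite expr0 subrr mul0r.
rewrite exprS -natr1.
have : 0 <= x ^+ n <= 1 by rewrite exprn_ge0 //= exprn_ile1.
nra.
Qed.

Lemma sin_le_id (x : R) : 0 <= x -> sin x <= x.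
Proof.
move=> x0; rewrite -subr_ge0 (_ : 0 = 0 - sin 0); last by rewrite sin0 subrr.
by apply: (deriv_ge0_le (fun y => y - sin y) (fun y => 1 - cos y) 0 x) => // y _;
   rewrite subr_ge0 cos_le1.
Qed.

(** Follows from cos v <= sin v / v and 1 - cos v <= sin v, the latter because cos v + sin v >=
    cos^2 v + sin^2 v. *)
Lemma sinc_sub1 (v : R) : 0 < v <= pi / 2 -> 0 <= 1 - sin v / v <= sin v.
Proof.
move=> /andP[v0 vpi]; have pi0 := @pi_gt0 R.
have s0 : 0 < sin v by rewrite sin_gt0_pi // v0 /=; lra.
have h1 := sin_le_id v (ltW v0).
have h2 : v * cos v <= sin v by apply: ler_pi_sin; rewrite ltW //=; lra.
have c0 : 0 <= cos v by rewrite cos_ge0_pihalf //; apply/andP; split; lra.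
have c1 := cos_le1 v; have s1 := sin_le1 v; have cs := cos2Dsin2 v.
rewrite subr_ge0 ler_pdivrMr // mul1r h1 /=.
have h3 : cos v <= sin v / v by rewrite ler_pdivlMr // mulrC.
have : sin v ^+ 2 <= sin v by rewrite expr2 ler_piMl // ltW.
have : cos v ^+ 2 <= cos v by rewrite expr2 ler_piMl.
lra.
Qed.

(** Starting bound of the contraction. The reflection v -> pi - v swaps the two terms, so (0, pi/2]
    suffices; there the first term deviates from 1 by at most M sin v and the second is at most sin
    v. *)
Lemma sinc_peaks_sub1 (M : nat) : (0 < M)%N ->
  exists2 C : R, 0 <= C &
  forall v, 0 < v < pi -> `|sinc_peaks M 1 v - 1| <= C * sin v.
Proof.
move=> M0; have pi0 := @pi_gt0 R; have pi2 := @pi_ge2 R.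
exists (M%:R + 1) => [|v]; first by rewrite addr_ge0.
have half : forall w : R, 0 < w <= pi / 2 ->
   `|(sin w / w) ^+ M + (sin w / (pi - w)) ^+ M - 1| <= (M%:R + 1) * sin w.
  move=> w w01; have /andP[w0 wpi] := w01.
  have s0 : 0 < sin w by rewrite sin_gt0_pi // w0 /=; lra.
  have /andP[a b] := sinc_sub1 w w01.
  have sc0 : 0 <= sin w / w by rewrite divr_ge0 // ltW.
  have sc01 : 0 <= sin w / w <= 1 by rewrite sc0 /=; lra.
  have := expr_le1_sub _ M sc01.
  have : (sin w / w) ^+ M <= 1 by rewrite exprn_ile1 //; case/andP: sc01.
  have q1 : 0 <= sin w / (pi - w) <= sin w.
    have d0 : 0 < pi - w by lra.
    rewrite divr_ge0 ?(ltW d0) ?(ltW s0) //= ler_pdivrMr // ler_peMr ?(ltW s0) //.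
    lra.
  have q2 : 0 <= (sin w / (pi - w)) ^+ M <= sin w.
    have [q1a q1'] := andP q1; rewrite exprn_ge0 //=; apply: le_trans q1'.
    rewrite -[leRHS]expr1 ler_wiXn2l //.
    rewrite ler_pdivrMr ?mul1r; [|lra].
    by have := sin_le1 w; lra.
  have : M%:R * (1 - sin w / w) <= M%:R * sin w by rewrite ler_wpM2l.
  by rewrite ler_norml; move: q2 => /andP[]; nra.
rewrite /sinc_peaks big_ord_recl big_ord0 /= mulr0 !addr0 => /andP[v0 vpi].
have [h|h] := leP v (pi / 2); first by apply: half; rewrite v0.
have := half (pi - v); rewrite (_ : sin (pi - v) = sin v); last first.
  by rewrite addrC sinDpi sinN opprK.
have -> : pi - (pi - v) = v by lra.
rewrite [X in `|X - 1|]addrC; apply; lra.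
Qed.

Lemma sum_ord_double (V : nmodType) (f : nat -> V) N :
  \sum_(i < 2 * N) f i = \sum_(j < N) (f (2 * j)%N + f (2 * j).+1).
Proof.
elim: N => [|N IH]; first by rewrite muln0 !big_ord0.
by rewrite mulnS add2n !big_ord_recr /= IH addrA.
Qed.

(* cos and sin of v / 2 turn the denominators v / 2 + pi j and v / 2 + pi / 2 + pi j into
   v + pi i with i even and odd respectively. *)
Lemma sinc_peaks_refine M N v :
  cos (v / 2) ^+ M * sinc_peaks M N (v / 2) +
  sin (v / 2) ^+ M * sinc_peaks M N (v / 2 + pi / 2) = sinc_peaks M (2 * N) v.
Proof.
have sv : sin v = 2 * (sin (v / 2) * cos (v / 2)).
  by rewrite [in LHS](_ : v = v / 2 + v / 2) ?sinD; [ring | lra].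
have key a b d d' : sin v = 2 * (a * b) -> d' = 2 * d ->
    a * (b / d) = sin v / d' :> R.
  by move=> -> ->; rewrite -mulf_div divff ?mul1r ?mulrA // pnatr_eq0.
pose F (j : nat) := (sin v / (v + pi * j%:R)) ^+ M + (sin v / (pi - v + pi * j%:R)) ^+ M.
have -> : sinc_peaks M (2 * N) v = \sum_(j < N) (F (2 * j)%N + F (2 * j).+1).
  exact: (sum_ord_double _ F).
rewrite /sinc_peaks /F !mulr_sumr -big_split /=.
apply: eq_bigr => j _; rewrite !mulrDr -!exprMn sinDpihalf.
rewrite (key (cos (v / 2)) (sin (v / 2)) _ (v + pi * (2 * j)%:R)); [|rewrite sv; ring|].
  rewrite (key (cos (v / 2)) _ _ (pi - v + pi * (2 * j).+1%:R)); [|rewrite sv; ring|].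
    rewrite (key (sin (v / 2)) (cos (v / 2)) (v / 2 + pi / 2 + _) (v + pi * (2 * j).+1%:R));
      [|rewrite sv; ring|].
      rewrite (key (sin (v / 2)) _ _ (pi - v + pi * (2 * j)%:R)); [|rewrite sv; ring|].
        by ring.
      by rewrite natrM; field.
    by rewrite -natr1 natrM; field.
  by rewrite -natr1 natrM; field.
by rewrite natrM; field.
Qed.

(** For j >= 2, j^(-M) <= 2^(2-M) / (j (j - 1)), and this majorant telescopes; the factor 1 - 1/N
    lets the induction close. *)
Lemma sum_inv_powers M N : (1 < M)%N -> (0 < N)%N ->
  \sum_(i < N) (1 + i%:R : R) ^- M <= 1 + 4 / 2 ^+ M * (1 - N%:R^-1).
Proof.
case: M => [|[|M]] // _; case: N => // N _; elim: N => [|N IH].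
  by rewrite big_ord_recl big_ord0 !addr0 expr1n invr1 subrr mulr0 addr0.
rewrite big_ord_recr /= (le_trans (lerD IH (lexx _))) // -addrA lerD2l.
rewrite -lerBrDl -mulrBr nat1r.
have -> : 1 - N.+2%:R^-1 - (1 - N.+1%:R^-1) = N.+1%:R^-1 - N.+2%:R^-1 :> R by ring.
set x := N.+1%:R : R; have x1 : 1 <= x by rewrite ler1n.
have -> : N.+2%:R = x + 1 by rewrite natr1.
rewrite !exprS.
have -> : 4 / (2 * (2 * 2 ^+ M)) = (2 ^+ M)^-1 :> R by field; rewrite expf_neq0.
have -> : x^-1 - (x + 1)^-1 = (x * (x + 1))^-1 by field; lra.
rewrite -invfM lef_pV2 ?posrE ?mulr_gt0 ?exprn_gt0 //; try lra.
rewrite mulrC [leRHS]mulrA; apply: ler_pM; rewrite ?exprn_ge0 ?mulr_ge0 //; try lra.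
by rewrite lerXn2r ?nnegrE; lra.
Qed.

(** For 0 < w < pi the denominator w + pi i is at least w (1 + i), so the pair of index i is at most
    (1 + i)^(-M) times the leading pair. *)
Lemma sinc_peaks_upper M N v : (1 < M)%N -> (0 < N)%N -> 0 < v < pi ->
  sinc_peaks M N v <= (1 + 4 / 2 ^+ M) * sinc_peaks M 1 v.
Proof.
move=> M1 N0 v01; have /andP[v0 vpi] := v01; have s0 := sin_gt0_pi v01.
have pi0 := @pi_gt0 R.
have key w (i : nat) : 0 < w < pi -> (sin v / (w + pi * i%:R)) ^+ M <=
    (sin v / w) ^+ M * (1 + i%:R) ^- M.
  move=> /andP[w0 wpi]; rewrite -exprVn -exprMn -mulrA -invfM.
  have i0 : 0 <= i%:R :> R by [].
  have d0 : 0 < w * (1 + i%:R) by rewrite mulr_gt0 //; lra.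
  have d1 : w * (1 + i%:R) <= w + pi * i%:R by rewrite mulrDr mulr1 lerD2l ler_wpM2r // ltW.
  have d2 := lt_le_trans d0 d1.
  apply: lerXn2r; rewrite ?nnegrE ?divr_ge0 ?(ltW d0) ?(ltW d2) ?(ltW s0) //.
  by rewrite ler_pM2l // lef_pV2 ?posrE.
rewrite {2}/sinc_peaks big_ord_recl big_ord0 /= mulr0 !addr0.
set S := _ + (sin v / (pi - v)) ^+ M.
have S0 : 0 <= S by rewrite addr_ge0 // exprn_ge0 // divr_ge0 ?ltW //; lra.
apply: (@le_trans _ _ (\sum_(i < N) S * (1 + i%:R) ^- M)).
  apply: ler_sum => i _; rewrite /S [leRHS]mulrDl; apply: lerD; first exact: key.
  by apply: key; lra.
rewrite -mulr_sumr mulrC ler_wpM2r // (le_trans (sum_inv_powers _ _ M1 N0)) // lerD2l.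
have c0 : 0 <= 4 / 2 ^+ M :> R by rewrite divr_ge0 // exprn_ge0.
have n0 : 0 <= N%:R^-1 :> R by rewrite invr_ge0.
nra.
Qed.

Lemma centered_symbol_cvg m : (1 < m)%N ->
  exists2 C : R, 0 <= C & forall N v, 0 < v < pi ->
  normc (centered_symbol m v - (sinc_peaks (2 * m) (2 ^ N) v)%:C) <=
  C / 2 ^+ N * sin v.
Proof.
move=> m1; have m0 : (0 < m)%N by lia.
have [C1 C10 H1] := centered_symbol_sub1 _ m0.
have M0 : (0 < 2 * m)%N by lia.
have M3 : (3 <= 2 * m)%N by lia.
have [C2 C20 H2] := sinc_peaks_sub1 _ M0.
have pi0 := @pi_gt0 R.
exists (C1 + C2) => [|N]; first by rewrite addr_ge0.
elim: N => [|N IH] v v01; have /andP[v0 vpi] := v01.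
  rewrite expn0 expr0 divr1.
  have -> : centered_symbol m v - (sinc_peaks (2 * m) 1 v)%:C =
     (centered_symbol m v - 1) - (sinc_peaks (2 * m) 1 v - 1)%:C.
    by rewrite rmorphB rmorph1; ring.
  rewrite (le_trans (le_normcD _ _)) // normcN normcR mulrDl lerD ?H2 //.
  by rewrite -[X in _ <= _ * X]ger0_norm ?H1 // ltW // sin_gt0_pi.
have s0 : 0 < sin (v / 2) by rewrite sin_gt0_pi //; lra.
have c0 : 0 < cos (v / 2) by rewrite cos_gt0_pihalf //; lra.
have sv : sin v = 2 * (sin (v / 2) * cos (v / 2)).
  by rewrite [in LHS](_ : v = v / 2 + v / 2) ?sinD; [ring | lra].
rewrite expnS -sinc_peaks_refine centered_symbol_refine // rmorphD !rmorphM /=.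
rewrite opprD addrACA -!mulrBr.
rewrite (le_trans (le_normcD _ _)) // !normcM !normcR !ger0_norm ?exprn_ge0 ?(ltW s0) ?(ltW c0) //.
have v1 : 0 < v / 2 < pi by lra.
have v2 : 0 < v / 2 + pi / 2 < pi by lra.
have := IH _ v1; have := IH _ v2; rewrite sinDpihalf => h2 h1.
set K := (C1 + C2) / 2 ^+ N in h1 h2 *.
have K0 : 0 <= K by rewrite divr_ge0 ?exprn_ge0 // addr_ge0.
have -> : (C1 + C2) / 2 ^+ N.+1 = K / 2 by rewrite exprSr invfM mulrA.
(* The third power is enough: cos^3 sin + sin^3 cos = cos sin = sin(v) / 2 at v / 2, which is
   exactly the halving. It needs 2 m >= 3. *)
have g1 : cos (v / 2) ^+ (2 * m) <= cos (v / 2) ^+ 3.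
  by apply: ler_wiXn2l => //; exact: ltW.
have g2 : sin (v / 2) ^+ (2 * m) <= sin (v / 2) ^+ 3.
  by apply: ler_wiXn2l => //; exact: ltW.
set c := cos (v / 2) in s0 c0 sv h1 h2 g1 g2 *.
set s := sin (v / 2) in s0 c0 sv h1 h2 g1 g2 *.
apply: (@le_trans _ _ (c ^+ 3 * (K * s) + s ^+ 3 * (K * c))).
  by apply: lerD; apply: ler_pM; rewrite ?normc_ge0 ?exprn_ge0 ?(ltW c0) ?(ltW s0).
have -> : c ^+ 3 * (K * s) + s ^+ 3 * (K * c) = K * s * c * (c ^+ 2 + s ^+ 2) by ring.
by rewrite cos2Dsin2 sv le_eqVlt; apply/orP; left; apply/eqP; field.
Qed.

Lemma archi_half_le0 (x C : R) : 0 <= C -> (forall N, x <= C / 2 ^+ N) -> x <= 0.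
Proof.
move=> C0 H; have z1 : `|2^-1 : R| < 1 by rewrite ger0_norm; lra.
have h := @cvg_geometric R C _ z1.
rewrite -(cvg_lim (@Rhausdorff R) h); apply: limr_ge; first by apply/cvg_ex; exists 0.
by apply: nearW => N; rewrite /= exprVn; exact: H.
Qed.

Lemma centered_symbol_bounds m v : (1 < m)%N -> 0 < v < pi ->
  sinc_peaks (2 * m) 1 v <= normc (centered_symbol m v) <=
  (1 + 4 / 2 ^+ (2 * m)) * sinc_peaks (2 * m) 1 v.
Proof.
move=> m1 v01; have [C C0 H] := centered_symbol_cvg _ m1.
have s0 := sin_gt0_pi v01; have /andP[v0 vpi] := v01; have pi0 := @pi_gt0 R.
have M1 : (1 < 2 * m)%N by lia.
have Cs : 0 <= C * sin v by rewrite mulr_ge0 // ltW.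
have P0 N : 0 <= sinc_peaks (2 * m) N v.
  have d j : 0 <= pi * j%:R :> R by rewrite mulr_ge0 // ltW.
  by apply: sumr_ge0 => j _; rewrite addr_ge0 // exprn_ge0 // divr_ge0 ?(ltW s0) //;
    have := d j; lra.
have mono N : sinc_peaks (2 * m) 1 v <= sinc_peaks (2 * m) N.+1 v.
  rewrite /sinc_peaks big_ord_recl big_ord0 addr0 [leRHS]big_ord_recl lerDl.
  have d j : 0 <= pi * j%:R :> R by rewrite mulr_ge0 // ltW.
  by apply: sumr_ge0 => j _; rewrite addr_ge0 // exprn_ge0 // divr_ge0 ?(ltW s0) //;
    have := d (lift ord0 j); lra.
have key N : `|normc (centered_symbol m v) - sinc_peaks (2 * m) (2 ^ N) v| <= C * sin v / 2 ^+ N.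
  have := le_normcB (centered_symbol m v) (sinc_peaks (2 * m) (2 ^ N) v)%:C.
  rewrite normcR [X in _ - X]ger0_norm // => h; apply: (le_trans h).
  by rewrite mulrAC H.
apply/andP; split.
  rewrite -subr_le0; apply: (archi_half_le0 _ (C * sin v)) => // N.
  have := key N; rewrite ler_norml; have := mono (2 ^ N).-1.
  by rewrite prednK ?expn_gt0 //; lra.
rewrite -subr_le0; apply: (archi_half_le0 _ (C * sin v)) => // N.
have := key N; rewrite ler_norml.
have := sinc_peaks_upper _ (2 ^ N) _ M1 (expn_gt0 _ _) v01.
lra.
Qed.

End CenteredSymbol.

(** * Fourier transform of the wavelet *)

Section SplineDerivatives.
Context {R : realType}.
Implicit Types (x : R).

Lemma is_derive_truncpow n x :
  is_derive x 1 (truncpow n.+2) (n.+2%:R * truncpow n.+1 x).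
Proof.
have [x0|x0|->] := ltgtP x 0.
- have E : \near x, cst 0 x = truncpow n.+2 x :> R.
    near=> y; rewrite /truncpow leNgt (_ : y < 0) //.
    by near: y; exact: lt_nbhsl.
  apply: (near_eq_is_derive E).
    rewrite /truncpow leNgt x0 /= mulr0; exact: is_derive_cst.
- have E : \near x, x ^+ n.+2 = truncpow n.+2 x :> R.
    near=> y; rewrite /truncpow ltW //.
    by near: y; exact: lt_nbhsr.
  apply: (near_eq_is_derive E).
    rewrite /truncpow (ltW x0).
    have -> : (GRing.exp (R:=R))^~ n.+2 = id ^+ n.+2 by apply/funext => y; rewrite fctE.
    by apply: is_derive_eq; rewrite /GRing.scale /= mulr1.
rewrite [X in is_derive _ _ _ X](_ : _ = 0); last first.
  by rewrite /truncpow lexx expr0n mulr0.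
(* At the knot the difference quotient is 0 or h^(n+1), hence at most |h| in absolute value once |h|
   <= 1. *)
have H : h^-1 *: (truncpow n.+2 (h *: 1 + 0) - truncpow n.+2 0) @[h --> 0^'] --> (0 : R).
  apply/cvgrPdist_le => e e0.
  near=> h; have h0 : h != 0 by near: h; exact: nbhs_dnbhs_neq.
  have h1 : `|h| <= Num.min 1 e.
    near: h; apply: dnbhs0_le; rewrite lt_min ltr01 /=; exact: e0.
  rewrite sub0r normrN /truncpow lexx expr0n subr0 addr0 /GRing.scale /= mulr1.
  move: h1; rewrite le_min => /andP[h1 he].
  case: ifP => _; last by rewrite mulr0 normr0 ltW.
  rewrite exprS mulrA mulVf // mul1r exprS normrM.
  rewrite (le_trans _ he) // ler_piMr // normrX exprn_ile1 //.
have D : derivable (truncpow n.+2) (0:R) 1 by apply/cvg_ex; exists 0.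
by apply: (DeriveDef D); exact: cvg_lim H.
Unshelve. all: by end_near.
Qed.

Lemma is_derive_sum_fun n (f : 'I_n -> R -> R) (df : 'I_n -> R) (x : R) :
  (forall i, is_derive x 1 (f i) (df i)) ->
  is_derive x 1 (fun y => \sum_(i < n) f i y) (\sum_(i < n) df i).
Proof.
move=> h; have -> : (fun y => \sum_(i < n) f i y) = \sum_(i < n) f i.
  by apply/funext => y; rewrite fct_sumE.
exact: is_derive_sum.
Qed.

(** The bound d + 2 <= M means that only powers of exponent at least 2 are differentiated, so the
    derivatives exist at the knots too. For order 2 m and d = m it reads m >= 2. *)
Lemma derive1n_bspline M d : (d.+2 <= M)%N ->
  derive1n d (bspline M) = fun x : R =>
  (((M.-1 - d)%N)`!%:R)^-1 *
  \sum_(0 <= j < M.+1) (-1) ^+ j * 'C(M, j)%:R * truncpow (M.-1 - d) (x - j%:R).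
Proof.
elim: d => [|d IH] dM; first by rewrite subn0; apply/funext.
rewrite derive1nS IH; last exact: ltnW.
have [n En] : exists n, (M.-1 - d = n.+2)%N by exists (M - d.+3)%N; lia.
have En1 : (M.-1 - d.+1 = n.+1)%N by lia.
rewrite En En1; apply/funext => x; rewrite derive1E.
rewrite big_mkord.
pose F (j : 'I_M.+1) := (fun y : R => (-1) ^+ j * 'C(M, j)%:R * truncpow n.+2 (y - j%:R)).
have GE : (fun y : R => (n.+2)`!%:R^-1 * \sum_(0 <= j < M.+1)
    (-1) ^+ j * 'C(M, j)%:R * truncpow n.+2 (y - j%:R)) =
    (n.+2)`!%:R^-1 \*: (fun y => \sum_(j < M.+1) F j y).
  by apply/funext => y /=; rewrite big_mkord.
rewrite GE.
apply: derive_val.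
apply: is_derive_eq.
  apply: is_deriveZ; apply: is_derive_sum_fun => j.
  rewrite /F; apply: is_deriveZ.
  apply: (@is_derive1_comp _ (truncpow n.+2) (fun y => y - j%:R) x).
    exact: is_derive_truncpow.
rewrite /GRing.scale /= factS natrM invfM -mulrA [in LHS]mulrCA; congr (_ * _).
rewrite mulr_sumr; apply: eq_bigr => j _.
by rewrite subr0 mulr1; field.
Qed.

End SplineDerivatives.

(** * Truncated-power coefficients of the wavelet *)

Section WaveletCoefficients.
Context {R : realType}.

Lemma sum_coefM (F : comNzRingType) (p q : {poly F}) (G : nat -> F) A B :
  (size p <= A)%N -> (size q <= B)%N ->
  \sum_(i < A) \sum_(j < B) p`_i * q`_j * G (i + j)%N =
  \sum_(s < A + B) (p * q)`_s * G s.
Proof.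
move=> pA qB; have widen (r : {poly F}) N : (size r <= N)%N -> r = \sum_(i < N) r`_i *: 'X^i.
  move=> rN; rewrite -[LHS]coefK poly_def (big_ord_widen N (fun i => r`_i *: 'X^i)) //.
  rewrite big_mkcond /=; apply: eq_bigr => i _; case: ltnP => // ri.
  by rewrite nth_default // scale0r.
rewrite [in RHS](widen _ _ pA) [in RHS](widen _ _ qB).
under [RHS]eq_bigr => s _.
  rewrite mulr_suml coef_sum mulr_suml.
  under eq_bigr do rewrite mulr_sumr coef_sum mulr_suml.
  over.
rewrite [RHS]exchange_big; apply: eq_bigr => i _ /=.
rewrite exchange_big; apply: eq_bigr => j _ /=.
have ijN : (i + j < A + B)%N by rewrite -addSn leq_add // ltnW.
rewrite (bigD1 (Ordinal ijN)) //= big1 ?addr0 => [|s sij].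
  by rewrite -scalerAl -scalerAr -exprD !coefZ coefXn eqxx mulr1n mulr1.
rewrite -scalerAl -scalerAr -exprD !coefZ coefXn.
case: eqVneq => [E|_]; last by rewrite !mulr0 mul0r.
by case/eqP: sij; apply/val_inj.
Qed.

Definition wavelet_symbol (m : nat) : {poly R} :=
  \poly_(nu < (2 * m).-1) ((-1) ^+ nu * bspline (2 * m) (nu.+1)%:R).

(** Coefficients of the wavelet in the functions (2 x - s)_+^(m-1). The factor (1 - X)^(2m) is the
    2m-th difference inside N_2m; the scalar collects 2^(m-1) and the factorial left after m
    differentiations. *)
Definition wavelet_coef (m : nat) : {poly R} :=
  (1 - 'X) ^+ (2 * m) * ((2 ^+ m.-1 * (m.-1)`!%:R)^-1 *: wavelet_symbol m).

Lemma size_wavelet_coef m : (0 < m)%N -> (size (wavelet_coef m) <= 4 * m)%N.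
Proof.
move=> m0; rewrite (leq_trans (size_polyMleq _ _)) //.
have h1 := @size_oneBX_exp R (2 * m).
have h2 := leq_trans (size_scale_leq (2 ^+ m.-1 * (m.-1)`!%:R)^-1 (wavelet_symbol m))
  (size_poly _ _).
rewrite -subn1 leq_subLR (leq_trans (leq_add h1 h2)) //.
by clear h1 h2; lia.
Qed.

Lemma spline_waveletE m (x : R) : (1 < m)%N ->
  spline_wavelet m x =
  \sum_(s < 4 * m) (wavelet_coef m)`_s * truncpow m.-1 (2 * x - s%:R).
Proof.
move=> m1; have m0 : (0 < m)%N by exact: ltnW.
transitivity (\sum_(s < (2 * m).-1 + (2 * m).+1)
    (wavelet_coef m)`_s * truncpow m.-1 (2 * x - s%:R)); last first.
  by have -> : ((2 * m).-1 + (2 * m).+1 = 4 * m)%N by lia.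
rewrite /wavelet_coef mulrC.
rewrite -(sum_coefM _ _ _ (fun s => truncpow m.-1 (2 * x - s%:R))); first last.
- exact: size_oneBX_exp.
- by rewrite (leq_trans (size_scale_leq _ _)) // size_poly.
rewrite /spline_wavelet big_mkord; apply: eq_bigr => i _.
rewrite derive1n_bspline; last by lia.
have -> : ((2 * m).-1 - m = m.-1)%N by lia.
rewrite big_mkord !mulr_sumr; apply: eq_bigr => j _.
rewrite coefZ coef_poly ltn_ord coef_oneBX_exp natrD opprD addrA invfM.
ring.
Qed.

(** The index shift loses nothing because N_2m(0) = 0, and the alternating signs become the
    substitution of -X. This is the origin of the shift by pi/2 in the argument of the symbol. *)
Lemma wavelet_symbolX m : (0 < m)%N ->
  'X * wavelet_symbol m = - (bspline_symbol (2 * m) \Po (- 'X)).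
Proof.
move=> m0; apply/polyP => i; rewrite coefXM coefN coef_comp_opp !coef_poly.
case: i => [|i] /=.
  rewrite expr0 mul1r muln_gt0 m0 /=.
  have -> : bspline (2 * m) (0 : R) = 0.
    rewrite (bspline_natE _ 0); last by lia.
    rewrite big_ord1 subrr expr0n.
    have -> : ((2 * m).-1 == 0)%N = false by lia.
    by rewrite !mulr0.
  by rewrite oppr0.
have -> : (i < (2 * m).-1)%N = (i.+1 < 2 * m)%N by lia.
by case: ifP => _; rewrite ?mulr0 ?oppr0 // exprS mulN1r mulNr opprK.
Qed.

End WaveletCoefficients.

(** * Cosine integrals by repeated integration by parts *)

Section CosineMoments.
Context {R : realType}.
Local Notation mu := (@lebesgue_measure R).
Implicit Types (x c w phi T : R).

Lemma Rintegral_FTC2 (f F : R -> R) (a b : R) : a <= b ->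
  (forall x, is_derive x 1 F (f x)) -> continuous f ->
  \int[mu]_(x in `[a, b]) f x = F b - F a.
Proof.
rewrite le_eqVlt => /orP[/eqP <-|ab] dF cf.
  by rewrite subrr set_itv1 Rintegral_set1.
have cF : continuous F.
  move=> x; apply: differentiable_continuous; apply/derivable1_diffP.
  by have [] := dF x.
rewrite /Rintegral (continuous_FTC2 ab (continuous_subspaceT cf) (F := F)) //.
- split=> [x _||]; first by have [] := dF x.
    exact: cvg_at_right_filter (cF a).
  exact: cvg_at_left_filter (cF b).
- by move=> x _; rewrite derive1E; apply: derive_val.
Qed.

(* Primitive of [(x - c) ^+ n * cos (x * w + phi)] obtained by repeated integration by parts. *)
Fixpoint cos_primitive (n : nat) (c w phi x : R) : R :=
  if n is n'.+1 then
    (x - c) ^+ n * (cos (x * w + phi - pi / 2) / w) -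
    n%:R / w * cos_primitive n' c w (phi - pi / 2) x
  else cos (x * w + phi - pi / 2) / w.

Lemma is_derive_cos_shift w phi x : w != 0 ->
  is_derive x 1 (fun y => cos (y * w + phi - pi / 2) / w) (cos (x * w + phi)).
Proof.
move=> w0; have D : is_derive x 1 (fun y => y * w + phi - pi / 2) w.
  by apply: is_derive_eq; rewrite /GRing.scale /=; ring.
apply: is_derive_eq; rewrite /GRing.scale /=.
have -> : sin (x * w + phi - pi / 2) = - cos (x * w + phi).
  by rewrite sinBpihalf.
by field.
Qed.

Lemma is_derive_cos_primitive n c w phi x : w != 0 ->
  is_derive x 1 (cos_primitive n c w phi) ((x - c) ^+ n * cos (x * w + phi)).
Proof.
move=> w0; elim: n phi => [|n IH] phi /=.
  by rewrite mul1r; exact: is_derive_cos_shift.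
have D1 := is_derive_cos_shift w phi x w0.
have D2 : is_derive x 1 (fun y => (y - c) ^+ n.+1) (n.+1%:R * (x - c) ^+ n).
  have -> : (fun y => (y - c) ^+ n.+1) = (id - cst c) ^+ n.+1.
    by apply/funext => y; rewrite fctE.
  by apply: is_derive_eq; rewrite /GRing.scale /=; ring.
have D3 := IH (phi - pi / 2).
have D4 := is_deriveB (is_deriveM D2 D1) (is_deriveZ (n.+1%:R / w) D3).
apply: (is_derive_eq D4); rewrite /GRing.scale /=.
have -> : x * w + (phi - pi / 2) = x * w + phi - pi / 2 by rewrite addrA.
by field.
Qed.

(** At x = c every term carrying a power of x - c vanishes and only the last integration by parts
    remains. *)
Lemma cos_primitive_diag n c w phi : w != 0 ->
  cos_primitive n c w phi c =
  (-1) ^+ n * n`!%:R / w ^+ n.+1 * cos (c * w + phi - n.+1%:R * (pi / 2)).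
Proof.
move=> w0; elim: n phi => [|n IH] phi /=.
  by rewrite expr0 fact0 expr1 !mul1r mulrC.
rewrite IH subrr expr0n mul0r sub0r factS natrM !exprS.
have -> : c * w + (phi - pi / 2) - n.+1%:R * (pi / 2) =
   c * w + phi - n.+2%:R * (pi / 2) by rewrite -[n.+2]addn1 natrD; ring.
by field; rewrite expf_neq0 // w0.
Qed.

(* As a function of the knot s / 2 the boundary term is a polynomial of degree at most n, so it is
   killed by the vanishing moments of the wavelet coefficients. *)
Lemma cos_primitive_poly n w phi x : exists2 p : {poly R}, (size p <= n.+1)%N &
  forall s, cos_primitive n (s / 2) w phi x = p.[s].
Proof.
elim: n phi => [|n IH] phi.
  exists (cos (x * w + phi - pi / 2) / w)%:P; first exact: size_polyC_leq1.
  by move=> s; rewrite hornerC.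
have [p sp Ep] := IH (phi - pi / 2).
exists ((cos (x * w + phi - pi / 2) / w) *: (x%:P - 2^-1 *: 'X) ^+ n.+1 -
        (n.+1%:R / w) *: p); last first.
  by move=> s; rewrite /= Ep !hornerE /= [s / 2]mulrC -mulrA [X in X - _]mulrC.
rewrite (leq_trans (size_polyD _ _)) // geq_max size_polyN; apply/andP; split; last first.
  by rewrite (leq_trans (size_scale_leq _ _)) // (leq_trans sp).
rewrite (leq_trans (size_scale_leq _ _)) // (leq_trans (size_poly_exp_leq _ _)) // ltnS.
rewrite -[leqRHS]mul1n leq_mul2r; apply/orP; right.
have : (size (x%:P - 2^-1 *: 'X)%R <= 2)%N.
  rewrite (leq_trans (size_polyD _ _)) // geq_max size_polyN size_polyC.
  by rewrite (leq_trans (leq_b1 _)) //= (leq_trans (size_scale_leq _ _)) // size_polyX.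
by case: (size _) => [|[|[]]].
Qed.

Lemma sum_wavelet_coef_poly m (p : {poly R}) : (0 < m)%N -> (size p <= 2 * m)%N ->
  \sum_(s < 4 * m) (wavelet_coef m)`_s * p.[s%:R] = 0.
Proof.
move=> m0 sp; apply: moment_poly_eq0 => //; exact: size_wavelet_coef.
Qed.

Lemma Rintegral_sum n (f : 'I_n -> R -> R) :
  (forall i, mu.-integrable setT (EFin \o f i)) ->
  \int[mu]_x (\sum_(i < n) f i x) = \sum_(i < n) \int[mu]_x f i x.
Proof.
elim: n f => [|n IH] f fi.
  under eq_Rintegral do rewrite big_ord0.
  by rewrite big_ord0 Rintegral_cst // mul0r.
rewrite big_ord_recr -(IH (fun i => f (widen_ord (leqnSn n) i))) //=.
rewrite -RintegralD //; first by apply: eq_Rintegral => x _; rewrite big_ord_recr.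
have := @integrable_sum _ _ _ mu setT measurableT _ (index_enum 'I_n) xpredT
  (fun i => EFin \o f (widen_ord (leqnSn n) i)) (fun i _ => fi _).
by apply: eq_integrable => // x _; rewrite /= sumEFin.
Qed.

(** The phase [phi] covers both components of the Fourier integral: 0 gives the cosine and pi/2
    gives minus the sine. *)
Lemma Rintegral_spline_cos m w phi : (1 < m)%N -> w != 0 ->
  \int[mu]_x (spline_wavelet m x * cos (x * w + phi)) =
  (-1) ^+ m * (2 ^+ m.-1 * (m.-1)`!%:R) / w ^+ m *
  \sum_(s < 4 * m) (wavelet_coef m)`_s *
     cos (s%:R / 2 * w + phi - m%:R * (pi / 2)).
Proof.
move=> m1 w0; have m0 : (0 < m)%N by exact: ltnW.
have [n En] : exists n, m = n.+2 by exists m.-2; lia.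
(* All knots s / 2 with s < 4 m lie below T = 2 m. Past T no power is truncated, so the wavelet is a
   moment of a polynomial of degree m - 1 in the knot index and vanishes. *)
set T : R := 2 * m%:R.
have sT (s : 'I_(4 * m)) : s%:R / 2 <= T.
  rewrite /T ler_pdivrMr // -natrM -natrM ler_nat.
  by have := ltn_ord s; lia.
pose g (s : 'I_(4 * m)) x := (x - s%:R / 2) ^+ m.-1 * cos (x * w + phi).
have cg s : continuous (g s).
  have c1 : continuous (fun y : R => (y - s%:R / 2) ^+ m.-1).
    move=> x; apply: (@continuous_comp _ _ _ (fun y : R => y - s%:R / 2) (fun y : R => y ^+ m.-1)).
      by apply: cvgB; [exact: cvg_id | exact: cvg_cst].
    exact: exprn_continuous.
  have c2 : continuous (fun y : R => cos (y * w + phi)).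
    move=> x; apply: (@continuous_comp _ _ _ (fun y : R => y * w + phi) (@cos R)); last exact:
      continuous_cos.
    apply: cvgD; last exact: cvg_cst.
    by apply: cvgM; [exact: cvg_id | exact: cvg_cst].
  by move=> x; apply: cvgM; [exact: c1 | exact: c2].
pose f (s : 'I_(4 * m)) x := 2 ^+ m.-1 * (wavelet_coef m)`_s * (g s \_ `[s%:R / 2, T]) x.
have E x : spline_wavelet m x * cos (x * w + phi) = \sum_(s < 4 * m) f s x.
  rewrite spline_waveletE // mulr_suml.
  have tp s : truncpow m.-1 (2 * x - s%:R) =
     if s%:R / 2 <= x then 2 ^+ m.-1 * (x - s%:R / 2) ^+ m.-1 else 0 :> R.
    rewrite /truncpow; have -> : (0 <= 2 * x - s%:R) = (s%:R / 2 <= x).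
      by apply/idP/idP; lra.
    by case: ifP => // _; rewrite -exprMn; congr (_ ^+ _); field.
  have [xT|Tx] := leP x T.
    apply: eq_bigr => s _; rewrite /f /g tp patchE mem_setE in_itv /= xT andbT.
    by case: ifP => _; [ring | rewrite !(mulr0, mul0r)].
  rewrite [RHS]big1; last first.
    move=> s _; rewrite /f patchE mem_setE in_itv /=.
    by rewrite (lt_geF Tx) andbF mulr0.
  rewrite -mulr_suml.
  have sz : (size (((2 * x)%:P - 'X) ^+ m.-1)%R <= 2 * m)%N.
    by rewrite (leq_trans (size_subX_exp _ _)) //; lia.
  rewrite [X in X * _](_ : _ = 0) ?mul0r //.
  rewrite -[RHS](sum_wavelet_coef_poly _ _ m0 sz); apply: eq_bigr => s _.
  rewrite !hornerE /truncpow; case: ifP => // /negP[].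
  by have := sT s; lra.
have ig (s : 'I_(4 * m)) : mu.-integrable setT (EFin \o (g s \_ `[s%:R / 2, T])).
  rewrite -restrict_EFin; apply/(integrable_mkcond _ _).1 => //.
  apply: continuous_compact_integrable; first exact: segment_compact.
  exact: continuous_subspaceT.
under eq_Rintegral do rewrite E.
rewrite Rintegral_sum; last first.
  move=> s; rewrite /f.
  have := @integrableZl _ _ _ mu setT measurableT (2 ^+ m.-1 * (wavelet_coef m)`_s) _ (ig s).
  by apply: eq_integrable => // x _.
have Ig (s : 'I_(4 * m)) : \int[mu]_x f s x =
    2 ^+ m.-1 * (wavelet_coef m)`_s * (cos_primitive m.-1 (s%:R / 2) w phi T -
      cos_primitive m.-1 (s%:R / 2) w phi (s%:R / 2)).
  rewrite RintegralZl // -Rintegral_mkcond; congr (_ * _).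
  apply: Rintegral_FTC2 => // x.
  exact: is_derive_cos_primitive.
rewrite (eq_bigr _ (fun s _ => Ig s)).
have [p sp Ep] := cos_primitive_poly m.-1 w phi T.
have sp' : (size p <= 2 * m)%N by rewrite (leq_trans sp) //; lia.
have P0 := sum_wavelet_coef_poly _ _ m0 sp'.
under eq_bigr do rewrite Ep mulrBr.
rewrite sumrB -(eq_bigr _ (fun s _ => mulrA _ _ _)) -mulr_sumr P0 mulr0 sub0r.
rewrite -sumrN mulr_sumr; apply: eq_bigr => s _.
rewrite cos_primitive_diag // prednK //.
have -> : (-1) ^+ m = - (-1) ^+ m.-1 :> R by rewrite -[in LHS](prednK m0) exprS mulN1r.
by field; rewrite expf_neq0 // w0.
Qed.

End CosineMoments.

(** * Modulus of the Fourier transform *)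

Section FourierClosedForm.
Context {R : realType}.
Local Open Scope complex_scope.
Import ComplexField.Normc.
Implicit Types (x w : R).

(** The modulus of the transform without the factor (2 pi)^(-1/2), for w nonzero. At w = 0 the
    convention 0^-1 = 0 makes it 0 when m > 0. *)
Definition wavelet_envelope (m : nat) (w : R) : R :=
  (4 * sin (w / 4) ^+ 2 / `|w|) ^+ m *
  normc (centered_symbol m (w / 4 + pi / 2)).

(** For z = exp(-i w / 2), |1 - z| = 2 |sin(w / 4)| and -z = exp(-2 i (w / 4 + pi / 2)), so
    [wavelet_symbolX] brings in the symbol. *)
Lemma normc_wavelet_coef m w : (0 < m)%N ->
  normc (map_poly (real_complex R) (wavelet_coef m)).[expi (- (w / 2))] =
  (4 * sin (w / 4) ^+ 2) ^+ m / (2 ^+ m.-1 * (m.-1)`!%:R) *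
  normc (centered_symbol m (w / 4 + pi / 2)).
Proof.
move=> m0; set z := expi (- (w / 2)).
have z1 : normc z = 1 by exact: normc_expi.
have E1 : normc (1 - z) ^+ 2 = 4 * sin (w / 4) ^+ 2.
  rewrite /z subr_expiN normcM normc_expi mul1r.
  have -> : w / 2 / 2 = w / 4 by lra.
  rewrite /= expr0n /= add0r sqr_sqrtr ?sqr_ge0 // exprMn.
  by ring.
have E2 : normc (map_poly (real_complex R) (wavelet_symbol m)).[z] =
    normc (centered_symbol m (w / 4 + pi / 2)).
  rewrite -[LHS]mul1r -{1}z1 -normcM.
  have := congr1 (fun p => (map_poly (real_complex R) p).[z]) (@wavelet_symbolX R m m0).
  rewrite rmorphM rmorphN /= map_polyX map_comp_poly rmorphN /= map_polyX.
  rewrite !hornerE horner_comp !hornerE => ->.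
  rewrite normcN /centered_symbol normcM normc_expi mul1r.
  congr (normc _.[_]).
  have -> : - (2 * (w / 4 + pi / 2)) = - (w / 2) + - pi by lra.
  rewrite /z expiD /expi [cos (- pi)]cosN [sin (- pi)]sinN cospi sinpi; simpc.
  by congr (_ +i* _); ring.
rewrite /wavelet_coef rmorphM rmorphXn rmorphB /= rmorph1 map_polyX map_polyZ.
rewrite hornerM hornerZ horner_exp hornerD hornerN hornerX hornerC.
rewrite [LHS]normcM [in LHS]normcM normcX exprM E1 E2 normcR.
rewrite ger0_norm ?invr_ge0 ?mulr_ge0 ?exprn_ge0 //.
by rewrite mulrA.
Qed.

Lemma normc_fourier_wavelet m w : (1 < m)%N -> w != 0 ->
  normc (fourier (spline_wavelet m) w) =
  (Num.sqrt (2 * pi))^-1 * wavelet_envelope m w.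
Proof.
move=> m1 w0; have m0 : (0 < m)%N by exact: ltnW.
rewrite /fourier normcM normcR ger0_norm ?invr_ge0 ?sqrtr_ge0 //; congr (_ * _).
have K0 : 0 <= 2 ^+ m.-1 * (m.-1)`!%:R :> R by rewrite mulr_ge0 // exprn_ge0.
set C : R := (-1) ^+ m * (2 ^+ m.-1 * (m.-1)`!%:R) / w ^+ m.
have -> : cintegral (fun x => (spline_wavelet m x)%:C * expi (- (x * w))) =
   C%:C * (expi (m%:R * (pi / 2)) *
    (map_poly (real_complex R) (wavelet_coef m)).[expi (- (w / 2))]).
  rewrite (@horner_coef_wide _ (4 * m)); last first.
    by rewrite (leq_trans (size_poly _ _)) // size_wavelet_coef.
  (* The common phase m pi / 2 matches the m quarter turns caused by integrating by parts. Real and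
     imaginary parts are the cases phi = 0 and phi = pi / 2 of [Rintegral_spline_cos]. *)
  have term (s : 'I_(4 * m)) : expi (m%:R * (pi / 2)) *
      ((map_poly (real_complex R) (wavelet_coef m))`_s * expi (- (w / 2)) ^+ s) =
      ((wavelet_coef m)`_s * cos (s%:R / 2 * w + 0 - m%:R * (pi / 2))) +i*
      ((wavelet_coef m)`_s * cos (s%:R / 2 * w + pi / 2 - m%:R * (pi / 2))).
    rewrite coef_map /= mulrCA expiX -expiD.
    have -> : m%:R * (pi / 2) + s%:R * - (w / 2) =
      - (s%:R / 2 * w - m%:R * (pi / 2)) by ring.
    have -> : s%:R / 2 * w + pi / 2 - m%:R * (pi / 2) =
       (s%:R / 2 * w - m%:R * (pi / 2)) + pi / 2 by ring.
    rewrite cosDpihalf addr0 /expi cosN sinN.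
    by rewrite /= /real_complex_def; simpc.
  rewrite mulr_sumr (eq_bigr _ (fun s _ => term s)).
  have sumC n (a b : 'I_n -> R) :
      \sum_(s < n) (a s +i* b s) = (\sum_(s < n) a s) +i* (\sum_(s < n) b s).
    elim: n a b => [|n IH] a b; first by rewrite !big_ord0.
    by rewrite !big_ord_recr /= IH; simpc.
  rewrite sumC /cintegral.
  rewrite /real_complex_def; simpc.
  rewrite -!Rintegral_spline_cos //; congr (_ +i* _).
    apply: eq_Rintegral => x _.
    by rewrite /= addr0 mul0r subr0 cosN.
  apply: eq_Rintegral => x _.
  by rewrite /= mul0r addr0 sinN cosDpihalf.
rewrite !normcM normc_expi mul1r normcR normc_wavelet_coef // /wavelet_envelope.
have -> : `|C| = 2 ^+ m.-1 * (m.-1)`!%:R / `|w| ^+ m.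
  by rewrite /C !normrM normfV !normrX normrN1 expr1n mul1r !normr_nat.
set X := normc _; rewrite [in RHS]exprMn exprVn; field.
by rewrite !expf_neq0 ?normr_eq0 // pnatr_eq0 -?lt0n fact_gt0.
Qed.

End FourierClosedForm.

(** * Numerical values *)

Section LogLambda.
Context {R : realType}.
Implicit Types (u v : R).

Definition ln_lambda_deriv u : R :=
  2 * (cos u / sin u) - 2 * (sin u / cos u) + (pi / 2 - u)^-1 - 2 / u.

(** Minus one half of the second derivative of ln lambda, so that its value at xi_2 is Lambda_2. *)
Definition ln_lambda_curv u : R :=
  sin u ^- 2 + cos u ^- 2 - (pi / 2 - u) ^- 2 / 2 - u ^- 2.

Lemma sin_gt0_quarter u : 0 < u < pi / 2 -> 0 < sin u.
Proof.
by move=> /andP[u0 u1]; rewrite sin_gt0_pi // u0; have := @pi_gt0 R; lra.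
Qed.

Lemma cos_gt0_quarter u : 0 < u < pi / 2 -> 0 < cos u.
Proof. by move=> /andP[u0 u1]; rewrite cos_gt0_pihalf //; lra. Qed.

Lemma lambda_funE u :
  lambda_fun u = (cos u * sin u) ^+ 2 / ((pi / 2 - u) * u ^+ 2).
Proof. by rewrite /lambda_fun sinBpihalf sqrrN -exprMn. Qed.

Lemma lambda_fun_gt0 u : 0 < u < pi / 2 -> 0 < lambda_fun u.
Proof.
move=> h; have s0 := sin_gt0_quarter _ h; have c0 := cos_gt0_quarter _ h.
have /andP[u0 u1] := h.
by rewrite lambda_funE divr_gt0 ?exprn_gt0 ?mulr_gt0 ?exprn_gt0 // subr_gt0.
Qed.

Lemma ln_lambda_funE u : 0 < u < pi / 2 -> ln (lambda_fun u) =
  2 * ln (cos u) + 2 * ln (sin u) - ln (pi / 2 - u) - 2 * ln u.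
Proof.
move=> h; have s0 := sin_gt0_quarter _ h; have c0 := cos_gt0_quarter _ h.
have /andP[u0 u1] := h; have y0 : 0 < pi / 2 - u by rewrite subr_gt0.
rewrite lambda_funE ln_div ?posrE ?exprn_gt0 ?mulr_gt0 ?exprn_gt0 //.
rewrite lnM ?posrE ?exprn_gt0 // !lnXn ?mulr_gt0 // lnM ?posrE //.
by ring.
Qed.

Lemma near_quarter u : 0 < u < pi / 2 -> \forall v \near u, 0 < v < pi / 2.
Proof.
move=> /andP[u0 u1]; near=> v; apply/andP; split; near: v.
- exact: lt_nbhsr.
- exact: lt_nbhsl.
Unshelve. all: by end_near.
Qed.

Lemma is_derive_csubr (a u : R) : is_derive u 1 (fun v => a - v) (- 1).
Proof.
apply: (is_derive_eq (is_deriveB (is_derive_cst a u 1) (is_derive_id u 1))).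
by rewrite sub0r.
Qed.

Lemma is_derive_ln_lambda u : 0 < u < pi / 2 ->
  is_derive u 1 (fun v => ln (lambda_fun v)) (ln_lambda_deriv u).
Proof.
move=> h; have s0 := sin_gt0_quarter _ h; have c0 := cos_gt0_quarter _ h.
have /andP[u0 u1] := h; have y0 : 0 < pi / 2 - u by rewrite subr_gt0.
have E : \near u, 2 * ln (cos u) + 2 * ln (sin u) - ln (pi / 2 - u) - 2 * ln u =
    ln (lambda_fun u).
  by near=> v; rewrite ln_lambda_funE //; near: v; exact: near_quarter.
apply: (near_eq_is_derive E).
have D1 := @is_derive1_comp _ _ _ u _ _ (is_derive1_ln c0) (is_derive_cos u).
have D2 := @is_derive1_comp _ _ _ u _ _ (is_derive1_ln s0) (is_derive_sin u).
have D3a : is_derive u 1 (fun v => pi / 2 - v) (- 1).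
  exact: is_derive_csubr.
have D3 := @is_derive1_comp _ _ (fun v => pi / 2 - v) u _ _ (is_derive1_ln y0) D3a.
have D4 := is_derive1_ln u0.
have D5 := is_deriveB (is_deriveB (is_deriveD (is_deriveZ 2 D1) (is_deriveZ 2 D2)) D3)
  (is_deriveZ 2 D4).
apply: (is_derive_eq D5); rewrite /GRing.scale /= /ln_lambda_deriv.
by move: y0; set y := pi / 2 - u => y0; field; rewrite !gt_eqF.
Unshelve. all: by end_near.
Qed.

Lemma is_derive_ln_lambda_deriv u : 0 < u < pi / 2 ->
  is_derive u 1 ln_lambda_deriv (- (2 * ln_lambda_curv u)).
Proof.
move=> h; have s0 := sin_gt0_quarter _ h; have c0 := cos_gt0_quarter _ h.
have /andP[u0 u1] := h; have y0 : 0 < pi / 2 - u by rewrite subr_gt0.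
have s1 : sin u != 0 by rewrite gt_eqF.
have c1 : cos u != 0 by rewrite gt_eqF.
have y1 : pi / 2 - u != 0 by rewrite gt_eqF.
have u2 : u != 0 by rewrite gt_eqF.
have Dy : is_derive u 1 (fun v => pi / 2 - v) (- 1).
  exact: is_derive_csubr.
have I1 := is_deriveV s1 (is_derive_sin u).
have I2 := is_deriveV c1 (is_derive_cos u).
have I3 := @is_deriveV _ (fun v => pi / 2 - v) u _ _ y1 Dy.
have I4 := is_deriveV u2 (is_derive_id u 1).
have D := is_deriveB (is_deriveD (is_deriveB
  (is_deriveZ 2 (is_deriveM (is_derive_cos u) I1))
  (is_deriveZ 2 (is_deriveM (is_derive_sin u) I2))) I3) (is_deriveZ 2 I4).
apply: (is_derive_eq D); rewrite /GRing.scale /= /ln_lambda_curv.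
have c2 : cos u ^+ 2 = 1 - sin u ^+ 2 by rewrite cos2sin2.
have e1 : cos u ^- 2 = 1 + (sin u / cos u) ^+ 2.
  by rewrite expr_div_n -[1](divff (expf_neq0 2 c1)) -mulrDl cos2Dsin2 mul1r.
have e2 : sin u ^- 2 = 1 + (cos u / sin u) ^+ 2.
  by rewrite expr_div_n -[1](divff (expf_neq0 2 s1)) -mulrDl addrC cos2Dsin2 mul1r.
by rewrite [in RHS]e1 [in RHS]e2; move: y1; set y := pi / 2 - u => y1; field; rewrite s1 c1 u2 y1.
Qed.

Lemma Lambda_funE u : 0 < u < pi / 2 -> Lambda_fun u = ln_lambda_curv u.
Proof.
move=> h; rewrite /Lambda_fun /= derive1E.
have -> : 'D_1 (derive1 (fun v : R => ln (lambda_fun v))) u = 'D_1 ln_lambda_deriv u.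
  apply: near_eq_derive; near=> v; rewrite derive1E.
  apply: derive_val; apply: is_derive_ln_lambda; near: v; exact: near_quarter.
have D := is_derive_ln_lambda_deriv _ h.
by rewrite derive_val; field.
Unshelve. all: by end_near.
Qed.

Lemma ler_cos_sub (u : R) : 0 < u < pi / 2 -> cos u <= pi / 2 - u.
Proof.
move=> /andP[u0 u1]; have -> : cos u = sin (pi / 2 - u).
  by rewrite -cosBpihalf -cosN; congr cos; lra.
by apply: sin_le_id; lra.
Qed.

(** After sin u <= u and cos u <= pi / 2 - u, what remains is at least cos(u)^(-2) / 2. *)
Lemma ln_lambda_curv_ge u : 0 < u < pi / 2 -> 2^-1 <= ln_lambda_curv u.
Proof.
move=> h; have s0 := sin_gt0_quarter _ h; have c0 := cos_gt0_quarter _ h.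
have /andP[u0 u1] := h; have y0 : 0 < pi / 2 - u by rewrite subr_gt0.
have h1 : u ^- 2 <= sin u ^- 2.
  rewrite lef_pV2 ?posrE ?exprn_gt0 // lerXn2r ?nnegrE ?(ltW s0) ?(ltW u0) //.
  by apply: sin_le_id; exact: ltW.
have h2 : (pi / 2 - u) ^- 2 <= cos u ^- 2.
  by rewrite lef_pV2 ?posrE ?exprn_gt0 // lerXn2r ?nnegrE ?(ltW c0) ?(ltW y0) // ler_cos_sub.
have h3 : 1 <= cos u ^- 2.
  by rewrite invf_ge1 ?exprn_gt0 // exprn_ile1 ?(ltW c0) // cos_le1.
by rewrite /ln_lambda_curv; lra.
Qed.

(** The transcendental equation is the critical-point equation of ln lambda cleared of denominators;
    the extra factor is positive on (0, pi / 2). *)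
Lemma xi2_equationE u : 0 < u < pi / 2 ->
  (2 * pi * u - 4 * u ^+ 2) * cos (2 * u) + (3 * u - pi) * sin (2 * u) =
  ln_lambda_deriv u * (2 * u * (pi / 2 - u) * (sin u * cos u)).
Proof.
move=> h; have s0 := sin_gt0_quarter _ h; have c0 := cos_gt0_quarter _ h.
have /andP[u0 u1] := h; have y0 : 0 < pi / 2 - u by rewrite subr_gt0.
rewrite /ln_lambda_deriv !mulr_natl sin_mulr2n cos_mulr2n.
have -> : cos u ^+ 2 *+ 2 - 1 = cos u ^+ 2 - sin u ^+ 2.
  by rewrite sin2cos2; ring.
have -> : pi = 2 * (pi / 2 - u) + 2 * u :> R by lra.
move: y0; have -> : (2 * (pi / 2 - u) + 2 * u) / 2 - u = pi / 2 - u :> R by lra.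
by set y := pi / 2 - u => y0; field; rewrite !gt_eqF.
Qed.

Lemma xi2_equationP u : 0 < u < pi / 2 ->
  xi2_equation u <-> ln_lambda_deriv u = 0.
Proof.
move=> h; have s0 := sin_gt0_quarter _ h; have c0 := cos_gt0_quarter _ h.
have /andP[u0 u1] := h; have y0 : 0 < pi / 2 - u by rewrite subr_gt0.
rewrite /xi2_equation xi2_equationE //; split=> [/eqP|->]; last by rewrite mul0r.
rewrite mulf_eq0 => /orP[/eqP //|]; rewrite !mulf_eq0 !gt_eqF //.
Qed.

Lemma ln_lambda_deriv_decr u v : 0 < u < pi / 2 -> 0 < v < pi / 2 -> u <= v ->
  ln_lambda_deriv v <= ln_lambda_deriv u - (v - u).
Proof.
move=> /andP[u0 u1] /andP[v0 v1] uv.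
have [c /andP[c0 c1] E] := mean_value _ _ _ _ uv (fun x xuv =>
  is_derive_ln_lambda_deriv x (introT andP (conj
   (lt_le_trans u0 (proj1 (andP xuv))) (le_lt_trans (proj2 (andP xuv)) v1)))).
have hc : 0 < c < pi / 2 by rewrite (lt_le_trans u0) //= (le_lt_trans c1).
have := ln_lambda_curv_ge _ hc.
move: E; set L := ln_lambda_curv c; set a := ln_lambda_deriv v; set b := ln_lambda_deriv u.
nra.
Qed.

End LogLambda.

(** * Rational enclosures of pi, xi_2, lambda_2 and Lambda_2 *)

Section Numerics.
Context {R : realType}.
Implicit Types (x u : R).

(** First of a chain of alternating Taylor bounds in nested form: each difference vanishes at 0 and
    its derivative is the difference bounded just before. *)
Lemma cos_taylor2 x : 0 <= x -> (1 - x ^+ 2 / 2) <= cos x.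
Proof.
move=> x0; rewrite -subr_ge0.
have -> : 0 = (fun y : R => cos y - ((1 - y ^+ 2 / 2))) 0 by rewrite cos0; field.
apply: (deriv_ge0_le (fun y => cos y - ((1 - y ^+ 2 / 2))) (fun y => y - sin y) _ _ x0).
  by move=> y _; apply: is_derive_eq; rewrite /GRing.scale /=; field.
by move=> y /andP[y0 _]; rewrite subr_ge0; exact: sin_le_id.
Qed.

Lemma sin_taylor3 x : 0 <= x -> x * (1 - x ^+ 2 / 6) <= sin x.
Proof.
move=> x0; rewrite -subr_ge0.
have -> : 0 = (fun y : R => sin y - y * (1 - y ^+ 2 / 6)) 0 by rewrite sin0; field.
apply: (deriv_ge0_le (fun y => sin y - y * (1 - y ^+ 2 / 6)) (fun y => cos y - (1 - y ^+ 2 / 2))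
  _ _ x0).
  by move=> y _; apply: is_derive_eq; rewrite /GRing.scale /=; field.
by move=> y /andP[y0 _]; rewrite subr_ge0; exact: cos_taylor2.
Qed.

Lemma cos_taylor4 x : 0 <= x -> cos x <= (1 - x ^+ 2 / 2 * (1 - x ^+ 2 / 12)).
Proof.
move=> x0; rewrite -subr_ge0.
have -> : 0 = (fun y : R => (1 - y ^+ 2 / 2 * (1 - y ^+ 2 / 12)) - cos y) 0 by rewrite cos0; field.
apply: (deriv_ge0_le (fun y => (1 - y ^+ 2 / 2 * (1 - y ^+ 2 / 12)) - cos y) (fun y => sin y - y
  * (1 - y ^+ 2 / 6)) _ _ x0).
  by move=> y _; apply: is_derive_eq; rewrite /GRing.scale /=; field.
by move=> y /andP[y0 _]; rewrite subr_ge0; exact: sin_taylor3.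
Qed.

Lemma sin_taylor5 x : 0 <= x -> sin x <= x * (1 - x ^+ 2 / 6 * (1 - x ^+ 2 / 20)).
Proof.
move=> x0; rewrite -subr_ge0.
have -> : 0 = (fun y : R => y * (1 - y ^+ 2 / 6 * (1 - y ^+ 2 / 20)) - sin y) 0 by rewrite sin0;
  field.
apply: (deriv_ge0_le (fun y => y * (1 - y ^+ 2 / 6 * (1 - y ^+ 2 / 20)) - sin y) (fun y => (1 -
  y ^+ 2 / 2 * (1 - y ^+ 2 / 12)) - cos y) _ _ x0).
  by move=> y _; apply: is_derive_eq; rewrite /GRing.scale /=; field.
by move=> y /andP[y0 _]; rewrite subr_ge0; exact: cos_taylor4.
Qed.

Lemma cos_taylor6 x : 0 <= x -> (1 - x ^+ 2 / 2 * (1 - x ^+ 2 / 12 * (1 - x ^+ 2 / 30))) <= cos x.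
Proof.
move=> x0; rewrite -subr_ge0.
have -> : 0 = (fun y : R => cos y - ((1 - y ^+ 2 / 2 * (1 - y ^+ 2 / 12 * (1 - y ^+ 2 / 30)))))
  0 by rewrite cos0; field.
apply: (deriv_ge0_le (fun y => cos y - ((1 - y ^+ 2 / 2 * (1 - y ^+ 2 / 12 * (1 - y ^+ 2 /
  30))))) (fun y => y * (1 - y ^+ 2 / 6 * (1 - y ^+ 2 / 20)) - sin y) _ _ x0).
  by move=> y _; apply: is_derive_eq; rewrite /GRing.scale /=; field.
by move=> y /andP[y0 _]; rewrite subr_ge0; exact: sin_taylor5.
Qed.

Lemma sin_taylor7 x : 0 <= x -> x * (1 - x ^+ 2 / 6 * (1 - x ^+ 2 / 20 * (1 - x ^+ 2 / 42))) <=
  sin x.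
Proof.
move=> x0; rewrite -subr_ge0.
have -> : 0 = (fun y : R => sin y - y * (1 - y ^+ 2 / 6 * (1 - y ^+ 2 / 20 * (1 - y ^+ 2 /
  42)))) 0 by rewrite sin0; field.
apply: (deriv_ge0_le (fun y => sin y - y * (1 - y ^+ 2 / 6 * (1 - y ^+ 2 / 20 * (1 - y ^+ 2 /
  42)))) (fun y => cos y - (1 - y ^+ 2 / 2 * (1 - y ^+ 2 / 12 * (1 - y ^+ 2 / 30)))) _ _ x0).
  by move=> y _; apply: is_derive_eq; rewrite /GRing.scale /=; field.
by move=> y /andP[y0 _]; rewrite subr_ge0; exact: cos_taylor6.
Qed.

Lemma cos_taylor8 x : 0 <= x -> cos x <= (1 - x ^+ 2 / 2 * (1 - x ^+ 2 / 12 * (1 - x ^+ 2 / 30 *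
  (1 - x ^+ 2 / 56)))).
Proof.
move=> x0; rewrite -subr_ge0.
have -> : 0 = (fun y : R => (1 - y ^+ 2 / 2 * (1 - y ^+ 2 / 12 * (1 - y ^+ 2 / 30 * (1 - y ^+ 2
  / 56)))) - cos y) 0 by rewrite cos0; field.
apply: (deriv_ge0_le (fun y => (1 - y ^+ 2 / 2 * (1 - y ^+ 2 / 12 * (1 - y ^+ 2 / 30 * (1 - y ^+
  2 / 56)))) - cos y) (fun y => sin y - y * (1 - y ^+ 2 / 6 * (1 - y ^+ 2 / 20 * (1 - y ^+ 2 /
    42)))) _ _ x0).
  by move=> y _; apply: is_derive_eq; rewrite /GRing.scale /=; field.
by move=> y /andP[y0 _]; rewrite subr_ge0; exact: sin_taylor7.
Qed.

Lemma sin_taylor9 x : 0 <= x -> sin x <= x * (1 - x ^+ 2 / 6 * (1 - x ^+ 2 / 20 * (1 - x ^+ 2 /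
  42 * (1 - x ^+ 2 / 72)))).
Proof.
move=> x0; rewrite -subr_ge0.
have -> : 0 = (fun y : R => y * (1 - y ^+ 2 / 6 * (1 - y ^+ 2 / 20 * (1 - y ^+ 2 / 42 * (1 - y
  ^+ 2 / 72)))) - sin y) 0 by rewrite sin0; field.
apply: (deriv_ge0_le (fun y => y * (1 - y ^+ 2 / 6 * (1 - y ^+ 2 / 20 * (1 - y ^+ 2 / 42 * (1 -
  y ^+ 2 / 72)))) - sin y) (fun y => (1 - y ^+ 2 / 2 * (1 - y ^+ 2 / 12 * (1 - y ^+ 2 / 30 * (1
    - y ^+ 2 / 56)))) - cos y) _ _ x0).
  by move=> y _; apply: is_derive_eq; rewrite /GRing.scale /=; field.
by move=> y /andP[y0 _]; rewrite subr_ge0; exact: cos_taylor8.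
Qed.

Lemma cos_taylor10 x : 0 <= x -> (1 - x ^+ 2 / 2 * (1 - x ^+ 2 / 12 * (1 - x ^+ 2 / 30 * (1 - x
  ^+ 2 / 56 * (1 - x ^+ 2 / 90))))) <= cos x.
Proof.
move=> x0; rewrite -subr_ge0.
have -> : 0 = (fun y : R => cos y - ((1 - y ^+ 2 / 2 * (1 - y ^+ 2 / 12 * (1 - y ^+ 2 / 30 * (1
  - y ^+ 2 / 56 * (1 - y ^+ 2 / 90))))))) 0 by rewrite cos0; field.
apply: (deriv_ge0_le (fun y => cos y - ((1 - y ^+ 2 / 2 * (1 - y ^+ 2 / 12 * (1 - y ^+ 2 / 30 *
  (1 - y ^+ 2 / 56 * (1 - y ^+ 2 / 90))))))) (fun y => y * (1 - y ^+ 2 / 6 * (1 - y ^+ 2 / 20 *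
    (1 - y ^+ 2 / 42 * (1 - y ^+ 2 / 72)))) - sin y) _ _ x0).
  by move=> y _; apply: is_derive_eq; rewrite /GRing.scale /=; field.
by move=> y /andP[y0 _]; rewrite subr_ge0; exact: sin_taylor9.
Qed.

Lemma sin_taylor11 x : 0 <= x -> x * (1 - x ^+ 2 / 6 * (1 - x ^+ 2 / 20 * (1 - x ^+ 2 / 42 * (1
  - x ^+ 2 / 72 * (1 - x ^+ 2 / 110))))) <= sin x.
Proof.
move=> x0; rewrite -subr_ge0.
have -> : 0 = (fun y : R => sin y - y * (1 - y ^+ 2 / 6 * (1 - y ^+ 2 / 20 * (1 - y ^+ 2 / 42 *
  (1 - y ^+ 2 / 72 * (1 - y ^+ 2 / 110)))))) 0 by rewrite sin0; field.
apply: (deriv_ge0_le (fun y => sin y - y * (1 - y ^+ 2 / 6 * (1 - y ^+ 2 / 20 * (1 - y ^+ 2 / 42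
  * (1 - y ^+ 2 / 72 * (1 - y ^+ 2 / 110)))))) (fun y => cos y - (1 - y ^+ 2 / 2 * (1 - y ^+ 2 /
    12 * (1 - y ^+ 2 / 30 * (1 - y ^+ 2 / 56 * (1 - y ^+ 2 / 90)))))) _ _ x0).
  by move=> y _; apply: is_derive_eq; rewrite /GRing.scale /=; field.
by move=> y /andP[y0 _]; rewrite subr_ge0; exact: cos_taylor10.
Qed.

(** Tripling the angle gives sin(pi / 2) = 1, which reads (s + 1) (2 s - 1)^2 = 0 with s > 0. *)
Lemma sin_pi_sixth : sin (pi / 6) = 2^-1 :> R.
Proof.
have pi0 := @pi_gt0 R.
have s0 : 0 < sin (pi / 6 : R) by rewrite sin_gt0_pi //; lra.
have h : sin (pi / 6 + pi / 6 + pi / 6) = 1 :> R.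
  by rewrite -[RHS]sin_pihalf; congr sin; lra.
have cs := cos2Dsin2 (pi / 6 : R).
move: h; rewrite !sinD cosD; set s := sin _ in s0 cs *; set c := cos _ in cs *.
move=> h; have e : (s + 1) * (2 * s - 1) ^+ 2 = 0.
  have -> : (s + 1) * (2 * s - 1) ^+ 2 = 1 - (3 * s * (1 - s ^+ 2) - s ^+ 3) by ring.
  have -> : 1 - s ^+ 2 = c ^+ 2 by lra.
  have -> : 1 - (3 * s * c ^+ 2 - s ^+ 3) = 1 - ((s * c + c * s) * c + (c * c - s * s) * s) by ring.
  by rewrite h subrr.
move/eqP: e; rewrite mulf_eq0 expf_eq0 /= => /orP[|] /eqP; lra.
Qed.

(* Numerals are unary, so decimals are written in base 1000. *)
Lemma pi_lower : (3 + (141 + (592 + 650 / 1000) / 1000) / 1000) <= pi :> R.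
Proof.
have pi2 := @pi_ge2 R; rewrite leNgt; apply/negP => h.
have : sin (pi / 6) < sin (((523 + (598 + (775 + 0 / 1000) / 1000) / 1000) / 1000) : R).
  by rewrite ltr_sin ?in_itv /=; [lra | apply/andP; split; lra | apply/andP; split; lra].
rewrite sin_pi_sixth; have := sin_taylor9 (((523 + (598 + (775 + 0 / 1000) / 1000) / 1000) /
  1000) : R).
set s := sin _; lra.
Qed.

(** If pi were larger, pi / 6 would exceed one sixth of the bound, rounded down; but the sine there
    is already at least 1/2 = sin(pi / 6). *)
Lemma pi_upper : pi <= (3 + (141 + (592 + 660 / 1000) / 1000) / 1000) :> R.
Proof.
have pi2 := @pi_ge2 R; rewrite leNgt; apply/negP => h.
have : sin (((523 + (598 + (776 + 666 / 1000) / 1000) / 1000) / 1000) : R) < sin (pi / 6).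
  by rewrite ltr_sin ?in_itv /=; [lra | apply/andP; split; lra | apply/andP; split; lra].
rewrite sin_pi_sixth; have := sin_taylor11 (((523 + (598 + (776 + 666 / 1000) / 1000) / 1000) /
  1000) : R).
set s := sin _; lra.
Qed.

Lemma sin_xi2_a : sin (((570 + (659 + 200 / 1000) / 1000) / 1000) : R) <= ((540 + (186 + (912 +
  (621 + 749 / 1000) / 1000) / 1000) / 1000) / 1000).
Proof. by have := sin_taylor9 (((570 + (659 + 200 / 1000) / 1000) / 1000) : R); move: (sin _) =>
  t; lra. Qed.

Lemma cos_xi2_a : ((841 + (545 + (66 + (817 + 249 / 1000) / 1000) / 1000) / 1000) / 1000) <= cos
  (((570 + (659 + 200 / 1000) / 1000) / 1000) : R).
Proof. by have := cos_taylor10 (((570 + (659 + 200 / 1000) / 1000) / 1000) : R); move: (cos _)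
  => t; lra. Qed.

(** The expression is affine in p with slope 2 u c - s, nonpositive because x cos x <= sin x at x =
    2 u; the upper bound of pi is therefore the worst case. *)
Lemma xi2_sign_a_aux (u p s c : R) : u = ((285 + (329 + 600 / 1000) / 1000) / 1000) -> 2 * u * c
  <= s -> p <= (3 + (141 + (592 + 660 / 1000) / 1000) / 1000) -> s <= ((540 + (186 + (912 + (621
    + 749 / 1000) / 1000) / 1000) / 1000) / 1000) -> ((841 + (545 + (66 + (817 + 249 / 1000) /
      1000) / 1000) / 1000) / 1000) <= c ->
  0 <= (2 * p * u - 4 * u ^+ 2) * c + (3 * u - p) * s.
Proof.
move=> uE k1 hp hs hc.
have -> : (2 * p * u - 4 * u ^+ 2) * c + (3 * u - p) * s =
  (2 * u * c - s) * p + (3 * u * s - 4 * u ^+ 2 * c) by ring.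
have k2 : (2 * u * c - s) * (3 + (141 + (592 + 660 / 1000) / 1000) / 1000) <= (2 * u * c - s) * p.
  by rewrite ler_wnM2l // subr_le0.
apply: (le_trans _ (lerD k2 (lexx _))).
by clear k1 k2 hp; rewrite uE; lra.
Qed.

Lemma xi2_sign_a (u : R) : u = ((285 + (329 + 600 / 1000) / 1000) / 1000) ->
  0 <= (2 * pi * u - 4 * u ^+ 2) * cos (2 * u) + (3 * u - pi) * sin (2 * u).
Proof.
move=> uE; have -> : 2 * u = ((570 + (659 + 200 / 1000) / 1000) / 1000) by rewrite uE; lra.
apply: (xi2_sign_a_aux _ _ _ _ uE); last exact: cos_xi2_a.
- have -> : 2 * u = ((570 + (659 + 200 / 1000) / 1000) / 1000) by rewrite uE; lra.
  by apply: ler_pi_sin; have := @pi_ge2 R; move: (pi : R) => p h; apply/andP; split; lra.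
- exact: pi_upper.
- exact: sin_xi2_a.
Qed.

Lemma sin_xi2_b : ((540 + (187 + (249 + (187 + 373 / 1000) / 1000) / 1000) / 1000) / 1000) <=
  sin (((570 + (659 + 600 / 1000) / 1000) / 1000) : R).
Proof. by have := sin_taylor11 (((570 + (659 + 600 / 1000) / 1000) / 1000) : R); move: (sin _)
  => t; lra. Qed.

Lemma cos_xi2_b : cos (((570 + (659 + 600 / 1000) / 1000) / 1000) : R) <= ((841 + (544 + (851 +
  (751 + 690 / 1000) / 1000) / 1000) / 1000) / 1000).
Proof. by have := cos_taylor8 (((570 + (659 + 600 / 1000) / 1000) / 1000) : R); move: (cos _) =>
  t; lra. Qed.

Lemma xi2_sign_b_aux (u p s c : R) : u = ((285 + (329 + 800 / 1000) / 1000) / 1000) -> 2 * u * c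
  <= s -> (3 + (141 + (592 + 650 / 1000) / 1000) / 1000) <= p -> ((540 + (187 + (249 + (187 +
    373 / 1000) / 1000) / 1000) / 1000) / 1000) <= s -> c <= ((841 + (544 + (851 + (751 + 690 /
      1000) / 1000) / 1000) / 1000) / 1000) ->
  (2 * p * u - 4 * u ^+ 2) * c + (3 * u - p) * s <= 0.
Proof.
move=> uE k1 hp hs hc.
have -> : (2 * p * u - 4 * u ^+ 2) * c + (3 * u - p) * s =
  (2 * u * c - s) * p + (3 * u * s - 4 * u ^+ 2 * c) by ring.
have k2 : (2 * u * c - s) * p <= (2 * u * c - s) * (3 + (141 + (592 + 650 / 1000) / 1000) / 1000).
  by rewrite ler_wnM2l // subr_le0.
apply: (le_trans (lerD k2 (lexx _)) _).
by clear k1 k2 hp; rewrite uE; lra.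
Qed.

Lemma xi2_sign_b (u : R) : u = ((285 + (329 + 800 / 1000) / 1000) / 1000) ->
  (2 * pi * u - 4 * u ^+ 2) * cos (2 * u) + (3 * u - pi) * sin (2 * u) <= 0.
Proof.
move=> uE; have -> : 2 * u = ((570 + (659 + 600 / 1000) / 1000) / 1000) by rewrite uE; lra.
apply: (xi2_sign_b_aux _ _ _ _ uE); last exact: cos_xi2_b.
- have -> : 2 * u = ((570 + (659 + 600 / 1000) / 1000) / 1000) by rewrite uE; lra.
  by apply: ler_pi_sin; have := @pi_ge2 R; move: (pi : R) => p h; apply/andP; split; lra.
- exact: pi_lower.
- exact: sin_xi2_b.
Qed.

Lemma ler_sin_le1 (a b : R) : 0 <= a -> a <= b -> b <= 1 -> sin a <= sin b.
Proof.
move=> a0 ab b1; have pi2 := @pi_ge2 R.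
by rewrite leNgt ltr_sin ?in_itv /=; [rewrite -leNgt |
  apply/andP; split; lra | apply/andP; split; lra].
Qed.

Lemma ler_sqr_ge0 (a b : R) : 0 <= a -> a <= b -> a ^+ 2 <= b ^+ 2.
Proof. by move=> a0 ab; rewrite lerXn2r ?nnegrE // (le_trans a0). Qed.

Lemma inv_bounds (a b c d x : R) : 0 < a -> a <= x <= b -> c * b <= 1 -> 1 <= d * a ->
  c <= x^-1 <= d.
Proof.
move=> a0 /andP[ax xb] cb da; have x0 : 0 < x by exact: lt_le_trans ax.
have b0 : 0 < b by exact: lt_le_trans xb.
have h1 : x^-1 <= a^-1 by rewrite lef_pV2.
have h2 : b^-1 <= x^-1 by rewrite lef_pV2.
have h3 : c <= b^-1 by rewrite -[leRHS]mul1r ler_pdivlMr.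
have h4 : a^-1 <= d by rewrite -[leLHS]mul1r ler_pdivrMr.
by rewrite (le_trans h3 h2) (le_trans h1 h4).
Qed.

Lemma ratio_bounds (s q y sl sh qa qb yl yh lo hi : R) :
  0 < sl -> 0 < qa -> 0 < yl -> 0 <= lo -> 0 <= hi ->
  sl <= s <= sh -> qa <= q <= qb -> yl <= y <= yh ->
  lo * (yh * qb) <= sl ^+ 2 -> sh ^+ 2 < hi * (yl * qa) ->
  lo <= s ^+ 2 / (y * q) < hi.
Proof.
move=> sl0 qa0 yl0 lo0 hi0 /andP[s1 s2] /andP[q1 q2] /andP[y1 y2] h1 h2.
have y0 : 0 < y by exact: lt_le_trans y1.
have q0 : 0 < q by exact: lt_le_trans q1.
have S1 : sl ^+ 2 <= s ^+ 2 by apply: ler_sqr_ge0; rewrite ?(ltW sl0).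
have S2 : s ^+ 2 <= sh ^+ 2 by apply: ler_sqr_ge0 => //; rewrite (le_trans _ s1) // ltW.
have Y1 : yl * qa <= y * q by apply: ler_pM => //; exact: ltW.
have Y2 : y * q <= yh * qb by apply: ler_pM => //; exact: ltW.
rewrite ler_pdivlMr ?ltr_pdivrMr ?mulr_gt0 //; apply/andP; split.
  by rewrite (le_trans _ S1) // (le_trans _ h1) // ler_wpM2l.
by rewrite (le_lt_trans S2) // (lt_le_trans h2) // ler_wpM2l.
Qed.

(** The Taylor bounds of degree 7 and 9 enclose the defect by polynomials in q = x^2, where each
    occurrence of q is replaced by the endpoint that its sign calls for. *)
Lemma sin_defect_bounds (x s qa qb tl th : R) : 0 < x -> 0 < qa -> qb <= 1 ->
  s <= x * (1 - x ^+ 2 / 6 * (1 - x ^+ 2 / 20 * (1 - x ^+ 2 / 42 * (1 - x ^+ 2 / 72)))) -> x *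
    (1 - x ^+ 2 / 6 * (1 - x ^+ 2 / 20 * (1 - x ^+ 2 / 42))) <= s -> qa <= x ^+ 2 <= qb ->
  tl <= (1 - qb / 20 * (1 - qa / 42 * (1 - qb / 72))) / 6 ->
  (1 - qa / 20 * (1 - qb / 42)) / 6 <= th ->
  tl <= (x - s) / x ^+ 3 <= th.
Proof.
move=> x0 qa0 qb1; have -> : x ^+ 3 = x * x ^+ 2 by rewrite exprS.
move: (x ^+ 2) => q t9 t7 /andP[q1 q2] h1 h2.
have q0 : 0 < q by exact: lt_le_trans q1.
have m1 : qa * (1 - qb / 72) <= q * (1 - q / 72) by apply: ler_pM => //; lra.
have m1' : q * (1 - q / 72) <= q by rewrite ler_piMr; lra.
have m2 : q * (1 - q / 42 * (1 - q / 72)) <= qb * (1 - qa / 42 * (1 - qb / 72)).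
  by apply: ler_pM => //; lra.
have m3 : qa * (1 - qb / 42) <= q * (1 - q / 42) by apply: ler_pM => //; lra.
rewrite ler_pdivlMr ?ler_pdivrMr ?mulr_gt0 //; apply/andP; split.
  apply: (@le_trans _ _ ((1 - q / 20 * (1 - q / 42 * (1 - q / 72))) / 6 * (x * q))).
    by apply: ler_wpM2r; [rewrite mulr_ge0 // ltW | lra].
  move: t9; set v := 1 - q / 20 * _ => t9; rewrite -subr_ge0.
  have -> : x - s - v / 6 * (x * q) = x * (1 - q / 6 * v) - s by field.
  by rewrite subr_ge0.
apply: (@le_trans _ _ ((1 - q / 20 * (1 - q / 42)) / 6 * (x * q))); last first.
  by apply: ler_wpM2r; [rewrite mulr_ge0 // ltW | lra].
move: t7; set v := 1 - q / 20 * _ => t7; rewrite -subr_ge0.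
have -> : v / 6 * (x * q) - (x - s) = s - x * (1 - q / 6 * v) by field.
by rewrite subr_ge0.
Qed.

Lemma oneBM_bounds (a b c d lo hi x y : R) : 0 < a -> 0 < c -> a <= x <= b -> c <= y <= d ->
  lo <= 1 - b * d -> 1 - a * c <= hi -> lo <= 1 - x * y <= hi.
Proof.
move=> a0 c0 /andP[x1 x2] /andP[y1 y2] h1 h2.
have m1 : a * c <= x * y by apply: ler_pM => //; exact: ltW.
have m2 : x * y <= b * d.
  by apply: ler_pM => //; [apply: le_trans x1 | apply: le_trans y1]; exact: ltW.
by apply/andP; split; lra.
Qed.

Lemma curv_bounds (T r z tl th rl rh zl zh lo hi : R) :
  0 < tl -> 0 < rl -> 0 < zl -> tl <= T <= th -> rl <= r <= rh -> zl <= z <= zh ->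
  lo <= 4 * (tl * (rl ^+ 2 + rl)) - zh ^+ 2 / 2 ->
  4 * (th * (rh ^+ 2 + rh)) - zl ^+ 2 / 2 < hi ->
  lo <= 4 * T * (r ^+ 2 + r) - z ^+ 2 / 2 < hi.
Proof.
move=> tl0 rl0 zl0 /andP[T1 T2] /andP[r1 r2] /andP[z1 z2] h1 h2.
have z0 : 0 < z by exact: lt_le_trans z1.
have r0 : 0 < r by exact: lt_le_trans r1.
have T0 : 0 < T by exact: lt_le_trans T1.
have R1 : rl ^+ 2 <= r ^+ 2 by apply: ler_sqr_ge0; rewrite ?(ltW rl0).
have R2 : r ^+ 2 <= rh ^+ 2 by apply: ler_sqr_ge0; rewrite ?(ltW r0).
have Z1 : zl ^+ 2 <= z ^+ 2 by apply: ler_sqr_ge0; rewrite ?(ltW zl0).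
have Z2 : z ^+ 2 <= zh ^+ 2 by apply: ler_sqr_ge0; rewrite ?(ltW z0).
have M1 : tl * (rl ^+ 2 + rl) <= T * (r ^+ 2 + r).
  by apply: ler_pM; rewrite ?lerD ?addr_ge0 ?sqr_ge0 ?(ltW tl0) ?(ltW rl0).
have M2 : T * (r ^+ 2 + r) <= th * (rh ^+ 2 + rh).
  by apply: ler_pM; rewrite ?lerD ?addr_ge0 ?sqr_ge0 ?(ltW T0) ?(ltW r0).
rewrite -[4 * T * _]mulrA; clear R1 R2 T1 T2 r1 r2 z1 z2.
by apply/andP; split; lra.
Qed.

(* Expresses 4 / sin^2 x - 4 / x^2 through (x - sin x) / x^3, which avoids the cancellation
   that would ruin the interval evaluation. *)
Lemma ln_lambda_curv_doubleE (u : R) : 0 < u < pi / 2 ->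
  let x := 2 * u in
  ln_lambda_curv u = 4 * ((x - sin x) / x ^+ 3) *
    ((1 - x ^+ 2 * ((x - sin x) / x ^+ 3))^-1 ^+ 2 + (1 - x ^+ 2 * ((x - sin x) / x ^+ 3))^-1)
    - (pi / 2 - u)^-1 ^+ 2 / 2.
Proof.
move=> uq x; have s0 := sin_gt0_quarter _ uq; have c0 := cos_gt0_quarter _ uq.
have /andP[u0 u1] := uq.
have x1 : x != 0 by rewrite gt_eqF // mulr_gt0.
have sE : sin x = cos u * sin u *+ 2 by rewrite /x mulr_natl sin_mulr2n.
have sx : sin x != 0 by rewrite sE gt_eqF // -mulr_natl !mulr_gt0.
have -> : 1 - x ^+ 2 * ((x - sin x) / x ^+ 3) = sin x / x by field.
have -> : ln_lambda_curv u = 4 / (sin x) ^+ 2 - 4 / x ^+ 2 - (pi / 2 - u)^-1 ^+ 2 / 2.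
  have -> : 4 / sin x ^+ 2 = sin u ^- 2 + cos u ^- 2.
    have -> : sin u ^- 2 + cos u ^- 2 = (cos u ^+ 2 + sin u ^+ 2) * (sin u ^- 2 * cos u ^- 2).
      by field; rewrite !gt_eqF.
    by rewrite cos2Dsin2 sE; field; rewrite !gt_eqF.
  have y0 : pi / 2 - u != 0 by rewrite subr_eq0 gt_eqF.
  rewrite /ln_lambda_curv /x; move: y0; move: (pi / 2 - u) => y y0.
  by field; rewrite y0 !gt_eqF.
move: (pi / 2 - u)^-1 => z; move: sx; move: (sin x) => s sx.
by field; rewrite sx x1.
Qed.

Lemma lambda_fun_doubleE (u : R) : 0 < u < pi / 2 ->
  lambda_fun u = sin (2 * u) ^+ 2 / ((pi / 2 - u) * (2 * u) ^+ 2).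
Proof.
move=> /andP[h1 h2]; rewrite lambda_funE mulr_natl sin_mulr2n.
have y0 : pi / 2 - u != 0 by rewrite subr_eq0 gt_eqF.
move: y0; move: (pi / 2 - u) => y y0; field.
by rewrite y0 gt_eqF.
Qed.

(** The endpoints are 0.2853296 and 0.2853298. The narrow width serves Lambda_2, which lies only
    about 0.0000012 above 1.12229. *)
Definition xi2_range u := ((285 + (329 + 600 / 1000) / 1000) / 1000) <= u <= ((285 + (329 + 800
  / 1000) / 1000) / 1000).

Lemma xi2_exists : exists2 u, xi2_range u & xi2_equation u.
Proof.
pose f u : R := (2 * pi * u - 4 * u ^+ 2) * cos (2 * u) + (3 * u - pi) * sin (2 * u).
have lh : ((285 + (329 + 600 / 1000) / 1000) / 1000) <= ((285 + (329 + 800 / 1000) / 1000) /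
  1000) :> R by lra.
have cf : continuous f.
  move=> u; apply: differentiable_continuous; apply/derivable1_diffP.
  exact: ex_derive.
have fa : 0 <= f ((285 + (329 + 600 / 1000) / 1000) / 1000) by exact: xi2_sign_a.
have fb : f ((285 + (329 + 800 / 1000) / 1000) / 1000) <= 0 by exact: xi2_sign_b.
have [||c] := @IVT R f _ _ 0 lh.
- exact: continuous_subspaceT.
- by rewrite ge_min le_max fa fb orbT.
by rewrite in_itv /= => cI fc; exists c.
Qed.

Lemma xi2_quarter u : xi2_range u -> 0 < u < pi / 2.
Proof.
rewrite /xi2_range => /andP[h1 h2]; have := @pi_ge2 R; move: (pi : R) => p h3.
by apply/andP; split; lra.
Qed.

Lemma xi2_sin u : xi2_range u -> ((540 + (186 + 912 / 1000) / 1000) / 1000) <= sin (2 * u) <=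
  ((540 + (187 + 250 / 1000) / 1000) / 1000).
Proof.
rewrite /xi2_range => /andP[h1 h2]; apply/andP; split.
  apply: (@le_trans _ _ (sin ((570 + (659 + 200 / 1000) / 1000) / 1000))).
    by clear; have := sin_taylor11 (((570 + (659 + 200 / 1000) / 1000) / 1000) : R); move: (sin
      _) => t; lra.
  by apply: ler_sin_le1; lra.
apply: (@le_trans _ _ (sin ((570 + (659 + 600 / 1000) / 1000) / 1000))); first by apply:
  ler_sin_le1; lra.
by clear; have := sin_taylor9 (((570 + (659 + 600 / 1000) / 1000) / 1000) : R); move: (sin _) =>
  t; lra.
Qed.

Lemma xi2_sqr u : xi2_range u -> ((325 + (651 + (922 + 544 / 1000) / 1000) / 1000) / 1000) <= (2
  * u) ^+ 2 <= ((325 + (652 + (379 + 73 / 1000) / 1000) / 1000) / 1000).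
Proof.
rewrite /xi2_range => /andP[h1 h2]; apply/andP; split.
  apply: (@le_trans _ _ (((570 + (659 + 200 / 1000) / 1000) / 1000) ^+ 2)); first by clear; lra.
  by apply: ler_sqr_ge0; lra.
apply: (@le_trans _ _ (((570 + (659 + 600 / 1000) / 1000) / 1000) ^+ 2)); first by apply:
  ler_sqr_ge0; lra.
by clear; lra.
Qed.

Lemma xi2_pihalf_sub u : xi2_range u -> (1 + (285 + (466 + 525 / 1000) / 1000) / 1000) <= pi / 2
  - u <= (1 + (285 + (466 + 730 / 1000) / 1000) / 1000).
Proof.
rewrite /xi2_range => /andP[h1 h2].
have := pi_lower; have := pi_upper; move: (pi : R) => P h3 h4.
by apply/andP; split; [clear h1 h3; lra | clear h2 h4; lra].
Qed.

Lemma lambda2_prefix u : xi2_range u -> decimal_prefix 0 [:: 6; 9; 7; 0; 6]%N (lambda_fun u).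
Proof.
move=> hu; rewrite /decimal_prefix /= lambda_fun_doubleE; last exact: xi2_quarter.
apply: (ratio_bounds _ _ _ _ _ _ _ _ _ _ _ _ _ _ _ _ (xi2_sin _ hu) (xi2_sqr _ hu)
  (xi2_pihalf_sub _ hu));
  clear; lra.
Qed.

(** The value is 1.122291..., with decimals 1, 2, 2, 2, 9; the figure 1.2229 of the English
    statement lacks the first of them. *)
Lemma Lambda2_prefix u : xi2_range u -> decimal_prefix 1 [:: 1; 2; 2; 2; 9]%N (Lambda_fun u).
Proof.
move=> hu; have uq := xi2_quarter _ hu.
rewrite /decimal_prefix /= Lambda_funE // (ln_lambda_curv_doubleE _ uq) /=.
have x0 : 0 < 2 * u by case/andP: uq => u0 _; rewrite mulr_gt0.
have HT : ((163 + (973 + 843 / 1000) / 1000) / 1000) <= (2 * u - sin (2 * u)) / (2 * u) ^+ 3 <=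
  ((163 + (973 + 943 / 1000) / 1000) / 1000).
  apply: (sin_defect_bounds _ _ _ _ _ _ x0 _ _ (sin_taylor9 _ (ltW x0))
    (sin_taylor7 _ (ltW x0)) (xi2_sqr _ hu)); clear; lra.
move: HT (xi2_sqr _ hu) (xi2_pihalf_sub _ hu).
move: ((2 * u - sin (2 * u)) / (2 * u) ^+ 3) ((2 * u) ^+ 2) (pi / 2 - u) => T q y.
clear => HT Hq Hy.
have Hs : ((946 + (601 + 495 / 1000) / 1000) / 1000) <= 1 - q * T <= ((946 + (601 + 603 / 1000)
  / 1000) / 1000).
  by apply: (oneBM_bounds _ _ _ _ _ _ _ _ _ _ Hq HT); clear; lra.
have Hr : (1 + (56 + (410 + 634 / 1000) / 1000) / 1000) <= (1 - q * T)^-1 <= (1 + (56 + (410 +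
  755 / 1000) / 1000) / 1000) by apply: (inv_bounds _ _ _ _ _ _ Hs); clear; lra.
have Hz : ((777 + (927 + 562 / 1000) / 1000) / 1000) <= y^-1 <= ((777 + (927 + 687 / 1000) /
  1000) / 1000) by apply: (inv_bounds _ _ _ _ _ _ Hy); clear; lra.
by apply: (curv_bounds _ _ _ _ _ _ _ _ _ _ _ _ _ _ HT Hr Hz); clear; lra.
Qed.

Lemma xi2_prefix u : xi2_range u -> decimal_prefix 0 [:: 2; 8; 5; 3]%N u.
Proof.
rewrite /decimal_prefix /= /xi2_range => /andP[h1 h2].
by apply/andP; split; [clear h2; lra | clear h1; lra].
Qed.

End Numerics.

(** * Laplace method *)

Section LocalExpansion.
Context {R : realType}.
Implicit Types (f df : R -> R) (a b x u v xi : R).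

Lemma mean_value_sym f df a b :
  (forall x, `|x - a| <= `|b - a| -> is_derive x 1 f (df x)) ->
  exists2 c, `|c - a| <= `|b - a| & f b - f a = df c * (b - a).
Proof.
move=> fd; have [ab|ba] := leP a b.
  have [x /andP[h1 h2]|c /andP[h1 h2] E] := mean_value f df a b ab.
    by apply: fd; rewrite !ger0_norm ?subr_ge0 ?lerD2r.
  by exists c => //; rewrite !ger0_norm ?subr_ge0 ?lerD2r.
have [x /andP[h1 h2]|c /andP[h1 h2] E] := mean_value f df b a (ltW ba).
  by apply: fd; rewrite !ler0_norm ?subr_le0 ?lerN2 ?lerD2r // ltW.
exists c; first by rewrite !ler0_norm ?subr_le0 ?lerN2 ?lerD2r // ltW.
by rewrite -opprB E -mulrN opprB.
Qed.

(** The constant is |f'(a)| + 1. Applied to the curvature, this spares a bound on the third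
    derivative of ln lambda around xi_2. *)
Lemma derivable_lipschitz_at f a : derivable f a 1 ->
  exists C, exists2 d, 0 < d & 0 <= C /\
  forall x, `|x - a| < d -> `|f x - f a| <= C * `|x - a|.
Proof.
move=> /cvg_ex[/= l Hl].
have /= [d /= d0 Hd] := (cvgrPdist_lt _ _).1 Hl 1 ltr01.
exists (`|l| + 1), d => //; split=> [|x xa]; first by rewrite addr_ge0.
have [->|xna] := eqVneq x a; first by rewrite !subrr normr0 mulr0.
have h0 : x - a != 0 by rewrite subr_eq0.
have := Hd (x - a); rewrite /ball_ /= sub0r normrN => /(_ xa h0).
rewrite /GRing.scale /= mulr1 subrK => h.
have -> : f x - f a = (x - a)^-1 * (f x - f a) * (x - a) by field.
rewrite normrM ler_wpM2r //.
set q := _ * (f x - f a) in h *.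
have -> : q = l - (l - q) by rewrite opprB addrC subrK.
by rewrite (le_trans (ler_normB _ _)) // lerD2l ltW.
Qed.

(** The gap [F] vanishes at xi. Since (ln lambda)' vanishes there and decreases at rate at least 1,
    [F] has nonnegative derivative to the right of xi and nonpositive derivative to the left. *)
Lemma ln_lambda_concave xi v : 0 < xi < pi / 2 -> ln_lambda_deriv xi = 0 ->
  0 < v < pi / 2 ->
  ln (lambda_fun v) - ln (lambda_fun xi) <= - ((v - xi) ^+ 2 / 2).
Proof.
move=> hxi D0 hv; have /andP[xi0 xi1] := hxi; have /andP[v0 v1] := hv.
pose F u := ln (lambda_fun xi) - ln (lambda_fun u) - (u - xi) ^+ 2 / 2.
have dF u : 0 < u < pi / 2 -> is_derive u 1 F (- ln_lambda_deriv u - (u - xi)).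
  move=> hu; have D := is_derive_ln_lambda _ hu.
  have Q : is_derive u 1 (fun u : R => (u - xi) ^+ 2 / 2) (u - xi).
    by apply: is_derive_eq; rewrite /GRing.scale /=; field.
  have E := is_deriveB (is_deriveB (is_derive_cst (ln (lambda_fun xi)) u 1) D) Q.
  by apply: (is_derive_eq E); rewrite sub0r.
suff : 0 <= F v by rewrite /F; lra.
have F0 : F xi = 0 by rewrite /F !subrr expr0n mul0r subr0.
rewrite -F0; have [xv|vx] := leP xi v.
  apply: (deriv_ge0_le F (fun u => - ln_lambda_deriv u - (u - xi)) xi v xv).
    by move=> u /andP[h1 h2]; apply: dF; apply/andP; split; lra.
  move=> u /andP[h1 h2]; have hu : 0 < u < pi / 2 by apply/andP; split; lra.
  by have := ln_lambda_deriv_decr _ _ hxi hu h1; rewrite D0; lra.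
rewrite -lerN2.
apply: (deriv_ge0_le (fun u => - F u) (fun u => - (- ln_lambda_deriv u - (u - xi))) v xi (ltW vx)).
  by move=> u /andP[h1 h2]; apply: is_deriveN; apply: dF; apply/andP; split; lra.
move=> u /andP[h1 h2]; have hu : 0 < u < pi / 2 by apply/andP; split; lra.
by have := ln_lambda_deriv_decr _ _ hu hxi h2; rewrite D0; lra.
Qed.

Lemma derivable_ln_lambda_curv u : 0 < u < pi / 2 -> derivable ln_lambda_curv u 1.
Proof.
move=> h; have s0 := sin_gt0_quarter _ h; have c0 := cos_gt0_quarter _ h.
have /andP[u0 u1] := h; have y0 : 0 < pi / 2 - u by rewrite subr_gt0.
have s1 : sin u != 0 by rewrite gt_eqF.
have c1 : cos u != 0 by rewrite gt_eqF.
have y1 : pi / 2 - u != 0 by rewrite gt_eqF.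
have u2 : u != 0 by rewrite gt_eqF.
have I1 := is_deriveX 2 (is_deriveV s1 (is_derive_sin u)).
have I2 := is_deriveX 2 (is_deriveV c1 (is_derive_cos u)).
have I3 := is_deriveX 2 (@is_deriveV _ (fun v => pi / 2 - v) u _ _ y1 (is_derive_csubr _ u)).
have I4 := is_deriveX 2 (is_deriveV u2 (is_derive_id u 1)).
have [D _] := is_deriveB (is_deriveB (is_deriveD I1 I2) (is_deriveZ 2^-1 I3)) I4.
suff -> : ln_lambda_curv = (fun y : R => (sin y)^-1) ^+ 2 + (fun y => (cos y)^-1) ^+ 2 -
   2^-1 \*: (fun y => (pi / 2 - y)^-1) ^+ 2 - (fun y => y^-1) ^+ 2 by [].
by apply/funext => y; rewrite /ln_lambda_curv !fctE /= -!exprVn /GRing.scale /= [_ / 2]mulrC.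
Qed.

(** Two mean value arguments: the curvature deviates linearly from its value at xi, hence (ln
    lambda)' quadratically from its linear part and ln lambda cubically from its parabola. *)
Lemma ln_lambda_cubic xi : 0 < xi < pi / 2 -> ln_lambda_deriv xi = 0 ->
  exists C, exists2 d, 0 < d & 0 <= C /\
  forall v, `|v - xi| < d -> 0 < v < pi / 2 /\
    `|ln (lambda_fun v) - ln (lambda_fun xi) + ln_lambda_curv xi * (v - xi) ^+ 2| <=
    C * `|v - xi| ^+ 3.
Proof.
move=> hxi D0; have /andP[xi0 xi1] := hxi.
have [C [d d0 [C0 HC]]] := derivable_lipschitz_at _ _ (derivable_ln_lambda_curv _ hxi).
pose d' := Num.min d (Num.min xi (pi / 2 - xi)).
have in_range v : `|v - xi| < d' -> 0 < v < pi / 2.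
  rewrite !lt_min => /and3P[_]; rewrite !ltr_norml => /andP[h1 h2] /andP[h3 h4].
  by apply/andP; split; lra.
have in_d v : `|v - xi| < d' -> `|v - xi| < d by rewrite lt_min => /andP[].
exists (2 * C), d'; first by rewrite !lt_min d0 xi0 subr_gt0.
split=> [|v hv]; first by rewrite mulr_ge0.
split; first exact: in_range.
set L := ln_lambda_curv xi.
have deriv_bound u : `|u - xi| < d' -> `|ln_lambda_deriv u + 2 * L * (u - xi)| <= 2 * C * `|u -
  xi| ^+ 2.
  move=> hu; have [y hy|c hc E] := mean_value_sym ln_lambda_deriv (fun y => - (2 *
    ln_lambda_curv y)) xi u.
    by apply: is_derive_ln_lambda_deriv; apply: in_range; exact: le_lt_trans hu.
  have -> : ln_lambda_deriv u + 2 * L * (u - xi) = - (2 * (ln_lambda_curv c - L) * (u - xi)).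
    by move: E; rewrite D0 subr0 => ->; ring.
  rewrite normrN !normrM (ger0_norm (ler0n _ 2)) -!mulrA ler_wpM2l // expr2 mulrA ler_wpM2r //.
  rewrite (le_trans (HC _ _)) ?in_d ?(le_lt_trans hc) //.
  by rewrite ler_wpM2l.
pose F y := ln (lambda_fun y) + L * (y - xi) ^+ 2.
have [y hy|c hc E] := mean_value_sym F (fun y => ln_lambda_deriv y + 2 * L * (y - xi)) xi v.
  have hyr : 0 < y < pi / 2 by apply: in_range; exact: le_lt_trans hv.
  have Q : is_derive y 1 (fun y : R => L * (y - xi) ^+ 2) (2 * L * (y - xi)).
    by apply: is_derive_eq; rewrite /GRing.scale /=; ring.
  exact: (is_deriveD (is_derive_ln_lambda _ hyr) Q).
have -> : ln (lambda_fun v) - ln (lambda_fun xi) + L * (v - xi) ^+ 2 = F v - F xi.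
  by rewrite /F subrr expr0n mulr0 addr0; ring.
rewrite E normrM exprSr mulrA ler_wpM2r // (le_trans (deriv_bound _ _)) ?(le_lt_trans hc) //.
by rewrite ler_wpM2l ?mulr_ge0 // lerXn2r ?nnegrE.
Qed.

(* [(2 * pi - 4 * u) ^- (k * p)] for real [p], in a form with a visible derivative *)
Definition freq_weight (k : nat) (p u : R) : R := expR (- (k%:R * p) * ln (2 * pi - 4 * u)).

Lemma freq_weightE k p u : 0 < u < pi / 2 ->
  freq_weight k p u = ((2 * pi - 4 * u) ^- k) `^ p.
Proof.
move=> /andP[u0 u1]; have y0 : 0 < 2 * pi - 4 * u by lra.
rewrite /powR gt_eqF ?invr_gt0 ?exprn_gt0 // lnV ?posrE ?exprn_gt0 // lnXn //.
by rewrite /freq_weight; congr expR; rewrite -mulr_natl; ring.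
Qed.

Lemma derivable_freq_weight k p u : 0 < u < pi / 2 -> derivable (freq_weight k p) u 1.
Proof.
move=> /andP[u0 u1]; have y0 : 0 < 2 * pi - 4 * u by lra.
have D1 : is_derive u 1 (fun u : R => 2 * pi - 4 * u) (- 4).
  by apply: is_derive_eq; rewrite /GRing.scale /=; ring.
have D2 := @is_derive1_comp _ (@ln R) (fun u : R => 2 * pi - 4 * u) u _ _ (is_derive1_ln y0) D1.
have D3 := is_deriveZ (- (k%:R * p)) D2.
by have [] := @is_derive1_comp _ (@expR R) _ u _ _ (is_derive_expR _) D3.
Qed.

End LocalExpansion.

(** * Two-sided bounds for the envelope *)

Section Envelope.
Context {R : realType}.
Local Open Scope complex_scope.
Import ComplexField.Normc.
Implicit Types (t u v w : R) (p : {poly R}).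

Lemma horner_expi p t : (map_poly (real_complex R) p).[expi t] =
  (\sum_(i < size p) p`_i * cos (i%:R * t)) +i* (\sum_(i < size p) p`_i * sin (i%:R * t)).
Proof.
rewrite (@horner_coef_wide _ (size p)); last exact: size_poly.
have sumC n (a b : 'I_n -> R) :
    \sum_(s < n) (a s +i* b s) = (\sum_(s < n) a s) +i* (\sum_(s < n) b s).
  elim: n a b => [|n IH] a b; first by rewrite !big_ord0.
  by rewrite !big_ord_recr /= IH; simpc.
rewrite -sumC; apply: eq_bigr => i _.
by rewrite coef_map /= expiX /expi /real_complex_def; simpc.
Qed.

Lemma normc_centered_symbol m v : normc (centered_symbol m v) =
  normc (csymbol_poly (2 * m)).[expi (- (2 * v))].
Proof. by rewrite /centered_symbol normcM normc_expi mul1r. Qed.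

Lemma normc_centered_symbolN m v :
  normc (centered_symbol m (- v)) = normc (centered_symbol m v).
Proof.
rewrite !normc_centered_symbol /csymbol_poly mulrN !horner_expi /=; congr Num.sqrt; congr (_ + _).
  by congr (_ ^+ 2); apply: eq_bigr => i _; rewrite (mulrN _ (- (2 * v))) cosN.
rewrite -[RHS]sqrrN -sumrN; congr (_ ^+ 2); apply: eq_bigr => i _.
by rewrite (mulrN _ (- (2 * v))) sinN mulrN.
Qed.

Lemma normc_centered_symbolDpi m v :
  normc (centered_symbol m (v + pi)) = normc (centered_symbol m v).
Proof.
rewrite !normc_centered_symbol; congr (normc _.[_]).
have -> : - (2 * (v + pi)) = - (2 * v) + - (1%:R * (2 * pi)) by ring.
have e1 : expi (- (1%:R * (2 * pi))) = 1 :> R[i].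
  rewrite -[LHS]mul1r -{1}(@expi_pi_nat R 1) -expiD subrr.
  exact: expi0.
by rewrite expiD e1 mulr1.
Qed.

Lemma normc_centered_symbolDpin m v n :
  normc (centered_symbol m (v + n%:R * pi)) = normc (centered_symbol m v).
Proof.
elim: n => [|n IH]; first by rewrite mul0r addr0.
by rewrite -natr1 mulrDl mul1r addrA normc_centered_symbolDpi.
Qed.

Lemma sinc_peaks1E M v : sinc_peaks M 1 v =
  (sin v / v) ^+ M + (sin v / (pi - v)) ^+ M.
Proof. by rewrite /sinc_peaks big_ord_recl big_ord0 /= mulr0 !addr0. Qed.

Lemma inv_pow4_le m : (1 < m)%N -> 4 / 2 ^+ (2 * m) <= 4^-1 :> R.
Proof.
move=> m1; rewrite exprM; have -> : 2 ^+ 2 = 4 :> R by ring.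
rewrite ler_pdivrMr ?exprn_gt0 // ler_pdivlMl //.
have -> : 4 * 4 = 4 ^+ 2 :> R by ring.
by apply: ler_weXn2l => //; rewrite ler1n.
Qed.

(** The modulus is pi-periodic, so v may be taken in [0, pi). There both leading terms are at most 1
    because sin z <= z, which gives 2 (1 + 1/4) <= 4; the endpoint 0 gives 1. *)
Lemma normc_centered_symbol_le m v : (1 < m)%N -> 0 <= v ->
  normc (centered_symbol m v) <= 4.
Proof.
move=> m1 v0; have pi0 := @pi_gt0 R.
set n := Num.truncn (v / pi).
have /andP[n1 n2] : n%:R <= v / pi < n.+1%:R by rewrite truncn_itv // divr_ge0 // ltW.
move: n1 n2; rewrite ler_pdivlMr // ltr_pdivrMr // -natr1 mulrDl mul1r => n1 n2.
have -> : v = (v - n%:R * pi) + n%:R * pi by rewrite subrK.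
rewrite normc_centered_symbolDpin; set r := v - _.
have r0 : 0 <= r by rewrite subr_ge0.
have rpi : r < pi by rewrite /r; lra.
have [r00|rn0] := eqVneq r 0.
  rewrite r00 normc_centered_symbol mulr0 oppr0 expi0 csymbol_poly1; last by lia.
  by rewrite normc1; lra.
have r1 : 0 < r by rewrite lt_neqAle eq_sym rn0.
have rI : 0 < r < pi by rewrite r1.
have /andP[_ H] := centered_symbol_bounds m r m1 rI.
apply: (le_trans H); rewrite sinc_peaks1E.
have s0 := sin_gt0_pi rI.
have le1 (z : R) : 0 < z -> sin z = sin r -> (sin r / z) ^+ (2 * m) <= 1.
  move=> z0 E; rewrite exprn_ile1 ?divr_ge0 ?(ltW s0) ?(ltW z0) //.
  by rewrite ler_pdivrMr // mul1r -E sin_le_id // ltW.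
have h1 := le1 r r1 erefl.
have h2 : (sin r / (pi - r)) ^+ (2 * m) <= 1.
  apply: le1; first by rewrite subr_gt0.
  by rewrite addrC sinDpi sinN opprK.
have h3 := inv_pow4_le m m1.
have p1 : 0 <= (sin r / r) ^+ (2 * m) by rewrite exprn_ge0 ?divr_ge0 ?ltW.
have p2 : 0 <= (sin r / (pi - r)) ^+ (2 * m).
  by rewrite exprn_ge0 ?divr_ge0 ?(ltW s0) // subr_ge0 ltW.
have p3 : 0 <= 4 / 2 ^+ (2 * m) :> R by rewrite divr_ge0 ?exprn_ge0.
move: h1 h2 h3 p1 p2 p3; move: (_ ^+ _) (_ ^+ _) (4 / _) => a b c; nra.
Qed.

Lemma wavelet_envelopeN m w : wavelet_envelope m (- w) = wavelet_envelope m w.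
Proof.
rewrite /wavelet_envelope normrN mulNr sinN sqrrN; congr (_ * _).
have -> : - (w / 4) + pi / 2 = - (w / 4 + - (pi / 2)) by ring.
rewrite normc_centered_symbolN -normc_centered_symbolDpi.
by congr (normc (centered_symbol _ _)); lra.
Qed.

Lemma wavelet_envelope_ge0 m w : 0 <= wavelet_envelope m w.
Proof.
by rewrite mulr_ge0 ?normc_ge0 // exprn_ge0 // divr_ge0 // mulr_ge0 // sqr_ge0.
Qed.

Lemma wavelet_envelope_outer m w : (1 < m)%N -> 0 < w ->
  wavelet_envelope m w <= 4 * (4 / w) ^+ m.
Proof.
move=> m1 w0; rewrite /wavelet_envelope mulrC; have pi0 := @pi_gt0 R.
have A0 : 0 <= 4 * sin (w / 4) ^+ 2 / `|w| by rewrite divr_ge0 // mulr_ge0 // sqr_ge0.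
apply: ler_pM; [exact: normc_ge0 | exact: exprn_ge0 | |].
  by apply: normc_centered_symbol_le => //; lra.
rewrite (gtr0_norm w0) in A0 *.
rewrite lerXn2r ?nnegrE //; first by rewrite divr_ge0 // ltW.
by rewrite ler_wpM2r ?invr_ge0 ?(ltW w0) // ler_piMr // sin2cos2 gerBl sqr_ge0.
Qed.

(** At w = 2 pi - 4 v the symbol is taken at pi - v. Its larger leading term (sin v / v)^(2m)
    combines with (cos^2 v / (pi/2 - v))^m into lambda(v)^m; the other one is smaller by the factor
    (v / (pi - v))^(2m). *)
Lemma wavelet_envelope_inner m v : (1 < m)%N -> 0 < v < pi / 2 ->
  lambda_fun v ^+ m <= wavelet_envelope m (2 * pi - 4 * v) <=
  lambda_fun v ^+ m * ((1 + (v / (pi - v)) ^+ (2 * m)) * (1 + 4 / 2 ^+ (2 * m))).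
Proof.
move=> m1 hv; have /andP[v0 v1] := hv; have pi0 := @pi_gt0 R.
have s0 := sin_gt0_quarter _ hv.
have w0 : 0 < 2 * pi - 4 * v by lra.
rewrite /wavelet_envelope (gtr0_norm w0).
have -> : (2 * pi - 4 * v) / 4 = pi / 2 - v by lra.
have -> : sin (pi / 2 - v) = cos v by rewrite addrC sinDpihalf cosN.
have -> : pi / 2 - v + pi / 2 = pi - v by lra.
have y0 : 0 < pi / 2 - v by lra.
have -> : 4 * cos v ^+ 2 / (2 * pi - 4 * v) = cos v ^+ 2 / (pi / 2 - v).
  have -> : 2 * pi - 4 * v = 4 * (pi / 2 - v) by lra.
  by move: y0; move: (pi / 2 - v) => y y0; field; rewrite gt_eqF.
have pv : 0 < pi - v < pi by lra.
have /andP[B1 B2] := centered_symbol_bounds m (pi - v) m1 pv.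
have pv0 : 0 < pi - v by lra.
have E : sinc_peaks (2 * m) 1 (pi - v) =
   (sin v / v) ^+ (2 * m) * (1 + (v / (pi - v)) ^+ (2 * m)).
  have -> : sinc_peaks (2 * m) 1 (pi - v) =
     (sin v / (pi - v)) ^+ (2 * m) + (sin v / v) ^+ (2 * m).
    rewrite sinc_peaks1E.
    have -> : pi - (pi - v) = v by ring.
    by rewrite [pi - v]addrC sinDpi sinN opprK.
  rewrite mulrDr mulr1 -exprMn addrC; congr (_ + _ ^+ _).
  by move: pv0; move: (pi - v) => y pv0; field; rewrite !gt_eqF.
have lamE : lambda_fun v ^+ m = (cos v ^+ 2 / (pi / 2 - v)) ^+ m * (sin v / v) ^+ (2 * m).
  rewrite lambda_funE [_ ^+ (2 * m)]exprM -exprMn; congr (_ ^+ _).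
  by move: y0; move: (pi / 2 - v) => y y0; field; rewrite !gt_eqF.
have A0 : 0 <= (cos v ^+ 2 / (pi / 2 - v)) ^+ m.
  by rewrite exprn_ge0 // divr_ge0 ?sqr_ge0 // ltW.
rewrite lamE; move: A0; move: ((cos v ^+ 2 / (pi / 2 - v)) ^+ m) => A A0.
rewrite -[A * _ * (_ * _)]mulrA; apply/andP; split; apply: ler_wpM2l => //.
  apply: le_trans B1; rewrite E ler_peMr //; first by rewrite exprn_ge0 // divr_ge0 // ltW.
  by rewrite lerDl exprn_ge0 // divr_ge0 // ltW.
by apply: (le_trans B2); rewrite E [leRHS]mulrA mulrC.
Qed.

(** Needed for v near pi / 2, that is w near 0: each factor lambda(v) offsets one factor 1 / |w|. *)
Lemma lambda_fun_le v : 0 < v < pi / 2 -> lambda_fun v <= 2 * pi - 4 * v.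
Proof.
move=> hv; have /andP[v0 v1] := hv; have c0 := cos_gt0_quarter _ hv.
have s0 := sin_gt0_quarter _ hv; have y0 : 0 < pi / 2 - v by rewrite subr_gt0.
have h1 := ler_cos_sub _ hv; have h2 := sin_le_id v (ltW v0).
rewrite lambda_funE exprMn -mulf_div.
have a1 : cos v ^+ 2 / (pi / 2 - v) <= pi / 2 - v.
  by rewrite ler_pdivrMr // expr2 ler_pM // ltW.
have a2 : sin v ^+ 2 / v ^+ 2 <= 1.
  by rewrite ler_pdivrMr ?exprn_gt0 // mul1r lerXn2r ?nnegrE ?(ltW s0) ?(ltW v0).
have b1 : 0 <= cos v ^+ 2 / (pi / 2 - v) by rewrite divr_ge0 ?sqr_ge0 // ltW.
have b2 : 0 <= sin v ^+ 2 / v ^+ 2 by rewrite divr_ge0 ?sqr_ge0.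
apply: (@le_trans _ _ (cos v ^+ 2 / (pi / 2 - v))); first by rewrite ler_piMr.
by lra.
Qed.

End Envelope.

(** * Elementary Gaussian estimates *)

Section AnalyticEstimates.
Context {R : realType}.
Implicit Types (a b c x y h p s t tau M : R).

Lemma norm_expRB a b c : a <= c -> b <= c -> `|expR a - expR b| <= `|a - b| * expR c.
Proof.
have key x y : x <= y -> `|expR x - expR y| <= `|x - y| * expR y.
  move=> xy; rewrite !ler0_norm ?subr_le0 ?ler_expR // !opprB.
  have -> : x = y + (x - y) by ring.
  rewrite expRD; have := expR_ge1Dx (x - y); have := expR_ge0 y; nra.
move=> ac bc; have [ab|/ltW ba] := leP a b.
  by rewrite (le_trans (key _ _ ab)) // ler_wpM2l // ler_expR.
rewrite distrC [`|a - b|]distrC.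
by rewrite (le_trans (key _ _ ba)) // ler_wpM2l // ler_expR.
Qed.

Lemma powR_oneD_sub1 p tau : 0 <= p -> 0 <= tau <= 3 ->
  0 <= (1 + tau) `^ p - 1 <= p * expR (3 * p) * tau.
Proof.
move=> p0 /andP[t0 t3]; have t1 : 0 < 1 + tau by rewrite ltr_pwDl.
rewrite subr_ge0; apply/andP; split.
  have t2 : 1 <= 1 + tau by rewrite lerDl.
  by have := ler_powR t2 p0; rewrite powRr0.
have h1 : (1 + tau) `^ p <= expR (p * tau).
  rewrite /powR gt_eqF // ler_expR ler_wpM2l // le_ln1Dx //; lra.
have h2 : expR (p * tau) - 1 <= p * tau * expR (p * tau).
  have := expR_ge1Dx (- (p * tau)); rewrite expRN => h.
  have e0 := expR_gt0 (p * tau).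
  have : (1 + - (p * tau)) * expR (p * tau) <= 1.
    by rewrite -ler_pdivlMr // mul1r.
  by lra.
have h3 : expR (p * tau) <= expR (3 * p) by rewrite ler_expR mulrC ler_wpM2r.
have h4 : p * tau * expR (p * tau) <= p * tau * expR (3 * p).
  by rewrite ler_wpM2l // mulr_ge0.
by rewrite [leRHS]mulrAC; lra.
Qed.

Lemma mul_expRN_le1 t : t * expR (- t) <= 1.
Proof.
rewrite expRN ler_pdivrMr ?expR_gt0 // mul1r.
by have := expR_ge1Dx t; lra.
Qed.

(** In use M is m and h is m^(-1/2). With z = |x| / h, the bound exp(-t) <= 1 / (1 + t) reduces the
    claim to z <= 2 + z^2 / 4, a consequence of (z - 2)^2 >= 0. *)
Lemma norm_gauss_le h M s x : 0 < h -> M * h ^+ 2 = 1 -> M <= s ->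
  `|x| * expR (- (s * x ^+ 2 / 8)) <= 2 * h.
Proof.
move=> h0 Mh Ms.
have M0 : 0 < M by rewrite -(pmulr_lgt0 _ (exprn_gt0 2 h0)) Mh.
have e1 : expR (- (s * x ^+ 2 / 8)) <= (1 + M * x ^+ 2 / 8)^-1.
  rewrite expRN lef_pV2 ?posrE ?expR_gt0 //; last first.
    by rewrite ltr_pwDl // divr_ge0 // mulr_ge0 ?sqr_ge0 // ltW.
  apply: le_trans (expR_ge1Dx _); rewrite lerD2l ler_wpM2r // ler_wpM2r //.
  exact: sqr_ge0.
rewrite (le_trans (ler_wpM2l (normr_ge0 x) e1)) //.
rewrite ler_pdivrMr; last by rewrite ltr_pwDl // divr_ge0 // mulr_ge0 ?sqr_ge0 // ltW.
rewrite -[x ^+ 2]real_normK ?num_real //; move: `|x| => y.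
have -> : y = h * (y / h) by field; rewrite gt_eqF.
set z := y / h; have -> : M * (h * z) ^+ 2 = z ^+ 2.
  by rewrite exprMn mulrA Mh mul1r.
rewrite -[leRHS]mulrA [leRHS]mulrCA ler_pM2l //.
by have := sqr_ge0 (z - 2); lra.
Qed.

(** One factor absorbs polynomial terms in x, the other stays as the integrable majorant. *)
Lemma gauss_split s x : expR (- (s * x ^+ 2 / 2)) =
  expR (- (s * x ^+ 2 / 4)) * expR (- (s * x ^+ 2 / 4)).
Proof. by rewrite -expRD; congr expR; field. Qed.

Lemma gauss_split8 s x : expR (- (s * x ^+ 2 / 4)) =
  expR (- (s * x ^+ 2 / 8)) * expR (- (s * x ^+ 2 / 8)).
Proof. by rewrite -expRD; congr expR; field. Qed.

Lemma gauss_le1 s x c : 0 <= s -> 0 < c -> expR (- (s * x ^+ 2 / c)) <= 1.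
Proof.
move=> s0 c0; rewrite expR_le1 oppr_le0; apply: divr_ge0; last exact: ltW.
by apply: mulr_ge0 => //; exact: sqr_ge0.
Qed.

Lemma norm_gauss4_le h M s x : 0 < h -> M * h ^+ 2 = 1 -> M <= s ->
  `|x| * expR (- (s * x ^+ 2 / 4)) <= 2 * h.
Proof.
move=> h0 Mh Ms; have M0 : 0 < M by rewrite -(pmulr_lgt0 _ (exprn_gt0 2 h0)) Mh.
have s0 : 0 <= s by rewrite (le_trans (ltW M0)).
rewrite gauss_split8 mulrA; have := norm_gauss_le _ _ _ x h0 Mh Ms.
by apply: le_trans; rewrite ler_piMr ?gauss_le1 // mulr_ge0 // expR_ge0.
Qed.

Lemma cube_gauss_le h M s x : 0 < h -> M * h ^+ 2 = 1 -> M <= s ->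
  s * `|x| ^+ 3 * expR (- (s * x ^+ 2 / 4)) <= 16 * h.
Proof.
move=> h0 Mh Ms; have M0 : 0 < M by rewrite -(pmulr_lgt0 _ (exprn_gt0 2 h0)) Mh.
have s0 : 0 <= s by rewrite (le_trans (ltW M0)).
have k1 := norm_gauss_le _ _ _ x h0 Mh Ms.
have k2 := mul_expRN_le1 (s * x ^+ 2 / 8).
have -> : s * `|x| ^+ 3 * expR (- (s * x ^+ 2 / 4)) =
   8 * ((s * x ^+ 2 / 8 * expR (- (s * x ^+ 2 / 8))) *
        (`|x| * expR (- (s * x ^+ 2 / 8)))).
  by rewrite gauss_split8 -[x ^+ 2]real_normK ?num_real //; field.
have -> : 16 * h = 8 * (1 * (2 * h)) by ring.
have e0 := expR_ge0 (- (s * x ^+ 2 / 8)).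
have P1 : 0 <= s * x ^+ 2 / 8 * expR (- (s * x ^+ 2 / 8)).
  apply: mulr_ge0 => //; apply: divr_ge0 => //.
  by apply: mulr_ge0 => //; exact: sqr_ge0.
have P2 : 0 <= `|x| * expR (- (s * x ^+ 2 / 8)) by apply: mulr_ge0.
by rewrite ler_pM2l //; apply: ler_pM.
Qed.

End AnalyticEstimates.

(** * Pointwise comparison with Gaussians *)

Section InnerPointwise.
Context {R : realType}.
Implicit Types (x v w xi p : R).

(** For w nonzero, the modulus of the transform of _k psi divided by lambda(xi)^m / sqrt(2 pi); the
    normalisation makes the estimates uniform in m. *)
Definition scaled_envelope (k m : nat) (xi w : R) : R :=
  `|w| ^- k * wavelet_envelope m w / lambda_fun xi ^+ m.

Lemma lambda_fun_ratio xi v m : 0 < xi < pi / 2 -> 0 < v < pi / 2 ->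
  lambda_fun v ^+ m / lambda_fun xi ^+ m =
  expR (m%:R * (ln (lambda_fun v) - ln (lambda_fun xi))).
Proof.
move=> hxi hv; rewrite -expr_div_n expRM_natl expRB.
by rewrite !lnK ?posrE ?lambda_fun_gt0.
Qed.

(** Here [tau] is the relative excess of the envelope over lambda(v)^m. *)
Lemma scaled_envelope_inner k m xi v : (1 < m)%N -> 0 < xi < pi / 2 -> 0 < v < pi / 2 ->
  exists2 tau, 0 <= tau /\
    1 + tau <= (1 + (v / (pi - v)) ^+ (2 * m)) * (1 + 4 / 2 ^+ (2 * m)) &
  scaled_envelope k m xi (2 * pi - 4 * v) =
  (2 * pi - 4 * v) ^- k * expR (m%:R * (ln (lambda_fun v) - ln (lambda_fun xi))) * (1 + tau).
Proof.
move=> m1 hxi hv; have /andP[E1 E2] := wavelet_envelope_inner m v m1 hv.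
have l0 : 0 < lambda_fun v ^+ m by rewrite exprn_gt0 // lambda_fun_gt0.
have lx0 : 0 < lambda_fun xi ^+ m by rewrite exprn_gt0 // lambda_fun_gt0.
have e1 (z : R) : 1 + (z - 1) = z by ring.
exists (wavelet_envelope m (2 * pi - 4 * v) / lambda_fun v ^+ m - 1).
  rewrite subr_ge0 e1 ler_pdivlMr // mul1r ler_pdivrMr //; split=> //.
  by rewrite [leRHS]mulrC.
have /andP[v0 v1] := hv; have w0 : 0 < 2 * pi - 4 * v by lra.
rewrite e1 -lambda_fun_ratio // /scaled_envelope (gtr0_norm w0).
move: (_ ^- k) => W; move: l0 lx0; move: (lambda_fun v ^+ m) (lambda_fun xi ^+ m) => a b a0 b0.
by field; rewrite !gt_eqF.
Qed.

Lemma tau_le4 m v tau : (1 < m)%N -> 0 < v < pi / 2 ->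
  1 + tau <= (1 + (v / (pi - v)) ^+ (2 * m)) * (1 + 4 / 2 ^+ (2 * m)) -> tau <= 3.
Proof.
move=> m1 /andP[v0 v1] H; have h3 := @inv_pow4_le R m m1.
have y0 : 0 < pi - v by lra.
have r1 : (v / (pi - v)) ^+ (2 * m) <= 1.
  rewrite exprn_ile1 ?divr_ge0 ?(ltW v0) ?(ltW y0) //.
  by rewrite ler_pdivrMr // mul1r; lra.
have r0 : 0 <= (v / (pi - v)) ^+ (2 * m) by rewrite exprn_ge0 // divr_ge0 // ltW.
have q0 : 0 <= 4 / 2 ^+ (2 * m) :> R by rewrite divr_ge0 ?exprn_ge0.
by move: r1 r0 q0 h3 H; move: (_ ^+ _) (4 / _) => a b; nra.
Qed.

(** For v <= 1/2 the ratio v / (pi - v) is at most 1/2. With b = 4^(-m) <= 1/m = h^2 <= h this gives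
    1 + tau <= (1 + b) (1 + 4 b) <= 1 + 9 b. *)
Lemma tau_near m v tau h : (1 < m)%N -> 0 < v <= 2^-1 -> 0 < h -> m%:R * h ^+ 2 = 1 ->
  1 + tau <= (1 + (v / (pi - v)) ^+ (2 * m)) * (1 + 4 / 2 ^+ (2 * m)) -> tau <= 9 * h.
Proof.
move=> m1 /andP[v0 v1] h0 mh H; have pi2 := @pi_lower R.
have y0 : 0 < pi - v by lra.
have m0 : 0 < m%:R :> R by rewrite ltr0n ltnW.
have h1 : h <= 1.
  rewrite -(@expr_le1 _ 2) ?(ltW h0) // -mh ler_peMl ?sqr_ge0 // ler1n (ltnW m1) //.
set b : R := 4 ^- m.
have b0 : 0 < b by rewrite invr_gt0 exprn_gt0.
have bh : b <= h.
  apply: (@le_trans _ _ (h ^+ 2)); last by rewrite expr2 ler_piMr // ltW.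
  have -> : h ^+ 2 = m%:R^-1 by rewrite -[LHS](mulKf (lt0r_neq0 m0)) mh mulr1.
  rewrite lef_pV2 ?posrE ?exprn_gt0 // -natrX ler_nat.
  by rewrite ltnW // ltn_expl.
have r1 : (v / (pi - v)) ^+ (2 * m) <= b.
  rewrite exprM /b -exprVn lerXn2r ?nnegrE ?sqr_ge0 ?invr_ge0 //.
  have r2 : v / (pi - v) <= 2^-1 by rewrite ler_pdivrMr //; lra.
  have r3 : 0 <= v / (pi - v) by rewrite divr_ge0 // ltW.
  by move: r2 r3; move: (v / _) => r; nra.
have r0 : 0 <= (v / (pi - v)) ^+ (2 * m) by rewrite exprn_ge0 // divr_ge0 // ltW.
have qb : 4 / 2 ^+ (2 * m) = 4 * b.
  by rewrite exprM /b; congr (_ / _ ^+ _); ring.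
rewrite qb in H; clearbody b; move: r1 r0 H; move: (_ ^+ (2 * m)) => a r1 r0 H.
have b1 : b <= 1 by exact: le_trans h1.
nra.
Qed.

End InnerPointwise.

Section Pointwise.
Context {R : realType}.
Implicit Types (x v w xi p h : R).

Lemma scaled_envelope_powR k m p xi v : (1 < m)%N -> 0 <= p ->
  0 < xi < pi / 2 -> 0 < v < pi / 2 ->
  exists2 tau, 0 <= tau /\
    1 + tau <= (1 + (v / (pi - v)) ^+ (2 * m)) * (1 + 4 / 2 ^+ (2 * m)) &
  scaled_envelope k m xi (2 * pi - 4 * v) `^ p =
  freq_weight k p v *
  expR (m%:R * p * (ln (lambda_fun v) - ln (lambda_fun xi))) * (1 + tau) `^ p.
Proof.
move=> m1 p0 hxi hv; have [tau [t0 t1] E] := scaled_envelope_inner k m xi v m1 hxi hv.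
exists tau => //; have /andP[v0 v1] := hv; have w0 : 0 < 2 * pi - 4 * v by lra.
have wk : 0 <= (2 * pi - 4 * v) ^- k by rewrite invr_ge0 exprn_ge0 // ltW.
rewrite E powRM ?mulr_ge0 ?expR_ge0 ?addr_ge0 // powRM ?expR_ge0 //.
by rewrite freq_weightE // -expRM [m%:R * p * _]mulrAC.
Qed.

Lemma pointwise_near k p xi : 1 < p -> 0 < xi < 3 / 10 -> ln_lambda_deriv xi = 0 ->
  exists K, exists2 d, 0 < d & 0 <= K /\
  forall m v h, (1 < m)%N -> 0 < h -> m%:R * h ^+ 2 = 1 ->
    0 < v < pi / 2 -> `|v - xi| < d ->
  `|scaled_envelope k m xi (2 * pi - 4 * v) `^ p -
    freq_weight k p xi * expR (- (m%:R * p * ln_lambda_curv xi * (v - xi) ^+ 2))| <=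
  K * h * expR (- (m%:R * p * (v - xi) ^+ 2 / 4)).
Proof.
move=> p1 /andP[xi0 xi1] D0; have pi2 := @pi_ge2 R.
have hxi : 0 < xi < pi / 2 by rewrite xi0 /=; lra.
have p0 : 0 <= p by rewrite (le_trans _ (ltW p1)).
have [C [d1 d10 [C0 HC]]] := ln_lambda_cubic xi hxi D0.
have [CW [d2 d20 [CW0 HW]]] := derivable_lipschitz_at _ _ (derivable_freq_weight k p _ hxi).
set R0 := freq_weight k p xi; have R00 : 0 <= R0 by exact: expR_ge0.
set L := ln_lambda_curv xi; have L0 : 2^-1 <= L by exact: ln_lambda_curv_ge.
set P4 := (4 : R) `^ p; have P40 : 0 <= P4 by exact: powR_ge0.
set Cp := p * expR (3 * p); have Cp0 : 0 <= Cp by rewrite mulr_ge0 ?expR_ge0.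
(* The three summands answer to the variation of the frequency weight, the excess [tau], and the
   cubic remainder of ln lambda. The radius 1/5 and xi < 3/10 keep v below 1/2, as [tau_near]
   requires. *)
exists (2 * CW * P4 + 9 * R0 * Cp + 16 * R0 * C), (Num.min (5^-1) (Num.min d1 d2)).
  by rewrite !lt_min d10 d20 invr_gt0 ltr0n.
split=> [|m v h m1 h0 mh hv]; first by rewrite !addr_ge0 ?mulr_ge0.
rewrite !lt_min => /and3P[v5 vd1 vd2].
have [_ hg] := HC v vd1; have hw := HW v vd2; rewrite -/R0 in hw; rewrite -/L in hg.
have gc := ln_lambda_concave xi v hxi D0 hv.
have [tau [t0 t1] ->] := scaled_envelope_powR k m p xi v m1 p0 hxi hv.
have t3 := tau_le4 m v tau m1 hv t1.
have vhalf : 0 < v <= 2^-1.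
  case/andP: hv => v0 _; rewrite v0 /=.
  by move: v5; rewrite ltr_norml; lra.
have t9 := tau_near m v tau h m1 vhalf h0 mh t1.
set g := ln (lambda_fun v) - ln (lambda_fun xi) in gc hg *.
set x := v - xi in gc hg hw *.
set s := m%:R * p.
have m0 : 0 < m%:R :> R by rewrite ltr0n ltnW.
have ms : m%:R <= s by rewrite /s ler_peMr // ltW.
have s0 : 0 <= s by rewrite mulr_ge0.
set e4 := expR (- (s * x ^+ 2 / 4)).
set W := freq_weight k p v; set T := (1 + tau) `^ p.
have e40 : 0 <= e4 by exact: expR_ge0.
have e41 : e4 <= 1 by apply: gauss_le1.
have a1 : s * g <= - (s * x ^+ 2 / 2).
  by have := ler_wpM2l s0 gc; rewrite mulrN mulrA.
have a2 : - (s * L * x ^+ 2) <= - (s * x ^+ 2 / 2).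
  rewrite lerN2 [leRHS]mulrAC ler_wpM2l //; first by rewrite mulr_ge0 // sqr_ge0.
have B1 : expR (s * g) <= e4 * e4 by rewrite -gauss_split ler_expR.
have /andP[T0 T1] : 0 <= T - 1 <= Cp * tau by apply: powR_oneD_sub1; rewrite // t0.
have T4 : T <= P4.
  apply: ge0_ler_powR; rewrite ?nnegrE ?addr_ge0 //; clear - t3; lra.
have TT : 0 <= T by exact: powR_ge0.
have D1 : `|expR (s * g) - expR (- (s * L * x ^+ 2))| <= s * (C * `|x| ^+ 3) * (e4 * e4).
  rewrite (le_trans (norm_expRB _ _ _ a1 a2)) // -gauss_split ler_wpM2r ?expR_ge0 //.
  have -> : s * g - - (s * L * x ^+ 2) = s * (g + L * x ^+ 2) by ring.
  by rewrite normrM (ger0_norm s0) ler_wpM2l.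
have k1 := norm_gauss4_le _ _ _ x h0 mh ms; rewrite -/e4 in k1.
have k2 := cube_gauss_le _ _ _ x h0 mh ms; rewrite -/e4 in k2.
have -> : W * expR (s * g) * T - R0 * expR (- (s * L * x ^+ 2)) =
  (W - R0) * (expR (s * g) * T) + R0 * (expR (s * g) * (T - 1)) +
  R0 * (expR (s * g) - expR (- (s * L * x ^+ 2))) by ring.
have E0 : 0 <= expR (s * g) by exact: expR_ge0.
have -> : (2 * CW * P4 + 9 * R0 * Cp + 16 * R0 * C) * h * e4 =
  2 * CW * P4 * h * e4 + 9 * R0 * Cp * h * e4 + 16 * R0 * C * h * e4 by ring.
rewrite (le_trans (ler_normD _ _)) // lerD //.
  rewrite (le_trans (ler_normD _ _)) // lerD //.
    rewrite normrM (ger0_norm (mulr_ge0 E0 TT)).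
    apply: (@le_trans _ _ (CW * `|x| * (e4 * e4 * P4))).
      by apply: ler_pM => //; [exact: mulr_ge0 | apply: ler_pM].
    have -> : CW * `|x| * (e4 * e4 * P4) = (CW * P4 * e4) * (`|x| * e4) by ring.
    have -> : 2 * CW * P4 * h * e4 = (CW * P4 * e4) * (2 * h) by ring.
    by rewrite ler_wpM2l // !mulr_ge0.
  rewrite normrM (ger0_norm R00) (ger0_norm (mulr_ge0 E0 T0)).
  have -> : 9 * R0 * Cp * h * e4 = R0 * (e4 * (Cp * (9 * h))) by ring.
  rewrite ler_wpM2l // ler_pM //.
    by rewrite (le_trans B1) // ler_piMr.
  by rewrite (le_trans T1) // ler_wpM2l.
rewrite normrM (ger0_norm R00).
have -> : 16 * R0 * C * h * e4 = R0 * (C * e4 * (16 * h)) by ring.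
rewrite ler_wpM2l // (le_trans D1) //.
have -> : s * (C * `|x| ^+ 3) * (e4 * e4) = C * e4 * (s * `|x| ^+ 3 * e4) by ring.
by rewrite ler_wpM2l // mulr_ge0.
Qed.

(** Away from the peak both quantities are at most a constant times exp(-s x^2 / 2), with s = m p
    and x = v - xi; one half of that exponent already yields O(h^2). *)
Lemma pointwise_far k p xi d : 1 < p -> 0 < xi < 3 / 10 -> ln_lambda_deriv xi = 0 -> 0 < d ->
  exists2 K, 0 <= K &
  forall m v h, (1 < m)%N -> (k <= m)%N -> 0 < h -> m%:R * h ^+ 2 = 1 ->
    0 < v < pi / 2 -> d <= `|v - xi| ->
  `|scaled_envelope k m xi (2 * pi - 4 * v) `^ p -
    freq_weight k p xi * expR (- (m%:R * p * ln_lambda_curv xi * (v - xi) ^+ 2))| <=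
  K * h * expR (- (m%:R * p * (v - xi) ^+ 2 / 4)).
Proof.
move=> p1 /andP[xi0 xi1] D0 d0; have pi2 := @pi_ge2 R; have pi4 := @pi_upper R.
have hxi : 0 < xi < pi / 2 by rewrite xi0 /=; lra.
have p0 : 0 <= p by rewrite (le_trans _ (ltW p1)).
set R0 := freq_weight k p xi; have R00 : 0 <= R0 by exact: expR_ge0.
set L := ln_lambda_curv xi; have L0 : 2^-1 <= L by exact: ln_lambda_curv_ge.
set l := lambda_fun xi; have l0 : 0 < l by exact: lambda_fun_gt0.
(* The 4 bounds 1 + [tau]. Of the m factors lambda(v) / lambda(xi), k cancel the weight and leave
   lambda(xi)^(-k); restoring m in the exponent of the other m - k costs exp(k x^2 / 2) <= exp(2 k),
   as |x| <= 2. *)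
set A := 4 * l ^- k * expR (2 * k%:R).
have A0 : 0 <= A by rewrite !mulr_ge0 ?expR_ge0 // invr_ge0 exprn_ge0 // ltW.
exists ((A `^ p + R0) * (4 / d ^+ 2)).
  by rewrite mulr_ge0 ?addr_ge0 ?powR_ge0 // divr_ge0 // sqr_ge0.
move=> m v h m1 km h0 mh hv vd; have /andP[v0 v1] := hv.
have gc := ln_lambda_concave xi v hxi D0 hv.
have [tau [t0 t1] E] := scaled_envelope_inner k m xi v m1 hxi hv.
have t3 := tau_le4 m v tau m1 hv t1.
set g := ln (lambda_fun v) - ln (lambda_fun xi) in gc E.
set x := v - xi in gc vd *; set s := m%:R * p.
have m0 : 0 < m%:R :> R by rewrite ltr0n ltnW.
have ms : m%:R <= s by rewrite /s ler_peMr // ltW.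
have s0 : 0 < s by rewrite (lt_le_trans m0).
have w0 : 0 < 2 * pi - 4 * v by clear - v1; lra.
have x4 : x ^+ 2 <= 4.
  rewrite -[x ^+ 2]real_normK ?num_real //.
  have x2 : `|x| <= 2 by rewrite ler_norml /x; clear - xi0 xi1 v0 v1 pi4; lra.
  have -> : 4 = 2 ^+ 2 :> R by ring.
  by rewrite lerXn2r ?nnegrE.
have Z1 : scaled_envelope k m xi (2 * pi - 4 * v) <= A * expR (- (m%:R * x ^+ 2 / 2)).
  rewrite E; apply: (@le_trans _ _ ((2 * pi - 4 * v) ^- k * expR (m%:R * g) * 4)).
    rewrite ler_wpM2l //; last by clear - t3; lra.
    by rewrite mulr_ge0 ?expR_ge0 // invr_ge0 exprn_ge0 // ltW.
  have -> : m%:R * g = k%:R * g + (m - k)%:R * g by rewrite natrB //; ring.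
  rewrite expRD.
  have e1 : (2 * pi - 4 * v) ^- k * expR (k%:R * g) <= l ^- k.
    rewrite /g -lambda_fun_ratio // mulrA mulrC ler_piMr //.
      by rewrite invr_ge0 exprn_ge0 // ltW.
    rewrite mulrC ler_pdivrMr ?exprn_gt0 // mul1r lerXn2r ?nnegrE ?lambda_fun_le ?(ltW w0) //.
    by rewrite ltW // lambda_fun_gt0.
  have e2 : expR ((m - k)%:R * g) <= expR (2 * k%:R) * expR (- (m%:R * x ^+ 2 / 2)).
    rewrite -expRD ler_expR natrB //.
    have kmR : 0 <= m%:R - k%:R :> R by rewrite subr_ge0 ler_nat.
    have := ler_wpM2l kmR gc; have : 0 <= k%:R :> R by [].
    have := sqr_ge0 x.
    by move: (k%:R : R) (m%:R : R) (x ^+ 2) x4 => a b y; clear => *; nra.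
  have -> : A * expR (- (m%:R * x ^+ 2 / 2)) =
     l ^- k * (expR (2 * k%:R) * expR (- (m%:R * x ^+ 2 / 2))) * 4 by rewrite /A; ring.
  rewrite ler_wpM2r // mulrA ler_pM ?expR_ge0 //.
  by rewrite mulr_ge0 ?expR_ge0 // invr_ge0 exprn_ge0 // ltW.
have Z0 : 0 <= scaled_envelope k m xi (2 * pi - 4 * v).
  by rewrite E !mulr_ge0 ?expR_ge0 ?addr_ge0 // invr_ge0 exprn_ge0 // ltW.
set e4 := expR (- (s * x ^+ 2 / 4)).
have e40 : 0 <= e4 by exact: expR_ge0.
have Zp : scaled_envelope k m xi (2 * pi - 4 * v) `^ p <= A `^ p * (e4 * e4).
  apply: (@le_trans _ _ ((A * expR (- (m%:R * x ^+ 2 / 2))) `^ p)).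
    by apply: ge0_ler_powR; rewrite // nnegrE // mulr_ge0 ?expR_ge0.
  rewrite powRM ?expR_ge0 // -expRM -gauss_split ler_wpM2l ?powR_ge0 // ler_expR.
  by rewrite /s mulNr lerN2 le_eqVlt; apply/orP; left; apply/eqP; ring.
have G1 : expR (- (s * L * x ^+ 2)) <= e4 * e4.
  rewrite -gauss_split ler_expR lerN2 [leRHS]mulrAC ler_wpM2l //.
  by rewrite mulr_ge0 ?sqr_ge0 // ltW.
have d2 : d ^+ 2 <= x ^+ 2.
  by rewrite -[x ^+ 2]real_normK ?num_real // lerXn2r ?nnegrE // ltW.
have x20 : 0 < x ^+ 2 by rewrite (lt_le_trans _ d2) // exprn_gt0.
have h1 : h <= 1.
  rewrite -(@expr_le1 _ 2) ?(ltW h0) // -mh ler_peMl ?sqr_ge0 // ler1n (ltnW m1) //.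
have e4h : e4 <= 4 / d ^+ 2 * h.
  have := mul_expRN_le1 (s * x ^+ 2 / 4); rewrite -/e4 => he.
  have c1 : m%:R * d ^+ 2 / 4 <= s * x ^+ 2 / 4.
    by rewrite ler_wpM2r // ler_pM // ?sqr_ge0 // ltW.
  have c2 : m%:R * d ^+ 2 / 4 * e4 <= 1 by apply: le_trans he; rewrite ler_wpM2r.
  have c0 : 0 < m%:R * d ^+ 2 / 4 by rewrite divr_gt0 // mulr_gt0 // exprn_gt0.
  have c3 : e4 <= (m%:R * d ^+ 2 / 4)^-1 by rewrite -[leRHS]mul1r ler_pdivlMr // mulrC.
  apply: (le_trans c3).
  have -> : (m%:R * d ^+ 2 / 4)^-1 = 4 / d ^+ 2 * h ^+ 2.
    have -> : h ^+ 2 = m%:R^-1 by rewrite -[LHS](mulKf (lt0r_neq0 m0)) mh mulr1.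
    by move: m0; move: (m%:R : R) => a a0; field; rewrite !gt_eqF.
  by rewrite ler_wpM2l ?divr_ge0 ?sqr_ge0 // expr2 ler_piMr // ltW.
apply: (le_trans (ler_normB _ _)).
rewrite (ger0_norm (powR_ge0 _ _)) (ger0_norm (mulr_ge0 R00 (expR_ge0 _))).
apply: (@le_trans _ _ ((A `^ p + R0) * (e4 * e4))).
  by rewrite [leRHS]mulrDl lerD // ler_wpM2l.
have AR : 0 <= A `^ p + R0 by rewrite addr_ge0 ?powR_ge0.
have -> : (A `^ p + R0) * (4 / d ^+ 2) * h * e4 =
  (A `^ p + R0) * (4 / d ^+ 2 * h * e4) by ring.
by rewrite ler_wpM2l // ler_wpM2r.
Qed.

End Pointwise.

Section PointwiseAll.
Context {R : realType}.
Implicit Types (x v w xi p h M s L c d r : R).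

(** Disposes of the Gaussian of a peak at scaled distance at least d: half of the exponent pays for
    the factor h through t exp(-t) <= 1. *)
Lemma gauss_far h M s L x d : 0 < h <= 1 -> M * h ^+ 2 = 1 -> M <= s -> 2^-1 <= L ->
  0 < d -> d <= `|x| ->
  expR (- (s * L * x ^+ 2)) <= 4 / d ^+ 2 * h * expR (- (s * x ^+ 2 / 4)).
Proof.
move=> /andP[h0 h1] mh Ms L0 d0 dx.
have M0 : 0 < M by rewrite -(pmulr_lgt0 _ (exprn_gt0 2 h0)) mh.
have s0 : 0 < s by rewrite (lt_le_trans M0).
set e4 := expR (- (s * x ^+ 2 / 4)).
have e40 : 0 <= e4 by exact: expR_ge0.
have G1 : expR (- (s * L * x ^+ 2)) <= e4 * e4.
  rewrite -gauss_split ler_expR lerN2 [leRHS]mulrAC ler_wpM2l //.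
  by rewrite mulr_ge0 ?sqr_ge0 // ltW.
apply: (le_trans G1); rewrite ler_wpM2r //.
have d2 : d ^+ 2 <= x ^+ 2.
  by rewrite -[x ^+ 2]real_normK ?num_real // lerXn2r ?nnegrE // ltW.
have he := mul_expRN_le1 (s * x ^+ 2 / 4); rewrite -/e4 in he.
have c1 : M * d ^+ 2 / 4 <= s * x ^+ 2 / 4.
  by rewrite ler_wpM2r // ler_pM // ?sqr_ge0 // ltW.
have c2 : M * d ^+ 2 / 4 * e4 <= 1 by apply: le_trans he; rewrite ler_wpM2r.
have c0 : 0 < M * d ^+ 2 / 4 by rewrite divr_gt0 // mulr_gt0 // exprn_gt0.
have c3 : e4 <= (M * d ^+ 2 / 4)^-1 by rewrite -[leRHS]mul1r ler_pdivlMr // mulrC.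
apply: (le_trans c3).
have -> : (M * d ^+ 2 / 4)^-1 = 4 / d ^+ 2 * h ^+ 2.
  have -> : h ^+ 2 = M^-1 by rewrite -[LHS](mulKf (lt0r_neq0 M0)) mh mulr1.
  by field; rewrite !gt_eqF.
by rewrite ler_wpM2l ?divr_ge0 ?sqr_ge0 // expr2 ler_piMr // ltW.
Qed.

Lemma bernoulli_ge (x : R) n : 0 <= x -> 1 + n%:R * x <= (1 + x) ^+ n.
Proof.
move=> x0; elim: n => [|n IH]; first by rewrite mul0r addr0 expr0.
rewrite exprS -natr1.
have n0 : 0 <= n%:R * x by rewrite mulr_ge0.
have : 0 <= n%:R * x * x by rewrite mulr_ge0.
move: IH; set b := (1 + x) ^+ n; move: (n%:R : R) n0 => a n0 IH; nra.
Qed.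

(** Bernoulli's inequality with d = 1/r - 1. The exponent m - 2 leaves two powers free for
    integrability in w. *)
Lemma geometric_inv_le r m : 0 < r < 1 -> (1 < m)%N ->
  m%:R * r ^+ (m - 2) <= 2 + (r^-1 - 1)^-1.
Proof.
move=> /andP[r0 r1] m1; set d := r^-1 - 1.
have d0 : 0 < d by rewrite subr_gt0 invf_gt1.
have re : r = (1 + d)^-1 by rewrite /d addrC subrK invrK.
rewrite {1}re exprVn; have d1 : 0 < (1 + d) ^+ (m - 2) by rewrite exprn_gt0 // addr_gt0.
rewrite ler_pdivrMr //.
have B := bernoulli_ge d (m - 2) (ltW d0); rewrite natrB // in B.
have c0 : 0 <= 2 + d^-1 by rewrite addr_ge0 // invr_ge0 ltW.
apply: (le_trans _ (ler_wpM2l c0 B)).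
have -> : (2 + d^-1) * (1 + (m%:R - 2) * d) = m%:R + d^-1 + 2 * ((m%:R - 2) * d).
  by field; rewrite gt_eqF.
have m2 : 0 <= m%:R - 2 :> R by rewrite subr_ge0 ler_nat.
by rewrite -addrA lerDl addr_ge0 ?invr_ge0 ?mulr_ge0 // ltW.
Qed.

Lemma scaled_envelope_outer k p xi : 1 < p -> 69 / 100 <= lambda_fun xi ->
  exists2 K, 0 <= K &
  forall m w h, (1 < m)%N -> 0 < h -> m%:R * h ^+ 2 = 1 -> 2 * pi <= w ->
  scaled_envelope k m xi w `^ p <= K * h ^+ 2 / (1 + w ^+ 2).
Proof.
move=> p1 hl; set l := lambda_fun xi in hl; have l0 : 0 < l by lra.
have pl := @pi_lower R.
have p0 : 0 <= p by rewrite (le_trans _ (ltW p1)).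
set r := 4 / (l * (2 * pi)).
(* This is 2 / pi < lambda(xi), obtained from 0.69 times 6 being above 4. *)
have lp : 4 < l * (2 * pi).
  have : 69 / 100 * 6 <= l * (2 * pi) by apply: ler_pM => //; clear - pl; lra.
  by clear; lra.
have r0 : 0 < r by rewrite divr_gt0 // (lt_trans _ lp).
have r1 : r < 1 by rewrite ltr_pdivrMr ?mul1r // (lt_trans _ lp).
set K3 := 2 + (r^-1 - 1)^-1.
have K30 : 0 <= K3 by rewrite addr_ge0 // invr_ge0 subr_ge0 invf_ge1 // ltW.
exists ((4 : R) `^ p * (32 / l ^+ 2 * K3)).
  by rewrite !mulr_ge0 ?powR_ge0 // invr_ge0 exprn_ge0 // ltW.
move=> m w h m1 h0 mh hw; have w1 : 1 <= w by clear - pl hw; lra.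
have w0 : 0 < w by exact: lt_le_trans w1.
have E := wavelet_envelope_outer m w m1 w0.
set c := 4 / (l * w).
have c0 : 0 < c by rewrite divr_gt0 // mulr_gt0.
have cr : c <= r.
  have pi0 : 0 < 2 * pi :> R by clear - pl; lra.
  have d1 : 0 < l * (2 * pi) by exact: mulr_gt0.
  have d2 : 0 < l * w by exact: mulr_gt0.
  by rewrite /c /r ler_pM2l // lef_pV2 ?posrE // ler_pM2l.
have Z1 : scaled_envelope k m xi w <= 4 * c ^+ m.
  rewrite /scaled_envelope (gtr0_norm w0) ler_pdivrMr ?exprn_gt0 // -/l.
  have -> : 4 * c ^+ m * l ^+ m = 4 * (4 / w) ^+ m.
    rewrite -mulrA -exprMn /c; congr (_ * _ ^+ _).
    by field; rewrite !gt_eqF.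
  apply: le_trans E; rewrite ler_piMl ?wavelet_envelope_ge0 //.
  by rewrite invf_le1 ?exprn_gt0 // exprn_ege1.
have Z0 : 0 <= scaled_envelope k m xi w.
  apply: divr_ge0; last by rewrite exprn_ge0 // ltW.
  apply: mulr_ge0; last exact: wavelet_envelope_ge0.
  by rewrite invr_ge0 exprn_ge0.
have c1 : c <= 1 by rewrite (le_trans cr) // ltW.
have cm0 : 0 < c ^+ m by rewrite exprn_gt0.
apply: (@le_trans _ _ ((4 * c ^+ m) `^ p)).
  by apply: ge0_ler_powR; rewrite // nnegrE // mulr_ge0 // ltW.
rewrite powRM ?(ltW cm0) //.
have -> : 4 `^ p * (32 / l ^+ 2 * K3) * h ^+ 2 / (1 + w ^+ 2) =
  4 `^ p * (32 / l ^+ 2 * K3 * h ^+ 2 / (1 + w ^+ 2)) by ring.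
rewrite ler_wpM2l ?powR_ge0 //.
apply: (@le_trans _ _ (c ^+ m)).
  by apply: ge1r_powR; [rewrite cm0 exprn_ile1 // ltW | exact: ltW].
(* The square supplies the integrable 1 / (1 + w^2), the remaining power the factor h^2 = 1/m. *)
have -> : c ^+ m = c ^+ 2 * c ^+ (m - 2) by rewrite -exprD subnKC.
have q1 : c ^+ (m - 2) <= K3 * h ^+ 2.
  have m0 : 0 < m%:R :> R by rewrite ltr0n ltnW.
  have -> : h ^+ 2 = m%:R^-1 by rewrite -[LHS](mulKf (lt0r_neq0 m0)) mh mulr1.
  rewrite ler_pdivlMr // mulrC.
  apply: le_trans (geometric_inv_le r m _ m1); last by rewrite r0.
  rewrite ler_wpM2l // lerXn2r ?nnegrE ?(ltW c0) ?(ltW r0) //.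
have q2 : c ^+ 2 <= 32 / l ^+ 2 / (1 + w ^+ 2).
  have -> : c ^+ 2 = 16 / l ^+ 2 * (w ^+ 2)^-1.
    by rewrite /c; field; rewrite !gt_eqF.
  have -> : 32 / l ^+ 2 / (1 + w ^+ 2) = 16 / l ^+ 2 * (2 / (1 + w ^+ 2)) by field;
    rewrite !gt_eqF // ltr_pwDl // sqr_ge0.
  rewrite ler_wpM2l ?divr_ge0 ?sqr_ge0 // ler_pdivlMr ?ltr_pwDl ?sqr_ge0 //.
  rewrite mulrC ler_pdivrMr ?exprn_gt0 //.
  have w2 : 1 <= w ^+ 2 by rewrite exprn_ege1.
  by clear - w2; lra.
have -> : 32 / l ^+ 2 * K3 * h ^+ 2 / (1 + w ^+ 2) =
   (32 / l ^+ 2 / (1 + w ^+ 2)) * (K3 * h ^+ 2) by ring.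
by apply: ler_pM; rewrite ?exprn_ge0 // ltW.
Qed.

Lemma scaled_envelopeN k m xi w : scaled_envelope k m xi (- w) = scaled_envelope k m xi w.
Proof. by rewrite /scaled_envelope normrN wavelet_envelopeN. Qed.

(** For w = 2 pi - 4 v and b = 2 pi - 4 xi, (b - w) / 4 = v - xi; the second term is the mirror
    image of the first. *)
Definition gauss_peaks (a b w : R) : R :=
  expR (- (a * ((b - w) / 4) ^+ 2)) + expR (- (a * ((b + w) / 4) ^+ 2)).

Lemma gauss_peaksN a b w : gauss_peaks a b (- w) = gauss_peaks a b w.
Proof. by rewrite /gauss_peaks opprK addrC. Qed.

(** By evenness w > 0 suffices. The Gaussian centred at -b is then negligible since (b + w) / 4 >=
    1. The other one is the approximant below 2 pi, and beyond 2 pi it is negligible as well,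
    because (w - b) / 4 >= xi. *)
Lemma pointwise_all k p xi : 1 < p -> 0 < xi < 3 / 10 -> ln_lambda_deriv xi = 0 ->
  69 / 100 <= lambda_fun xi ->
  exists2 K, 0 <= K &
  forall m h w, (1 < m)%N -> (k <= m)%N -> 0 < h -> m%:R * h ^+ 2 = 1 -> w != 0 ->
  `|scaled_envelope k m xi w `^ p -
    freq_weight k p xi * gauss_peaks (m%:R * p * ln_lambda_curv xi) (2 * pi - 4 * xi) w| <=
  K * h * gauss_peaks (m%:R * p / 4) (2 * pi - 4 * xi) w + K * h ^+ 2 / (1 + w ^+ 2).
Proof.
move=> p1 hx D0 hl; have /andP[xi0 xi1] := hx; have pi2 := @pi_lower R.
have hxi : 0 < xi < pi / 2 by rewrite xi0 /=; lra.
have p0 : 0 <= p by rewrite (le_trans _ (ltW p1)).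
have [K1 [d d0 [K10 H1]]] := pointwise_near k p xi p1 hx D0.
have [K2 K20 H2] := pointwise_far k p xi d p1 hx D0 d0.
have [K3 K30 H3] := scaled_envelope_outer k p xi p1 hl.
set R0 := freq_weight k p xi in H1 H2 *; have R00 : 0 <= R0 by exact: expR_ge0.
set L := ln_lambda_curv xi in H1 H2 *; have L0 : 2^-1 <= L by exact: ln_lambda_curv_ge.
set b := 2 * pi - 4 * xi.
set Kx := R0 * (4 / xi ^+ 2).
have Kx0 : 0 <= Kx by rewrite mulr_ge0 // divr_ge0 // sqr_ge0.
exists (K1 + K2 + K3 + 4 * R0 + Kx); first by rewrite !addr_ge0 // mulr_ge0.
set K := K1 + K2 + K3 + 4 * R0 + Kx.
move=> m h + m1 km h0 mh.
have h1 : h <= 1.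
  by rewrite -(@expr_le1 _ 2) ?(ltW h0) // -mh ler_peMl ?sqr_ge0 // ler1n (ltnW m1).
have hI : 0 < h <= 1 by rewrite h0.
have ms : m%:R <= m%:R * p by rewrite ler_peMr // ltW.
suff pos w : 0 < w -> `|scaled_envelope k m xi w `^ p - R0 * gauss_peaks (m%:R * p * L) b w| <=
    K * h * gauss_peaks (m%:R * p / 4) b w + K * h ^+ 2 / (1 + w ^+ 2).
  move=> w w0; have [wp|wn] := ltP 0 w; first exact: pos.
  have := pos (- w); rewrite scaled_envelopeN !gauss_peaksN sqrrN; apply.
  by rewrite oppr_gt0 lt_neqAle w0.
move=> w0.
rewrite /gauss_peaks.
set xp := (b - w) / 4; set xm := (b + w) / 4.
set s := m%:R * p in ms *.
have es (x : R) : s / 4 * x ^+ 2 = s * x ^+ 2 / 4 by ring.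
rewrite !es; set ep := expR (- (s * xp ^+ 2 / 4)); set em := expR (- (s * xm ^+ 2 / 4)).
set gp := expR (- (s * L * xp ^+ 2)); set gm := expR (- (s * L * xm ^+ 2)).
have ep0 : 0 <= ep by exact: expR_ge0.
have em0 : 0 <= em by exact: expR_ge0.
have gm0 : 0 <= gm by exact: expR_ge0.
have gp0 : 0 <= gp by exact: expR_ge0.
have gmB : R0 * gm <= 4 * R0 * h * em.
  have xm1 : 1 <= `|xm| by rewrite ger0_norm /xm /b; clear - xi1 pi2 w0; lra.
  have := gauss_far h m%:R s L xm 1 hI mh ms L0 ltr01 xm1.
  rewrite expr1n divr1 -/gm -/em => hh.
  have -> : 4 * R0 * h * em = R0 * (4 * h * em) by ring.
  by rewrite ler_wpM2l.
have q0 : 0 <= h ^+ 2 / (1 + w ^+ 2).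
  by rewrite divr_ge0 ?sqr_ge0 // addr_ge0 // sqr_ge0.
have hep : 0 <= h * ep by rewrite mulr_ge0 // ltW.
have hem : 0 <= h * em by rewrite mulr_ge0 // ltW.
have -> : K * h * (ep + em) + K * h ^+ 2 / (1 + w ^+ 2) =
   K * (h * ep) + K * (h * em) + K * (h ^+ 2 / (1 + w ^+ 2)) by ring.
have Kge (K' : R) y : 0 <= y -> K' <= K -> K' * y <= K * y by move=> y0 k'; rewrite ler_wpM2r.
have K1K : K1 <= K by rewrite /K -!addrA lerDl !addr_ge0 // mulr_ge0.
have K2K : K2 <= K.
  by have -> : K = K2 + (K1 + K3 + 4 * R0 + Kx) by [rewrite /K; ring]; rewrite lerDl !addr_ge0
    // mulr_ge0.
have K3K : K3 <= K.
  by have -> : K = K3 + (K1 + K2 + 4 * R0 + Kx) by [rewrite /K; ring]; rewrite lerDl !addr_ge0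
    // mulr_ge0.
have K4K : 4 * R0 <= K.
  by have -> : K = 4 * R0 + (K1 + K2 + K3 + Kx) by [rewrite /K; ring]; rewrite lerDl !addr_ge0.
have K5K : Kx <= K by rewrite /K lerDr !addr_ge0 // mulr_ge0.
have K0 : 0 <= K by exact: le_trans K1K.
have gmC : R0 * gm <= K * (h * em).
  by apply: (le_trans gmB); rewrite -mulrA Kge.
have [w2|w2] := ltP w (2 * pi).
  set v := pi / 2 - w / 4.
  have hv : 0 < v < pi / 2 by rewrite /v; clear - w0 w2; apply/andP; split; lra.
  have wv : w = 2 * pi - 4 * v by rewrite /v; clear; field.
  have xv : xp = v - xi by rewrite /xp /b /v; clear; field.
  have key : `|scaled_envelope k m xi w `^ p - R0 * gp| <= K * (h * ep).
    rewrite /gp /ep xv {1}wv; have [vd|vd] := ltP `|v - xi| d.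
      apply: (le_trans (H1 m v h m1 h0 mh hv vd)).
      by rewrite -mulrA Kge // -xv.
    apply: (le_trans (H2 m v h m1 km h0 mh hv vd)).
    by rewrite -mulrA Kge // -xv.
  have -> : scaled_envelope k m xi w `^ p - R0 * (gp + gm) =
     (scaled_envelope k m xi w `^ p - R0 * gp) - R0 * gm by ring.
  apply: (le_trans (ler_normB _ _)).
  rewrite [`|R0 * gm|]ger0_norm ?mulr_ge0 //.
  have : 0 <= K * (h ^+ 2 / (1 + w ^+ 2)) by rewrite mulr_ge0.
  by move: key gmC; move: `|_|; clear; move=> *; lra.
have Z := H3 m w h m1 h0 mh w2.
have gpC : R0 * gp <= K * (h * ep).
  have xp1 : xi <= `|xp| by rewrite ler0_norm /xp /b; clear - xi0 xi1 pi2 w2; lra.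
  have := gauss_far h m%:R s L xp xi hI mh ms L0 xi0 xp1; rewrite -/gp -/ep => hh.
  apply: (@le_trans _ _ (Kx * (h * ep))); last exact: Kge.
  have -> : Kx * (h * ep) = R0 * (4 / xi ^+ 2 * h * ep) by rewrite /Kx; ring.
  by rewrite ler_wpM2l.
have ZC : scaled_envelope k m xi w `^ p <= K * (h ^+ 2 / (1 + w ^+ 2)).
  by apply: (le_trans Z); rewrite -mulrA Kge.
apply: (le_trans (ler_normB _ _)).
rewrite (ger0_norm (powR_ge0 _ _)) [`|R0 * _|]ger0_norm ?mulr_ge0 ?addr_ge0 // mulrDr.
by rewrite [leRHS]addrC; exact: lerD ZC (lerD gpC gmC).
Qed.

End PointwiseAll.

(** * Integration of the pointwise estimate *)

Section IntegralAsymptotics.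
Context {R : realType}.
Local Notation mu := (@lebesgue_measure R).
Implicit Types (a b w xi p h : R).
Import ComplexField.Normc.

Definition gauss_bump a b w : R := expR (- (a * ((b - w) / 4) ^+ 2)).

(** A multiple of the normal density of mean b and variance 8 / a, whose integral is known. *)
Lemma gauss_bumpE a b w : 0 < a -> gauss_bump a b w =
  4 * Num.sqrt (pi / a) * normal_pdf b (Num.sqrt (8 / a)) w.
Proof.
move=> a0; have a8 : 0 <= 8 / a by rewrite divr_ge0 // ltW.
have s0 : Num.sqrt (8 / a) != 0 by rewrite gt_eqF // sqrtr_gt0 divr_gt0.
rewrite /normal_pdf (negbTE s0) /normal_peak /normal_fun sqr_sqrtr //.
have -> : 8 / a * pi *+ 2 = 4 ^+ 2 * (pi / a) by field; rewrite gt_eqF.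
have -> : Num.sqrt (4 ^+ 2 * (pi / a)) = 4 * Num.sqrt (pi / a).
  by rewrite (sqrtrM _ (sqr_ge0 _)) sqrtr_sqr ger0_norm.
have q0 : 4 * Num.sqrt (pi / a) != 0.
  by rewrite mulf_neq0 // gt_eqF // sqrtr_gt0 divr_gt0 // pi_gt0.
rewrite mulrA mulrV ?unitfE // mul1r; congr expR.
by field; rewrite gt_eqF.
Qed.

Lemma integrable_gauss_bump a b : 0 < a -> mu.-integrable setT (EFin \o gauss_bump a b).
Proof.
move=> a0; have := @integrableZl _ _ _ mu setT measurableT (4 * Num.sqrt (pi / a)) _
   (integrable_normal_pdf b (Num.sqrt (8 / a))).
by apply: eq_integrable => // w _; rewrite /= gauss_bumpE // EFinM.
Qed.

Lemma Rintegral_gauss_bump a b : 0 < a -> \int[mu]_w gauss_bump a b w = 4 * Num.sqrt (pi / a).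
Proof.
move=> a0; under eq_Rintegral do rewrite gauss_bumpE //.
rewrite RintegralZl //; last exact: integrable_normal_pdf.
by rewrite /Rintegral integral_normal_pdf mulr1.
Qed.

Lemma gauss_peaksE a b : gauss_peaks a b = (fun w => gauss_bump a b w + gauss_bump a (- b) w).
Proof.
apply/funext => w; rewrite /gauss_peaks /gauss_bump; congr (_ + expR (- (a * _))).
by rewrite -opprD mulNr sqrrN.
Qed.

Lemma integrable_gauss_peaks a b : 0 < a -> mu.-integrable setT (EFin \o gauss_peaks a b).
Proof.
move=> a0; rewrite gauss_peaksE.
have := integrableD measurableT (integrable_gauss_bump a b a0) (integrable_gauss_bump a (- b) a0).
by apply: eq_integrable.
Qed.

Lemma Rintegral_gauss_peaks a b : 0 < a ->
  \int[mu]_w gauss_peaks a b w = 8 * Num.sqrt (pi / a).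
Proof.
move=> a0; rewrite gauss_peaksE RintegralD //; try exact: integrable_gauss_bump.
by rewrite !Rintegral_gauss_bump //; ring.
Qed.

Lemma integral_oneDsqrV :
  (\int[mu]_w ((1 + w ^+ 2)^-1)%:E = (pi : R)%:E)%E.
Proof.
have := @ge0_symfun_integralT R (fun w => (1 + w ^+ 2)^-1).
have -> : [set x : R | 0 <= x] = `[0, +oo[%classic by rewrite set_itvcy.
have := @integral0y_oneDsqr R; rewrite /oneDsqr => -> -> //.
- by rewrite -EFinM; congr EFin; field.
- by move=> x; rewrite invr_ge0 addr_ge0 // sqr_ge0.
- exact: continuous_oneDsqrV.
- by move=> x /=; rewrite sqrrN.
Qed.

Lemma integrable_oneDsqrV : mu.-integrable setT (fun w => ((1 + w ^+ 2)^-1)%:E).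
Proof.
apply/integrableP; split.
  by apply/measurable_EFinP; apply: continuous_measurable_fun; exact: continuous_oneDsqrV.
under eq_integral => w _.
  rewrite gee0_abs; last by rewrite lee_fin invr_ge0 addr_ge0 // sqr_ge0.
  over.
by rewrite integral_oneDsqrV ltry.
Qed.

Lemma measurable_inv_normX k : measurable_fun setT (fun w : R => `|w| ^- k).
Proof.
have -> : (fun w : R => `|w| ^- k) = (fun w => (`|w| ^+ k) `^ (- 1)).
  by apply/funext => w; rewrite powR_inv1 // exprn_ge0.
apply: (measurableT_comp (measurable_powR _)).
by apply: measurable_funX; exact: (continuous_measurable_fun (@norm_continuous _ R)).
Qed.

Lemma measurable_normc_centered_symbol m :
  measurable_fun setT (fun v : R => normc (centered_symbol m v)).
Proof.
under eq_fun do rewrite normc_centered_symbol /csymbol_poly horner_expi /=.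
apply: measurableT_comp; first by apply: continuous_measurable_fun; exact: sqrt_continuous.
by apply: measurable_funD; apply: measurable_funX; apply: measurable_sum => i;
  apply: continuous_measurable_fun => v; apply: differentiable_continuous;
  apply/derivable1_diffP; exact: ex_derive.
Qed.

Lemma measurable_scaled_envelope k m xi : measurable_fun setT (@scaled_envelope R k m xi).
Proof.
apply: measurable_funM => //; apply: measurable_funM; first exact: measurable_inv_normX.
apply: measurable_funM.
  apply: measurable_funX; apply: measurable_funM; last exact: (measurable_inv_normX 1).
  apply: continuous_measurable_fun => w; apply: differentiable_continuous.
  by apply/derivable1_diffP; exact: ex_derive.
apply: (measurableT_comp (measurable_normc_centered_symbol m)).
apply: continuous_measurable_fun => w; apply: differentiable_continuous.
by apply/derivable1_diffP; exact: ex_derive.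
Qed.

(** Adds w = 0, where the envelope is 0 by the convention 0^-1 = 0; both Gaussians are negligible
    there because b / 4 >= 1. *)
Lemma pointwise_total k p xi : 1 < p -> 0 < xi < 3 / 10 -> ln_lambda_deriv xi = 0 ->
  69 / 100 <= lambda_fun xi ->
  exists2 K, 0 <= K &
  forall m h w, (1 < m)%N -> (k <= m)%N -> 0 < h -> m%:R * h ^+ 2 = 1 ->
  `|scaled_envelope k m xi w `^ p -
    freq_weight k p xi * gauss_peaks (m%:R * p * ln_lambda_curv xi) (2 * pi - 4 * xi) w| <=
  K * h * gauss_peaks (m%:R * p / 4) (2 * pi - 4 * xi) w + K * h ^+ 2 / (1 + w ^+ 2).
Proof.
move=> p1 hx D0 hl; have [K K0 H] := pointwise_all k p xi p1 hx D0 hl.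
have /andP[xi0 xi1] := hx; have pi2 := @pi_lower R.
have hxi : 0 < xi < pi / 2 by rewrite xi0 /=; lra.
have R00 : 0 <= freq_weight k p xi by exact: expR_ge0.
have L0 : 2^-1 <= ln_lambda_curv xi by exact: ln_lambda_curv_ge.
exists (K + 4 * freq_weight k p xi); first by rewrite addr_ge0 // mulr_ge0.
move=> m h w m1 km h0 mh.
have G0 a b : 0 <= gauss_peaks a b w by rewrite addr_ge0 // expR_ge0.
have q0 : 0 <= h ^+ 2 / (1 + w ^+ 2).
  by rewrite divr_ge0 ?sqr_ge0 // addr_ge0 // sqr_ge0.
have [w0|w0] := eqVneq w 0; last first.
  apply: (le_trans (H m h w m1 km h0 mh w0)).
  have KK : K <= K + 4 * freq_weight k p xi by rewrite lerDl mulr_ge0.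
  rewrite -[_ * h ^+ 2 / _]mulrA -[leRHS]addrC -[(K + _) * h ^+ 2 / _]mulrA [leRHS]addrC.
  apply: lerD; last exact: ler_wpM2r.
  by apply: ler_wpM2r => //; apply: ler_wpM2r => //; exact: ltW.
have Z0 : scaled_envelope k m xi w `^ p = 0.
  have -> : scaled_envelope k m xi w = 0.
    have m00 : (m == 0)%N = false by case: (m) m1.
    rewrite w0 /scaled_envelope /wavelet_envelope [0 / 4]mul0r sin0.
    have -> : 4 * 0 ^+ 2 / `|0 : R| = 0 :> R by rewrite normr0 invr0 mulr0.
    by rewrite expr0n m00 mul0r mulr0 mul0r.
  by rewrite powR0 // gt_eqF // (lt_trans ltr01).
rewrite Z0 sub0r normrN ger0_norm ?mulr_ge0 //.
have h1 : h <= 1.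
  by rewrite -(@expr_le1 _ 2) ?(ltW h0) // -mh ler_peMl ?sqr_ge0 // ler1n (ltnW m1).
have hI : 0 < h <= 1 by rewrite h0.
have ms : m%:R <= m%:R * p by rewrite ler_peMr // ltW.
apply: (@le_trans _ _ (4 * freq_weight k p xi * h * gauss_peaks (m%:R * p / 4) (2 * pi - 4 * xi)
  w)); last first.
  rewrite -[leLHS]addr0; apply: lerD.
    by rewrite ler_wpM2r // ler_wpM2r ?(ltW h0) // lerDr.
  by rewrite -mulrA mulr_ge0 // addr_ge0 // mulr_ge0.
have -> : 4 * freq_weight k p xi * h * gauss_peaks (m%:R * p / 4) (2 * pi - 4 * xi) w =
  freq_weight k p xi * (4 * h * gauss_peaks (m%:R * p / 4) (2 * pi - 4 * xi) w) by ring.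
rewrite ler_wpM2l // /gauss_peaks w0 subr0 addr0.
have x1 : 1 <= `|(2 * pi - 4 * xi) / 4| by rewrite ger0_norm; clear - xi1 pi2; lra.
have := gauss_far h m%:R (m%:R * p) _ _ 1 hI mh ms L0 ltr01 x1.
rewrite expr1n divr1.
have -> : m%:R * p * ((2 * pi - 4 * xi) / 4) ^+ 2 / 4 =
  m%:R * p / 4 * ((2 * pi - 4 * xi) / 4) ^+ 2 by ring.
move: (expR _) (expR _) => c a hh.
have -> : 4 * h * (c + c) = 4 * h * c + 4 * h * c by ring.
exact: lerD.
Qed.

(** The majorant integrates to K h times a Gaussian integral of order h, plus K pi h^2, hence to
    O(1/m). *)
Lemma scaled_envelope_integral k p xi : 1 < p -> 0 < xi < 3 / 10 -> ln_lambda_deriv xi = 0 ->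
  69 / 100 <= lambda_fun xi ->
  exists2 K, 0 <= K &
  forall m, (1 < m)%N -> (k <= m)%N ->
  mu.-integrable setT (EFin \o (fun w => scaled_envelope k m xi w `^ p)) /\
  `|\int[mu]_w (scaled_envelope k m xi w `^ p) -
    freq_weight k p xi * (8 * Num.sqrt (pi / (m%:R * p * ln_lambda_curv xi)))| <= K / m%:R.
Proof.
move=> p1 hx D0 hl; have [K K0 H] := pointwise_total k p xi p1 hx D0 hl.
have /andP[xi0 xi1] := hx; have pi2 := @pi_lower R.
have hxi : 0 < xi < pi / 2 by rewrite xi0 /=; lra.
have L0 : 2^-1 <= ln_lambda_curv xi by exact: ln_lambda_curv_ge.
have p0 : 0 < p by exact: lt_trans p1.
set R0 := freq_weight k p xi in H *; set L := ln_lambda_curv xi in H L0 *.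
set b := 2 * pi - 4 * xi in H.
exists (K * (8 * Num.sqrt (4 * pi / p)) + K * pi).
  by rewrite addr_ge0 ?mulr_ge0 ?sqrtr_ge0 ?pi_ge0.
move=> m m1 km; have m0 : 0 < m%:R :> R by rewrite ltr0n ltnW.
set h := (Num.sqrt m%:R)^-1 : R.
have h0 : 0 < h by rewrite invr_gt0 sqrtr_gt0.
have h2 : h ^+ 2 = m%:R^-1 by rewrite exprVn sqr_sqrtr // ltW.
have mh : m%:R * h ^+ 2 = 1 by rewrite h2 divff // gt_eqF.
have {}H w := H m h w m1 km h0 mh.
have a10 : 0 < m%:R * p * L by rewrite !mulr_gt0 //; lra.
have a20 : 0 < m%:R * p / 4 by rewrite !mulr_gt0.
pose F w := scaled_envelope k m xi w `^ p.
pose G w := R0 * gauss_peaks (m%:R * p * L) b w.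
pose E w := K * h * gauss_peaks (m%:R * p / 4) b w + K * h ^+ 2 * (1 + w ^+ 2)^-1.
have iG : mu.-integrable setT (EFin \o G).
  have := @integrableZl _ _ _ mu setT measurableT R0 _ (integrable_gauss_peaks _ b a10).
  by apply: eq_integrable.
have iE1 : mu.-integrable setT (EFin \o (fun w => K * h * gauss_peaks (m%:R * p / 4) b w)).
  have := @integrableZl _ _ _ mu setT measurableT (K * h) _ (integrable_gauss_peaks _ b a20).
  by apply: eq_integrable.
have iE2 : mu.-integrable setT (EFin \o (fun w : R => K * h ^+ 2 * (1 + w ^+ 2)^-1)).
  have := @integrableZl _ _ _ mu setT measurableT (K * h ^+ 2) _ integrable_oneDsqrV.
  by apply: eq_integrable.
have iE : mu.-integrable setT (EFin \o E).
  by have := integrableD measurableT iE1 iE2; apply: eq_integrable.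
have mF : measurable_fun setT F.
  by apply: (measurableT_comp (measurable_powR _)); exact: measurable_scaled_envelope.
have iF : mu.-integrable setT (EFin \o F).
  have iGE := integrableD measurableT iG iE.
  apply: (le_integrable measurableT _ _ iGE); first exact/measurable_EFinP.
  move=> w _; rewrite /= lee_fin.
  have F0 : 0 <= F w by exact: powR_ge0.
  have Fl : F w <= G w + E w.
    have := ler_norm (F w - G w); have := H w; rewrite -/(F w) -/(G w) => h3 h4.
    by have := le_trans h4 h3; rewrite lerBlDl.
  by rewrite (ger0_norm F0) (le_trans Fl) // ler_norm.
split=> //.
have iFG : mu.-integrable setT (EFin \o (fun w => F w - G w)).
  by have := integrableB measurableT iF iG; apply: eq_integrable.
have intG : \int[mu]_w G w = R0 * (8 * Num.sqrt (pi / (m%:R * p * L))).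
  by rewrite RintegralZl ?Rintegral_gauss_peaks //; exact: integrable_gauss_peaks.
rewrite -intG -RintegralB //.
apply: (le_trans (le_normr_Rintegral measurableT iFG)).
apply: (@le_trans _ _ (\int[mu]_w E w)).
  apply: le_Rintegral => //.
    have := integrable_norm iFG; by apply: eq_integrable.
  by move=> w _; exact: H.
have -> : \int[mu]_w E w = K * h * (8 * Num.sqrt (pi / (m%:R * p / 4))) + K * h ^+ 2 * pi.
  rewrite RintegralD // RintegralZl //; last exact: integrable_gauss_peaks.
  rewrite Rintegral_gauss_peaks // RintegralZl //; last exact: integrable_oneDsqrV.
  by rewrite /Rintegral integral_oneDsqrV.
have -> : pi / (m%:R * p / 4) = h ^+ 2 * (4 * pi / p).
  by rewrite h2; move: m0; move: (m%:R : R) => M M0; field; rewrite !gt_eqF.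
rewrite sqrtrM ?sqr_ge0 // sqrtr_sqr (gtr0_norm h0) -h2.
by rewrite le_eqVlt; apply/orP; left; apply/eqP; ring.
Qed.

End IntegralAsymptotics.

(** * From the integral to the norm *)

Section NormFormula.
Context {R : realType}.
Local Notation mu := (@lebesgue_measure R).
Local Open Scope complex_scope.
Import ComplexField.Normc.
Implicit Types (w xi p x a : R).

Lemma normc_fourier_shift k m xi w : (1 < m)%N -> w != 0 -> lambda_fun xi != 0 ->
  normc (fourier_shift k%:Z (spline_wavelet m) w) =
  lambda_fun xi ^+ m / Num.sqrt (2 * pi) * scaled_envelope k m xi w.
Proof.
move=> m1 w0 l0; rewrite /fourier_shift normcM normc_fourier_wavelet // -exprnN normcV normcX.
have -> : normc (0 +i* w) = `|w| by rewrite /= expr0n add0r sqrtr_sqr.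
rewrite /scaled_envelope.
have lm : lambda_fun xi ^+ m != 0 by rewrite expf_neq0.
move: (lambda_fun xi ^+ m) lm (Num.sqrt _)^-1 (`|w| ^- k) (wavelet_envelope m w) => c c0 t W E.
by field.
Qed.

(** The closed form of the transform is available only off w = 0, which is a null set. *)
Lemma integral_point_change (f : R -> R) (c : R) : measurable_fun setT f ->
  (\int[mu]_w (if w == 0 then c else f w)%:E = \int[mu]_w (f w)%:E)%E.
Proof.
move=> mf; apply: ae_eq_integral => //.
- apply/measurable_EFinP; apply: measurable_fun_ifT => //.
  by apply: measurable_fun_eqr.
- exact/measurable_EFinP.
exists [set 0]; split.
- exact: measurable_set1.
- exact: lebesgue_measure_set1.
move=> w /=; apply: contra_notP => /eqP w0 _.
by rewrite (negbTE w0).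
Qed.

Lemma cLnorm_fourier_shift k m p xi : (1 < m)%N -> 1 < p -> 0 < lambda_fun xi ->
  mu.-integrable setT (EFin \o (fun w => scaled_envelope k m xi w `^ p)) ->
  cLnorm p (fourier_shift k%:Z (spline_wavelet m)) =
  (lambda_fun xi ^+ m / Num.sqrt (2 * pi) *
   (\int[mu]_w (scaled_envelope k m xi w `^ p)) `^ (1 / p))%:E.
Proof.
move=> m1 p1 l0 iZ; have p0 : 0 < p by exact: lt_trans p1.
set A := lambda_fun xi ^+ m / Num.sqrt (2 * pi).
have A0 : 0 <= A by rewrite divr_ge0 ?sqrtr_ge0 // exprn_ge0 // ltW.
have Z0 w : 0 <= scaled_envelope k m xi w.
  apply: divr_ge0; last by rewrite exprn_ge0 // ltW.
  by apply: mulr_ge0; [rewrite invr_ge0 exprn_ge0 | exact: wavelet_envelope_ge0].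
rewrite /cLnorm unlock /=.
set F := fourier_shift _ _.
have -> : (fun w : R => `|(normc (F w))%:E| `^ p)%E =
    (fun w => (if w == 0 then normc (F 0) `^ p else A `^ p * (scaled_envelope k m xi w `^ p))%:E).
  apply/funext => w; rewrite abse_EFin poweR_EFin ger0_norm ?normc_ge0 //.
  have [->//|w0] := eqVneq w 0.
  rewrite /F (normc_fourier_shift k m xi w m1 w0 (lt0r_neq0 l0)) -/A.
  by rewrite (powRM _ A0 (Z0 w)).
rewrite integral_point_change; last first.
  apply: measurable_funM => //; apply: (measurableT_comp (measurable_powR _)).
  exact: measurable_scaled_envelope.
have -> : (\int[mu]_w (A `^ p * scaled_envelope k m xi w `^ p)%:E =
    (A `^ p * \int[mu]_w (scaled_envelope k m xi w `^ p))%:E)%E.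
  rewrite EFinM /Rintegral fineK; last exact: integrable_fin_num.
  by rewrite -integralZl.
have J0 : 0 <= \int[mu]_w (scaled_envelope k m xi w `^ p).
  by apply: Rintegral_ge0 => w _; exact: powR_ge0.
rewrite poweR_EFin powRM ?powR_ge0 // -powRrM divff ?gt_eqF // powRr1 //.
by rewrite div1r.
Qed.

(** The power x^a lies between 1 and x, so taking the p-th root does not enlarge the relative
    error. *)
Lemma norm_powR_sub1 x a : 0 <= x -> 0 < a <= 1 -> `|x `^ a - 1| <= `|x - 1|.
Proof.
move=> x0 /andP[a0 a1]; have [x1|x1] := leP 1 x.
  have h1 : 1 <= x `^ a by have := ler_powR x1 (ltW a0); rewrite powRr0.
  by rewrite !ger0_norm ?subr_ge0 // lerD2r ler1_powR.
move: x0; rewrite le_eqVlt => /predU1P[<-|x0].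
  by rewrite powR0 // gt_eqF.
have xI : 0 < x <= 1 by rewrite x0 ltW.
have h1 : x `^ a <= 1.
  have := @ge0_ler_powR R a (ltW a0) x 1; rewrite powR1; apply; rewrite ?nnegrE ?(ltW x0) //.
  exact: ltW.
rewrite !ler0_norm ?subr_le0 ?(ltW x1) // !opprB lerD2l lerN2.
exact: ger1_powR.
Qed.

Definition main_integral (k : nat) p xi (m : nat) : R :=
  freq_weight k p xi * (8 * Num.sqrt (pi / (m%:R * p * ln_lambda_curv xi))).

(** Here 8^(1/p) = 2^(3/p) and sqrt(pi / (m p L)) = sqrt(2 pi) / sqrt(2 L m p); the power sqrt(2
    pi)^(1/p) meets the prefactor 1 / sqrt(2 pi) and leaves the exponent 1 - 1/p in the
    denominator. *)
Lemma main_integralE k p xi m : 1 < p -> 0 < xi < pi / 2 -> (0 < m)%N ->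
  lambda_fun xi ^+ m / Num.sqrt (2 * pi) * main_integral k p xi m `^ (1 / p) =
  2 `^ (3 / p) / Num.sqrt (2 * pi) `^ (1 - 1 / p)
   * ((2 * pi - 4 * xi) ^- k
      / Num.sqrt (2 * Lambda_fun xi * m%:R * p) `^ (1 / p))
   * lambda_fun xi ^+ m.
Proof.
move=> p1 hxi m0; have p0 : 0 < p by exact: lt_trans p1.
have L0 : 0 < ln_lambda_curv xi by apply: lt_le_trans (ln_lambda_curv_ge _ hxi); rewrite invr_gt0.
have /andP[xi0 xi1] := hxi; have q0 : 0 < 2 * pi - 4 * xi by lra.
have pi0 := @pi_gt0 R.
have M0 : 0 < m%:R :> R by rewrite ltr0n.
rewrite Lambda_funE // /main_integral freq_weightE //.
set L := ln_lambda_curv xi in L0 *.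
set t := Num.sqrt (2 * pi); have t0 : 0 < t by rewrite sqrtr_gt0 mulr_gt0.
set S := Num.sqrt (2 * L * m%:R * p); have S0 : 0 < S by rewrite sqrtr_gt0 !mulr_gt0.
have -> : Num.sqrt (pi / (m%:R * p * L)) = t / S.
  have -> : pi / (m%:R * p * L) = 2 * pi * (2 * L * m%:R * p)^-1.
    by move: M0 L0; move: (m%:R : R) (L) => M L' M0 L0; field; rewrite !gt_eqF.
  have h1 : 0 <= 2 * pi :> R by rewrite mulr_ge0 // ltW.
  have h2 : 0 <= 2 * L * m%:R * p by rewrite !mulr_ge0 // ltW.
  by rewrite (sqrtrM _ h1) (sqrtrV h2).
have qk : 0 <= (2 * pi - 4 * xi) ^- k by rewrite invr_ge0 exprn_ge0 // ltW.
rewrite powRM ?powR_ge0 //; last by rewrite mulr_ge0 // divr_ge0 ?ltW.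
rewrite -powRrM div1r mulfV ?gt_eqF // powRr1 //.
rewrite powRM ?divr_ge0 ?(ltW t0) ?(ltW S0) // powRM ?invr_ge0 ?(ltW t0) ?(ltW S0) //.
have -> : 8 `^ p^-1 = 2 `^ (3 / p) :> R.
  by rewrite powRrM; congr (_ `^ _); rewrite powR_mulrn //; ring.
have -> : S^-1 `^ p^-1 = (S `^ p^-1)^-1.
  by rewrite -(powR_inv1 (ltW S0)) -powRrM mulN1r powRN.
have tE : t = t `^ (1 - p^-1) * t `^ p^-1.
  rewrite -powRD ?subrK ?powRr1 ?(ltW t0) //.
  by apply/implyP => _; rewrite gt_eqF.
rewrite {1}tE.
have t1 : 0 < t `^ (1 - p^-1) by exact: powR_gt0.
have t2 : 0 < t `^ p^-1 by exact: powR_gt0.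
have s2 : 0 < S `^ p^-1 by exact: powR_gt0.
move: t1 t2 s2; move: (t `^ _) (t `^ _) (S `^ _) (2 `^ _) (_ ^- k) => a b c d e a0 b0 c0.
by field; rewrite !gt_eqF.
Qed.

End NormFormula.

Section RelativeError.
Context {R : realType}.
Local Notation mu := (@lebesgue_measure R).
Implicit Types (p xi u v : R).

(** Both points are zeros of (ln lambda)', which drops by at least v - u from u to v. *)
Lemma xi2_unique u v : 0 < u < pi / 2 -> xi2_equation u ->
  0 < v < pi / 2 -> xi2_equation v -> u = v.
Proof.
wlog uv : u v / u <= v.
  by move=> H hu Eu hv Ev; have [/H|/ltW/H] := leP u v; [apply | move=> ->].
move=> hu /(xi2_equationP _ hu) Du hv /(xi2_equationP _ hv) Dv.
have := ln_lambda_deriv_decr _ _ hu hv uv; rewrite Du Dv => h.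
by apply/eqP; rewrite eq_le uv /=; lra.
Qed.

(** An exact quotient, so that the asymptotic formula becomes an identity and the content lies in
    the bound on this sequence. *)
Definition relative_error (k : nat) p xi (m : nat) : R :=
  (\int[mu]_w (scaled_envelope k m xi w `^ p)) `^ (1 / p) /
  main_integral k p xi m `^ (1 / p) - 1.

Lemma main_integral_gt0 k p xi m : 1 < p -> 0 < xi < pi / 2 -> (0 < m)%N ->
  0 < main_integral k p xi m.
Proof.
move=> p1 hxi m0; have p0 : 0 < p by exact: lt_trans p1.
have L0 : 0 < ln_lambda_curv xi by apply: lt_le_trans (ln_lambda_curv_ge _ hxi); rewrite invr_gt0.
rewrite !mulr_gt0 ?expR_gt0 // sqrtr_gt0 divr_gt0 ?pi_gt0 // !mulr_gt0 //.
by rewrite ltr0n.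
Qed.

(** The main term at m is its value at 1 divided by sqrt(m), so the absolute error K / m becomes a
    relative error of order m^(-1/2). *)
Lemma relative_error_le k p xi : 1 < p -> 0 < xi < 3 / 10 -> ln_lambda_deriv xi = 0 ->
  69 / 100 <= lambda_fun xi ->
  exists2 C, 0 < C & forall m, (1 < m)%N -> (k <= m)%N ->
    `|relative_error k p xi m| <= C * m%:R `^ (- (1 / 2)).
Proof.
move=> p1 hx D0 hl; have [K K0 H] := scaled_envelope_integral k p xi p1 hx D0 hl.
have /andP[xi0 xi1] := hx; have pi2 := @pi_lower R.
have hxi : 0 < xi < pi / 2 by rewrite xi0 /=; lra.
have p0 : 0 < p by exact: lt_trans p1.
set G1 := main_integral k p xi 1.
have G10 : 0 < G1 by exact: main_integral_gt0.
(* The summand 1 only makes the constant positive. *)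
exists (K / G1 + 1); first by rewrite ltr_wpDl // divr_ge0 // ltW.
move=> m m1 km; have m0 : 0 < m%:R :> R by rewrite ltr0n ltnW.
have [iZ HJ] := H m m1 km.
set G := main_integral k p xi m.
have G0 : 0 < G by apply: main_integral_gt0 => //; exact: ltnW.
rewrite -/(main_integral k p xi m) -/G in HJ.
set J := \int[mu]_w _ in HJ.
have J0 : 0 <= J by apply: Rintegral_ge0 => w _; exact: powR_ge0.
have GE : G = G1 / Num.sqrt m%:R.
  rewrite /G /G1 /main_integral mul1r.
  have L0 : 0 < ln_lambda_curv xi by apply: lt_le_trans (ln_lambda_curv_ge _ hxi); rewrite invr_gt0.
  have -> : pi / (m%:R * p * ln_lambda_curv xi) = pi / (p * ln_lambda_curv xi) * m%:R^-1.
    by move: m0 L0; move: (m%:R : R) (ln_lambda_curv xi) => M L M0 L0; field; rewrite !gt_eqF.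
  have h1 : 0 <= pi / (p * ln_lambda_curv xi).
    by rewrite divr_ge0 ?pi_ge0 // mulr_ge0 // ltW.
  by rewrite (sqrtrM _ h1) (sqrtrV (ltW m0)); ring.
have E : relative_error k p xi m = (J / G) `^ (1 / p) - 1.
  rewrite /relative_error -/J -/G; congr (_ - 1).
  rewrite -{1}[J](divfK (lt0r_neq0 G0)) powRM ?divr_ge0 ?(ltW G0) //.
  by rewrite mulfK // gt_eqF // powR_gt0.
rewrite E; have aI : 0 < 1 / p <= 1.
  by rewrite divr_gt0 //= ler_pdivrMr // mul1r ltW.
rewrite (le_trans (norm_powR_sub1 _ _ (divr_ge0 J0 (ltW G0)) aI)) //.
have -> : J / G - 1 = (J - G) / G by rewrite mulrBl divff // gt_eqF.
rewrite normrM normfV (gtr0_norm G0) ler_pdivrMr // (le_trans HJ) //.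
have sm : 0 < Num.sqrt (m%:R : R) by rewrite sqrtr_gt0.
have -> : m%:R `^ (- (1 / 2)) = (Num.sqrt m%:R)^-1 :> R.
  by rewrite powRN div1r powR12_sqrt // ltW.
have mE : m%:R = Num.sqrt m%:R * Num.sqrt m%:R :> R.
  by rewrite -expr2 sqr_sqrtr // ltW.
have -> : K / m%:R = K / (Num.sqrt m%:R * Num.sqrt m%:R) by rewrite -mE.
rewrite GE; move: sm; move: (Num.sqrt m%:R) => t t0.
have -> : (K / G1 + 1) / t * (G1 / t) = (K + G1) / (t * t) by field; rewrite !gt_eqF.
by rewrite ler_wpM2r ?invr_ge0 ?mulr_ge0 ?(ltW t0) // lerDl ltW.
Qed.

End RelativeError.

Theorem theorem5 (R : realType) (p : R) (k : nat) (hp : 1 < p) :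
  exists xi2 : R,
    let lambda2 := lambda_fun xi2 in
    let Lambda2 := Lambda_fun xi2 in
    [/\ unique (fun u : R => (0 < u < pi / 2) /\ xi2_equation u) xi2,
        decimal_prefix 0 [:: 2; 8; 5; 3]%N xi2,
        decimal_prefix 0 [:: 6; 9; 7; 0; 6]%N lambda2,
        decimal_prefix 1 [:: 1; 2; 2; 2; 9]%N Lambda2 &
        exists2 eps : nat -> R,
          eps =O_\oo (fun m : nat => m%:R `^ (- (1 / 2))) &
          \forall m \near \oo,
            cLnorm p (fourier_shift k%:Z (spline_wavelet m)) =
            (2 `^ (3 / p) / Num.sqrt (2 * pi) `^ (1 - 1 / p)
             * ((2 * pi - 4 * xi2) ^- k
                / Num.sqrt (2 * Lambda2 * m%:R * p) `^ (1 / p))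
             * lambda2 ^+ m * (1 + eps m))%:E].
Proof.
have [xi hu Exi] := @xi2_exists R.
have hxi := xi2_quarter _ hu.
have D0 : ln_lambda_deriv xi = 0 by exact/xi2_equationP.
have Pxi := xi2_prefix _ hu; have Pl := lambda2_prefix _ hu.
have hx : 0 < xi < 3 / 10.
  have /andP[xi0 _] := hxi; move: Pxi; rewrite /decimal_prefix /= => /andP[_ h].
  by rewrite xi0 /=; lra.
have hl : 69 / 100 <= lambda_fun xi.
  by move: Pl; rewrite /decimal_prefix /= => /andP[h _]; lra.
have [C C0 HC] := relative_error_le k p xi hp hx D0 hl.
exists xi; split=> //.
- by split=> // v [hv Ev]; exact: xi2_unique.
- exact: Lambda2_prefix.
exists (relative_error k p xi).
  apply/eqO_exP; exists C => //; near=> m.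
  rewrite [`|_ `^ _|]ger0_norm ?powR_ge0 //.
  by apply: HC; near: m; exact: nbhs_infty_ge.
near=> m.
have m1 : (1 < m)%N by near: m; exact: nbhs_infty_ge.
have km : (k <= m)%N by near: m; exact: nbhs_infty_ge.
have [K K0 HK] := scaled_envelope_integral k p xi hp hx D0 hl.
have [iZ _] := HK m m1 km.
have l0 := lambda_fun_gt0 _ hxi.
rewrite (cLnorm_fourier_shift _ _ _ _ m1 hp l0 iZ); congr EFin.
rewrite -(main_integralE k p xi m hp hxi (ltnW m1)) /relative_error.
have G0 : main_integral k p xi m `^ (1 / p) != 0.
  by rewrite gt_eqF // powR_gt0 // main_integral_gt0 // ltnW.
move: G0; move: (main_integral k p xi m `^ (1 / p)) (_ `^ (1 / p)) => g j g0.
move: (lambda_fun xi ^+ m / _) => c.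
by field.
Unshelve. all: by end_near.
Qed.
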